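(* Let $k$ be a finitely generated field of characteristic zero, let $A$ be a torsion-free abelian minimax group, and let $P$ be a faithful prime ideal of $kA$. Let $R=kA/P$ and let $h$ be the field of fractions of $R$, so that $A\le h^*$ via the natural map. Let $C$ be a finitely generated dense subgroup of $A$, and let $\tau$ be the set of all roots of $1$ of degree $p^n$ for all $p\in\pi(A/C)$ and all positive integers $n$, together with a primitive $4$-th root of $1$. Let $f$ be the field obtained by adjoining to $h$ all elements of $\tau$ (inside an algebraic closure of $h$), let $s$ be the subfield of $f$ generated over $k$ by $\tau$ and $C$, and let $B=A\cap s^*$. Let $D$ be a dense subgroup of $C$, let $d$ be the subfield of $f$ generated over $k$ by $D$ and $t(s^* )$, and let $H=A\cap d^*$. Then: (i) $B$ and $H$ are finitely generated dense subgroups of $A$ and $H\le B$; (ii) both $B$ and $H$ control the ideal $P$.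
   Context: An ideal $I$ of $kA$ is faithful if $A\cap(1+I)=\{1\}$; a subgroup $H\le A$ controls $I$ if $I=(I\cap kH)kA$. A subgroup $B$ of an abelian group $A$ is dense if for every $a\in A$ some positive power $a^n$ lies in $B$ (i.e. $A/B$ is torsion). An abelian group is minimax if it has a finite series each of whose factors is cyclic or quasicyclic. $\pi(X)$ is the set of primes dividing orders of elements of a torsion group $X$; $t(s^* )$ is the group of roots of unity in $s$. *)

(* Defs.v *)
From HB Require Import structures.
From mathcomp Require Import all_boot all_order all_algebra.
From mathcomp Require Import finmap.
Set Implicit Arguments. Unset Strict Implicit. Unset Printing Implicit Defensive.
Import Order.TTheory GRing.Theory Num.Theory.
Local Open Scope fset_scope.
Local Open Scope ring_scope.

Section GA.
Variables (k : fieldType) (A : zmodType).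
Definition grpalg := {fsfun A -> k with 0}.
Definition ga0 : grpalg := [fsfun a in fset0 => (0 : k) | 0].
Definition ga_of (g : A) : grpalg := [fsfun a in [fset g] => (1 : k) | 0].
Definition ga1 : grpalg := ga_of 0.
Definition ga_add (x y : grpalg) : grpalg :=
  [fsfun a in finsupp x `|` finsupp y => x a + y a | 0].
Definition ga_shift (c : k) (g : A) (y : grpalg) : grpalg :=
  [fsfun a in [fset b + g | b in finsupp y] => c * y (a - g) | 0].
Definition ga_mul (x y : grpalg) : grpalg :=
  \big[ga_add/ga0]_(g <- finsupp x) ga_shift (x g) g y.
End GA.

Section GAIdeals.
Variables (k : fieldType) (A : zmodType).
Local Notation kA := (grpalg k A).

Definition ga_ideal (I : kA -> Prop) : Prop :=
  [/\ I (ga0 k A),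
      (forall x y, I x -> I y -> I (ga_add x y)) &
      (forall r x, I x -> I (ga_mul r x))].

Definition ga_prime_ideal (I : kA -> Prop) : Prop :=
  [/\ ga_ideal I, ~ I (ga1 k A) &
      (forall x y, I (ga_mul x y) -> I x \/ I y)].

(* faithful: A ∩ (1 + I) = {1} (A written additively, so 1_A is 0) *)
Definition ga_faithful (I : kA -> Prop) : Prop :=
  forall a : A, (exists2 x, I x & ga_of k a = ga_add (ga1 k A) x) -> a = 0.

Definition ga_supported (H : A -> Prop) (x : kA) : Prop :=
  forall a, a \in finsupp x -> H a.

Definition controls (H : A -> Prop) (I : kA -> Prop) : Prop :=
  forall x, I x <->
    exists l : seq (kA * kA),
      (forall p, p \in l -> I p.1 /\ ga_supported H p.1) /\
      x = foldr (@ga_add k A) (ga0 k A) [seq ga_mul p.1 p.2 | p <- l].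

Definition ga_eval (Om : fieldType) (phi : {rmorphism k -> Om}) (chi : A -> Om)
  (x : kA) : Om := \sum_(a <- finsupp x) phi (x a) * chi a.
End GAIdeals.

Section AbGroups.
Variable A : zmodType.

Definition is_subgroup (U : A -> Prop) : Prop :=
  U 0 /\ (forall x y, U x -> U y -> U (x - y)).

Definition torsion_free : Prop :=
  forall (a : A) (n : nat), (0 < n)%N -> a *+ n = 0 -> a = 0.

Definition dense_in (X B : A -> Prop) : Prop :=
  forall a, X a -> exists n : nat, (0 < n)%N /\ B (a *+ n).

Definition dense (B : A -> Prop) : Prop := dense_in (fun _ => True) B.

Definition fg_subgroup (B : A -> Prop) : Prop :=
  exists gs : seq A, forall x, B x <->
    exists c : nat -> int, x = \sum_(i < size gs) gs`_i *~ c i.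

Definition cyclic_factor (U V : A -> Prop) : Prop :=
  exists2 g, V g & forall v, V v -> exists z : int, U (v - g *~ z).

(* V/U is quasicyclic (Prüfer p-group), given by its standard presentation
   <x_0, x_1, ... | p x_0 = 0, p x_(n+1) = x_n> with x_0 <> 0 *)
Definition quasicyclic_factor (U V : A -> Prop) : Prop :=
  exists p : nat, prime p /\ exists g : nat -> A,
    [/\ forall n, V (g n),
        ~ U (g 0%N), U (g 0%N *+ p),
        forall n, U (g n.+1 *+ p - g n) &
        forall v, V v -> exists (n : nat) (z : int), U (v - g n *~ z)].

Definition minimax : Prop :=
  exists (n : nat) (S : nat -> A -> Prop),
    [/\ forall i, is_subgroup (S i),
        forall x, S 0%N x <-> x = 0,
        forall x, S n x,
        forall i x, (i < n)%N -> S i x -> S i.+1 x &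
        forall i, (i < n)%N ->
          cyclic_factor (S i) (S i.+1) \/ quasicyclic_factor (S i) (S i.+1)].

Definition pi_quot (C : A -> Prop) (p : nat) : Prop :=
  prime p /\ exists (a : A) (n : nat),
    [/\ (0 < n)%N, (p %| n)%N, C (a *+ n) &
        forall m, (0 < m)%N -> (m < n)%N -> ~ C (a *+ m)].
End AbGroups.

Inductive field_gen (F : fieldType) (S : F -> Prop) : F -> Prop :=
| fg_in x : S x -> field_gen S x
| fg_one : field_gen S 1
| fg_add x y : field_gen S x -> field_gen S y -> field_gen S (x + y)
| fg_opp x : field_gen S x -> field_gen S (- x)
| fg_mul x y : field_gen S x -> field_gen S y -> field_gen S (x * y)
| fg_inv x : field_gen S x -> field_gen S (x^-1).

Definition fin_gen_field (F : fieldType) : Prop :=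
  exists s : seq F, forall x, field_gen (fun y => y \in s) x.

(* Main.v *)
(* Control. Let K be s or d. Every root of unity in chi(A)K^* lies in K: for s by the choice
   of tau, for d because the roots of unity of s were adjoined. If b in chi(A)K^* has order m
   modulo K^*, the constant term of a factor of degree r of X^m - b^m is b^r times a root of
   unity, so X^m - b^m is irreducible over K and b has trace zero when m > 1. Hence elements of
   chi(A) that are distinct modulo K^* are linearly independent over K, and an element of P
   splits along the cosets of A meet K^*.

   Finite generation. Since A is torsion-free it suffices that B^N lies in C for some N > 0.
   Each b in B lies in a cyclotomic extension of the finitely generated field k(C) and has a
   power in C; because Galois groups of cyclotomic extensions are abelian (Schinzel), b^w is in
   k(C) up to a root of unity, w being the exponent of the roots of unity of k(C). It remains to
   bound the exponent of the radicals of C in k(C). Over Q, the radicals with exponents reduced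
   modulo n have bounded height and degree, so they are finitely many (Northcott). The bound
   passes to a simple transcendental extension by specialization along places, and to finite
   extensions because only a bound on the degree of the radical is used. *)
Require Import Defs.
From HB Require Import structures.
From mathcomp Require Import all_boot all_order all_algebra all_field all_solvable.
From mathcomp Require Import finmap boolp ring.
Set Implicit Arguments. Unset Strict Implicit. Unset Printing Implicit Defensive.
Import Order.TTheory GRing.Theory Num.Theory.
Local Open Scope ring_scope.

(** * Spans and stable families *)

(** Fields are handled through embeddings [inc] into one algebraically closed field, and a finite
    extension is represented by a finite list whose span is preserved by multiplication. Such a list
    yields degree bounds, through a characteristic polynomial, and traces. The obstacle in bounding
    radicals is a transcendental generator: a specialization may identify distinct monomials, or
    make them differ by torsion, and then the residue of x^M says too little about x^M. The remedy
    is to keep one generator of infinite order from becoming torsion; exponent vectors with torsion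
    value then form a group of smaller rank, and induction treats the error. Places serve as
    specializations because they extend to any prescribed radical, whose residue keeps a bounded
    degree. Injectivity of [chi], which comes from faithfulness, and torsion-freeness of A finally
    remove the roots of unity introduced by Schinzel's argument. *)

Lemma horner_map_coef (F L : fieldType) (inc : {rmorphism F -> L}) (p : {poly F}) x :
  (map_poly inc p).[x] = \sum_(i < size p) inc p`_i * x ^+ i.
Proof.
rewrite horner_coef size_map_poly; apply: eq_bigr => i _.
by rewrite coef_map.
Qed.

Lemma horner_map_wide (F L : fieldType) (inc : {rmorphism F -> L}) (p : {poly F}) n x :
  (size p <= n)%N -> (map_poly inc p).[x] = \sum_(i < n) inc p`_i * x ^+ i.
Proof.
move=> sp; rewrite (@horner_coef_wide _ n) ?size_map_poly //.
by apply: eq_bigr => i _; rewrite coef_map.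
Qed.

Section Span.
Variables (F L : fieldType) (inc : {rmorphism F -> L}).

Definition span (S : seq L) (z : L) : Prop :=
  exists c : nat -> F, z = \sum_(i < size S) inc (c i) * S`_i.

Lemma span0 S : span S 0.
Proof. by exists (fun=> 0); rewrite big1 // => i _; rewrite rmorph0 mul0r. Qed.

Lemma spanD S x y : span S x -> span S y -> span S (x + y).
Proof.
move=> [c ->] [d ->]; exists (fun i => c i + d i).
by rewrite -big_split; apply: eq_bigr => i _; rewrite rmorphD mulrDl.
Qed.

Lemma spanZ S a x : span S x -> span S (inc a * x).
Proof.
move=> [c ->]; exists (fun i => a * c i).
by rewrite mulr_sumr; apply: eq_bigr => i _; rewrite rmorphM mulrA.
Qed.

Lemma span_mem S s : s \in S -> span S s.
Proof.
move=> sS; exists (fun i => (i == index s S)%:R).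
have lt_s : (index s S < size S)%N by rewrite index_mem.
rewrite (bigD1 (Ordinal lt_s)) //= eqxx rmorph1 mul1r nth_index //.
rewrite big1 ?addr0 // => i /eqP ne_i.
case: eqP => [e|_]; first by case: ne_i; apply: val_inj.
by rewrite rmorph0 mul0r.
Qed.

Lemma span_ind S (P : L -> Prop) : P 0 -> (forall x y, P x -> P y -> P (x + y)) ->
  (forall a s, s \in S -> P (inc a * s)) -> forall z, span S z -> P z.
Proof.
move=> P0 PD PZ z [c ->]; apply: big_ind => // i _.
by apply: PZ; apply: mem_nth.
Qed.

Lemma span_sum S (I : Type) (r : seq I) (E : I -> L) :
  (forall i, span S (E i)) -> span S (\sum_(i <- r) E i).
Proof. by move=> h; apply: big_ind => // [|x y]; [exact: span0|exact: spanD]. Qed.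

Lemma span_trans S S' : (forall s, s \in S -> span S' s) ->
  forall z, span S z -> span S' z.
Proof.
move=> h; apply: (span_ind (span0 S')); first exact: spanD.
by move=> a s sS; apply/spanZ/h.
Qed.

(** The list may be dependent or repeat entries. One [S] can serve many x at once; closure under
    sums, products and inverses of algebraic elements then bounds all their degrees by [size S],
    once [S] has a nonzero entry. *)
Definition stable (S : seq L) (x : L) : Prop := forall s, s \in S -> span S (x * s).

Lemma stable_span S x z : stable S x -> span S z -> span S (x * z).
Proof.
move=> hx hz; elim/span_ind: hz => [|y y' hy hy'|a s sS].
- by rewrite mulr0; exact: span0.
- by rewrite mulrDr; exact: spanD.
- by rewrite mulrCA; apply/spanZ/hx.
Qed.

Lemma stableM S x y : stable S x -> stable S y -> stable S (x * y).
Proof. by move=> hx hy s sS; rewrite -mulrA; apply: stable_span => //; exact: hy. Qed.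

Lemma stableD S x y : stable S x -> stable S y -> stable S (x + y).
Proof. by move=> hx hy s sS; rewrite mulrDl; apply: spanD; [exact: hx|exact: hy]. Qed.

Lemma stable_const S a : stable S (inc a).
Proof. by move=> s sS; apply/spanZ/span_mem. Qed.

Lemma stable1 S : stable S 1.
Proof. by rewrite -(rmorph1 inc); exact: stable_const. Qed.

Lemma stableX S x n : stable S x -> stable S (x ^+ n).
Proof.
by move=> hx; elim: n => [|n IHn]; rewrite ?expr0 ?exprS; [exact: stable1|exact: stableM].
Qed.

Lemma stable_horner S x (p : {poly F}) : stable S x -> stable S (map_poly inc p).[x].
Proof.
move=> hx; rewrite horner_map_coef; apply: big_ind => [||i _].
- by rewrite -(rmorph0 inc); exact: stable_const.
- by move=> u v; exact: stableD.
- by apply: stableM; [exact: stable_const|exact: stableX].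
Qed.

Definition prodseq (S U : seq L) := [seq s * u | s <- S, u <- U].

Lemma size_prodseq S U : size (prodseq S U) = (size S * size U)%N.
Proof. by rewrite size_allpairs. Qed.

Lemma span_prod S U x y : span S x -> span U y -> span (prodseq S U) (x * y).
Proof.
move=> hx hy; elim/span_ind: hx => [|x1 x2 h1 h2|a s sS].
- by rewrite mul0r; exact: span0.
- by rewrite mulrDl; exact: spanD.
rewrite -mulrA; apply: spanZ; elim/span_ind: hy => [|x1 x2 h1 h2|b u uU].
- by rewrite mulr0; exact: span0.
- by rewrite mulrDr; exact: spanD.
rewrite mulrCA; apply/spanZ/span_mem.
by apply/allpairsP; exists (s, u).
Qed.

Lemma stable_prodl S U x : stable S x -> stable (prodseq S U) x.
Proof.
move=> hx _ /allpairsP [[s u] /= [sS uU ->]]; rewrite mulrA.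
by apply: span_prod; [exact: hx|exact: span_mem].
Qed.

Lemma stable_prodr S U x : stable U x -> stable (prodseq S U) x.
Proof.
move=> hx _ /allpairsP [[s u] /= [sS uU ->]]; rewrite mulrCA.
by apply: span_prod; [exact: span_mem|exact: hx].
Qed.

Definition powseq (x : L) n := [seq x ^+ i | i <- iota 0 n].


Lemma mem_powseq x n i : (i < n)%N -> x ^+ i \in powseq x n.
Proof. by move=> lt; apply/mapP; exists i => //; rewrite mem_iota. Qed.

Lemma stable_powseq x (p : {poly F}) : p != 0 -> root (map_poly inc p) x ->
  stable (powseq x (size p).-1) x.
Proof.
move=> p0 /eqP; have sp : size p = (size p).-1.+1.
  by rewrite prednK // lt0n size_poly_eq0.
rewrite (@horner_map_wide _ _ _ _ (size p)) // sp big_ord_recr /=.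
rewrite -/(lead_coef p) => e s /mapP [i].
rewrite mem_iota add0n => /= lt_i ->; rewrite -exprS.
have [lt|ge] := ltnP i.+1 (size p).-1; first by apply/span_mem/mem_powseq.
have -> : i.+1 = (size p).-1 by apply/eqP; rewrite eqn_leq ge andbT.
have l0 : inc (lead_coef p) != 0 by rewrite fmorph_eq0 lead_coef_eq0.
move/eqP: e; rewrite addrC addr_eq0 => /eqP e.
have -> : x ^+ (size p).-1 = inc (- (lead_coef p)^-1) *
   \sum_(i < (size p).-1) inc p`_i * x ^+ i.
  by rewrite rmorphN mulNr -mulrN -e fmorphV mulKf.
apply/spanZ/span_sum => j; apply/spanZ/span_mem/mem_powseq/ltn_ord.
Qed.

Definition pdeg (N : nat) (x : L) : Prop :=
  exists p : {poly F}, [/\ p != 0, (size p <= N.+1)%N & root (map_poly inc p) x].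

Lemma pdeg_stable N x : pdeg N x -> exists S, [/\ (size S <= N)%N, 1 \in S & stable S x].
Proof.
move=> [p [p0 sp rp]]; exists (powseq x (size p).-1); split.
- by rewrite size_map size_iota; case: (size p) sp.
- rewrite -(expr0 x); apply: mem_powseq; case E : (size p) => [|[|n]] //.
    by move/eqP: E; rewrite size_poly_eq0 (negPf p0).
  move/eqP/size_poly1P: E => [c c0 E].
  by move: rp; rewrite E map_polyC /root hornerC fmorph_eq0 (negPf c0).
- exact: stable_powseq.
Qed.

Lemma stable_matrix S x : stable S x -> exists M : 'M[F]_(size S),
  \row_j S`_j *m map_mx inc M = x *: \row_j S`_j.
Proof.
move=> hx; have h (i : 'I_(size S)) : exists c : nat -> F,
   x * S`_i = \sum_(j < size S) inc (c j) * S`_j by apply/hx/mem_nth.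
have [c hc] := choice h; exists (\matrix_(j, i) c i j).
apply/rowP => i; rewrite !mxE hc; apply: eq_bigr => j _.
by rewrite !mxE mulrC.
Qed.

(** As [S] may be dependent, the matrix of multiplication by x is not unique. Any choice has the row
    [S] as an eigenvector over L with eigenvalue x, nonzero because of s, and its characteristic
    polynomial has degree [size S]. *)
Lemma stable_pdeg S x s : s \in S -> s != 0 -> stable S x -> pdeg (size S) x.
Proof.
move=> sS s0 /stable_matrix [M hM]; exists (char_poly M); split.
- exact: monic_neq0 (char_poly_monic M).
- by rewrite size_char_poly.
rewrite map_char_poly -eigenvalue_root_char; apply/eigenvalueP.
exists (\row_j S`_j) => //; apply: contra s0 => /eqP/rowP h.
have lt_s : (index s S < size S)%N by rewrite index_mem.
by move: (h (Ordinal lt_s)); rewrite !mxE /= nth_index // => ->.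
Qed.

Lemma pdeg_leq N N' x : (N <= N')%N -> pdeg N x -> pdeg N' x.
Proof. by move=> le [p [p0 sp rp]]; exists p; split=> //; exact: leq_trans sp _. Qed.

Lemma algebraic_pdeg x : algebraicOver inc x -> exists N, pdeg N x.
Proof. by move=> [p p0 rp]; exists (size p), p; split. Qed.

Lemma pdeg_algebraic N x : pdeg N x -> algebraicOver inc x.
Proof. by move=> [p [p0 _ rp]]; exists p. Qed.

(** Divide p by X until its constant term is nonzero; then p = q X + p_0 gives the inverse as - q(x)
    / p_0. For x = 0 the convention 0^-1 = 0 is used. *)
Lemma algebraic_inv_horner x : algebraicOver inc x ->
  exists q : {poly F}, x^-1 = (map_poly inc q).[x].
Proof.
have [->|x0 [p p0]] := eqVneq x 0.
  by exists 0; rewrite rmorph0 horner0 invr0.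
have [n] := ubnP (size p); elim: n p p0 => // n IHn p p0 lt_p rp.
pose q := \poly_(i < (size p).-1) p`_i.+1.
have sp : size p = (size p).-1.+1 by rewrite prednK // lt0n size_poly_eq0.
have pE : p = q * 'X + (p`_0)%:P.
  apply/polyP => -[|i]; rewrite coefD coefMX coefC /= ?add0r // addr0 coef_poly.
  by case: ltnP => // le; rewrite nth_default // sp.
have [e0|n0] := eqVneq p`_0 0.
  have q0 : q != 0 by apply: contra p0 => /eqP q0; rewrite pE e0 q0 mul0r addr0.
  apply: (IHn q) => //.
    by rewrite ltnS in lt_p; apply: leq_trans lt_p; rewrite sp ltnS size_poly.
  move: rp; rewrite pE e0 addr0 rmorphM /= map_polyX rootM.
  by rewrite [X in _ || X]/root hornerX (negPf x0) orbF.
have e : (map_poly inc q).[x] * x = - inc p`_0.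
  apply/eqP; rewrite -addr_eq0; move: rp.
  by rewrite {1}pE rmorphD rmorphM /= map_polyX map_polyC /root !hornerE.
exists (- (p`_0)^-1 *: q).
rewrite map_polyZ hornerZ; apply: (mulIf x0); rewrite mulVf // -mulrA e.
by rewrite rmorphN mulNr mulrN opprK fmorphV mulVf // fmorph_eq0.
Qed.

Lemma stableV S x : algebraicOver inc x -> stable S x -> stable S x^-1.
Proof. by move=> /algebraic_inv_horner [q ->] hx; exact: stable_horner. Qed.

End Span.

Lemma pchar0_natr (L : fieldType) : [pchar L] =i pred0 ->
  forall n, (n%:R == 0 :> L) = (n == 0)%N.
Proof. by move=> h n; rewrite (pcharf0P _).1. Qed.

(** * Subfields given by predicates, as embedded fields *)

Section SubField.
Variable L : fieldType.

Record subfield := Subfield {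
  sf_pred : L -> Prop;
  sf_1 : sf_pred 1;
  sf_B : forall x y, sf_pred x -> sf_pred y -> sf_pred (x - y);
  sf_M : forall x y, sf_pred x -> sf_pred y -> sf_pred (x * y);
  sf_V : forall x, sf_pred x -> sf_pred x^-1 }.

Variable K : subfield.

Definition sf_mem : {pred L} := fun x => `[< sf_pred K x >].

Fact sf_divring_closed : divring_closed sf_mem.
Proof.
split=> [|x y /asboolP hx /asboolP hy|x y /asboolP hx /asboolP hy]; apply/asboolP.
- exact: sf_1.
- exact: sf_B.
- exact/sf_M/sf_V.
Qed.
HB.instance Definition _ := GRing.isDivringClosed.Build L sf_mem sf_divring_closed.

Inductive sf_type : predArgType := SFType x of x \in sf_mem.
Definition sf_val (x : sf_type) := let: SFType y _ := x in y.
HB.instance Definition _ := [isSub for sf_val].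
HB.instance Definition _ := [Choice of sf_type by <:].
HB.instance Definition _ := [SubChoice_isSubComUnitRing of sf_type by <:].
HB.instance Definition _ := [SubComUnitRing_isSubIntegralDomain of sf_type by <:].
HB.instance Definition _ := [SubIntegralDomain_isSubField of sf_type by <:].

End SubField.

Lemma subfield_type (L : fieldType) (K : subfield L) :
  exists (F : fieldType) (inc : {rmorphism F -> L}),
    forall x, sf_pred K x <-> exists y, x = inc y.
Proof.
exists (sf_type K), (val : {rmorphism sf_type K -> L}) => x; split.
  by move=> /asboolP hx; exists (SFType hx).
by move=> [[y hy] ->]; apply/asboolP.
Qed.

Section ExpHom.
Variables (V : zmodType) (K : fieldType) (f : V -> K).
Hypotheses (f0 : f 0 = 1) (fD : forall a b, f (a + b) = f a * f b).

Lemma exphom_neq0 a : f a != 0.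
Proof.
apply/eqP => e; move: f0; rewrite -(subrr a) fD e mul0r => /esym/eqP.
by rewrite oner_eq0.
Qed.

Lemma exphomN a : f (- a) = (f a)^-1.
Proof.
apply: (mulfI (exphom_neq0 a)); rewrite -fD subrr f0 divff //.
exact: exphom_neq0.
Qed.

Lemma exphomB a b : f (a - b) = f a / f b.
Proof. by rewrite fD exphomN. Qed.

Lemma exphomMn a n : f (a *+ n) = f a ^+ n.
Proof. by elim: n => [|n IH]; rewrite ?mulr0n ?expr0 // mulrS exprS fD IH. Qed.

Lemma exphomMz a z : f (a *~ z) = f a ^ z.
Proof.
case: z => n; first by rewrite -pmulrn exphomMn.
by rewrite NegzE mulrNz exphomN -pmulrn exphomMn.
Qed.

Lemma exphom_sum (I : Type) (r : seq I) (E : I -> V) :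
  f (\sum_(i <- r) E i) = \prod_(i <- r) f (E i).
Proof. exact: (big_morph f fD f0). Qed.

End ExpHom.

(** * Pure radical extensions *)

Section Kummer.
Variables (F : fieldType) (L : closedFieldType) (inc : {rmorphism F -> L}).

Lemma prod_root_shift (rs : seq L) (b : L) m : b != 0 ->
  (forall z, z \in rs -> z ^+ m = b ^+ m) ->
  exists2 eta, eta ^+ m = 1 & \prod_(z <- rs) z = eta * b ^+ size rs.
Proof.
move=> b0; elim: rs => [|z rs IHrs] h.
  by exists 1; rewrite ?expr1n // big_nil expr0 mulr1.
have [|eta e1 e2] := IHrs; first by move=> u hu; apply: h; rewrite in_cons hu orbT.
exists (eta * (z / b)).
  rewrite exprMn e1 mul1r expr_div_n h ?mem_head // divff //.
  by rewrite expf_neq0.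
by rewrite big_cons e2 exprS; set B := b ^+ _; field.
Qed.

(* The constant term of a degree r factor of X^m - b^m is b^r times a root of unity. *)
Lemma kummer_irreducible (b : L) (c : F) (m : nat) : (0 < m)%N -> b != 0 ->
  b ^+ m = inc c ->
  (forall r eta x, (0 < r)%N -> eta ^+ m = 1 -> eta * b ^+ r = inc x -> (m <= r)%N) ->
  irreducible_poly ('X^m - c%:P).
Proof.
move=> m0 b0 bm h; have sP : size ('X^m - c%:P) = m.+1 by rewrite size_XnsubC.
split; first by rewrite sP ltnS.
move=> q sq dq; have P0 : 'X^m - c%:P != 0 by rewrite -size_poly_eq0 sP.
have q0 : q != 0 by apply: contraNneq P0 => q0; rewrite q0 dvd0p in dq.
have sq1 : (1 < size q)%N.
  by rewrite ltn_neqAle eq_sym sq lt0n size_poly_eq0.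
rewrite -dvdp_size_eqp // sP eqn_leq; apply/andP; split.
  by rewrite -sP; apply: dvdp_leq.
have [rs Drs] := closed_field_poly_normal (map_poly inc q).
rewrite lead_coef_map /= in Drs.
have l0 : inc (lead_coef q) != 0 by rewrite fmorph_eq0 lead_coef_eq0.
have srs : size rs = (size q).-1.
  by rewrite -(size_map_poly inc q) Drs size_scale // size_prod_XsubC.
have [|eta e1 e2] := @prod_root_shift rs b m b0.
  move=> z zrs; have rz : root (map_poly inc q) z.
    by rewrite Drs rootZ // root_prod_XsubC.
  have dq' : map_poly inc q %| map_poly inc ('X^m - c%:P) by rewrite dvdp_map.
  have := root_dvdp dq' rz.
  by rewrite rmorphB /= map_polyXn map_polyC /root !hornerE bm subr_eq0 => /eqP.
have := congr1 (fun p => p.[0]) Drs.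
rewrite hornerZ horner_prod.
under eq_bigr do rewrite hornerXsubC sub0r.
have -> : \prod_(z <- rs) - z = inc ((-1) ^+ size rs) * \prod_(z <- rs) z.
  rewrite rmorphXn rmorphN1; elim: (rs) => [|z rs' IH]; first by rewrite !big_nil mul1r.
  by rewrite !big_cons IH exprS mulN1r mulNr mulrCA mulNr.
rewrite -[X in _.[X]](rmorph0 inc) horner_map e2 => /esym/eqP e3.
have -> : size q = (size rs).+1 by rewrite srs prednK // ltnW.
apply: (h _ eta ((lead_coef q * (-1) ^+ size rs)^-1 * q.[0])) => //.
  by rewrite srs; case: (size q) sq1 => [|[]].
have ls0 : lead_coef q * (-1) ^+ size rs != 0.
  by rewrite mulf_neq0 ?lead_coef_eq0 ?signr_eq0.
have ls1 : inc (lead_coef q * (-1) ^+ size rs) != 0 by rewrite fmorph_eq0.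
apply: (mulfI ls1).
by rewrite -[RHS](rmorphM inc) mulVKf // -(eqP e3) rmorphM -mulrA.
Qed.

(** A root of p is a common root with q, so gcd(q, p) is not constant and irreducibility gives q |
    p; divide and repeat. *)
Lemma power_of_irreducible (q p : {poly F}) : irreducible_poly q -> p != 0 ->
  (forall z, root (map_poly inc p) z -> root (map_poly inc q) z) ->
  exists e, p %= q ^+ e.
Proof.
move=> [sq irr]; have [n] := ubnP (size p); elim: n p => // n IHn p lt_p p0 h.
have [sp|sp] := eqVneq (size p) 1; first by exists 0; rewrite expr0 -size_poly_eq1 sp.
have [z rz] : exists z, root (map_poly inc p) z.
  by apply/closed_rootP; rewrite size_map_poly.
have dq : q %| p.
  have /eqP := sp; rewrite -(size_map_poly inc).
  have gz : root (map_poly inc (gcdp q p)) z.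
    by rewrite gcdp_map root_gcd h.
  have sg : size (gcdp q p) != 1.
    apply: contraTneq gz => /eqP/size_poly1P [c c0 ->].
    by rewrite map_polyC /root hornerC fmorph_eq0.
  have := irr _ sg (dvdp_gcdl _ _) => eg _.
  by rewrite -(eqp_dvdl _ eg) dvdp_gcdr.
have q0 : q != 0 by rewrite -size_poly_gt0 ltnW.
have /eqP e : p %/ q * q == p by rewrite divpK.
have r0 : p %/ q != 0 by apply: contra p0 => /eqP r0; rewrite -e r0 mul0r.
have [|||d hd] := IHn (p %/ q) => //.
- rewrite ltnS in lt_p; apply: leq_trans lt_p; rewrite size_divp //.
  rewrite ltn_subrL -subn1 subn_gt0 sq size_poly_gt0 p0.
  by [].
- by move=> y ry; apply: h; rewrite -e rmorphM rootM ry.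
by exists d.+1; rewrite exprSr -e; rewrite eqp_mul2r.
Qed.

(** The characteristic polynomial is a power of X^m - c, hence a polynomial in X^m, and m divides
    its degree t. Minus the trace is the coefficient of X^(t-1), whose index m > 1 cannot divide. *)
Lemma trace_radical (t m : nat) (M : 'M[F]_t) (c : F) : (1 < m)%N ->
  (0 < t)%N -> irreducible_poly ('X^m - c%:P) ->
  (forall z, root (map_poly inc (char_poly M)) z -> z ^+ m = inc c) -> \tr M = 0.
Proof.
move=> m1 t0 irr h; apply/eqP; rewrite -oppr_eq0 -char_poly_trace //.
have [||e] := power_of_irreducible irr (p := char_poly M).
- exact: monic_neq0 (char_poly_monic M).
- move=> z /h e; rewrite rmorphB /= map_polyXn map_polyC /root !hornerE e.
  by rewrite subrr.
rewrite eqp_monic ?char_poly_monic ?monic_exp ?monicXnsubC ?(ltnW m1) // => /eqP E.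
have Et : t = (m * e)%N.
  by have := size_exp ('X^m - c%:P) e; rewrite -E size_char_poly size_XnsubC ?(ltnW m1).
have -> : char_poly M = (('X - c%:P) ^+ e) \Po 'X^m.
  by rewrite E rmorphXn /= rmorphB /= comp_polyX comp_polyC.
rewrite coef_comp_poly_Xn ?(ltnW m1) // ifN //.
apply: contraL m1 => dv; rewrite -leqNgt.
have : (m %| t - t.-1)%N by rewrite dvdn_sub // Et dvdn_mulr.
by rewrite -subn1 subKn // => /dvdn_leq ->.
Qed.
End Kummer.

Section Indep.
Variables (F L : fieldType) (inc : {rmorphism F -> L}).

Lemma stable_algebraic (gs : seq L) : (forall g, g \in gs -> algebraicOver inc g) ->
  exists2 S, 1 \in S & forall g, g \in gs -> stable inc S g.
Proof.
elim: gs => [|g gs IH] h; first by exists [:: 1] => [|g]; rewrite ?mem_seq1 ?in_nil.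
have [|S S1 hS] := IH; first by move=> x hx; apply: h; rewrite in_cons hx orbT.
have /algebraic_pdeg [N /pdeg_stable [U [_ U1 hU]]] := h g (mem_head _ _).
exists (prodseq U S).
  by apply/allpairsP; exists (1, 1); rewrite mulr1.
move=> x; rewrite in_cons => /predU1P [->|/hS xS].
  exact: stable_prodl.
exact: stable_prodr.
Qed.

Definition lin_indep (S : seq L) := forall w : nat -> F,
  \sum_(i < size S) inc (w i) * S`_i = 0 -> forall i, (i < size S)%N -> w i = 0.

(** Take a stable list of least length among those with a nonzero entry: a repeated or dependent
    entry could be dropped without changing the span. *)
Lemma stable_basis (gs : seq L) : (forall g, g \in gs -> algebraicOver inc g) ->
  exists S, [/\ (0 < size S)%N, lin_indep S & forall g, g \in gs -> stable inc S g].
Proof.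
move=> /stable_algebraic [S0 S01 hS0].
pose good t := exists S, [/\ size S = t, exists2 s, s \in S & s != 0 &
   forall g, g \in gs -> stable inc S g].
have ex : exists t, `[< good t >].
  by exists (size S0); apply/asboolP; exists S0; split => //; exists 1; rewrite ?oner_neq0.
case: (ex_minnP ex) => t /asboolP [S [<- [s sS s0] hS]] min_t.
have {}min_t (S' : seq L) : (forall x, x \in S' -> x \in S) ->
    (forall x, x \in S -> span inc S' x) -> (size S <= size S')%N.
  move=> h1 h2; apply: min_t; apply/asboolP; exists S'; split => //.
    apply: contrapT => h; case/negP: s0; apply/eqP.
    move: (h2 s sS); apply: (span_ind (P := fun z => z = 0)) => // [x y -> ->|a x xS].
      by rewrite addr0.
    have [->|x0] := eqVneq x 0; first by rewrite mulr0.
    by case: h; exists x.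
  move=> g /hS hg x /h1 /hg; exact: span_trans.
exists S; split => //; first by case: (S) sS.
move=> w hw i lt_i; apply: contrapT => /eqP wi0.
(* Needed first, since filtering out a value must remove a single index only. *)
have uS : uniq S.
  rewrite -[uniq S]negbK -ltn_size_undup -leqNgt; apply: min_t => x.
    by rewrite mem_undup.
  by rewrite -mem_undup; exact: span_mem.
have : (size S <= size (filter (predC1 (S`_i)%R) S))%N.
  apply: min_t => x; first by rewrite mem_filter => /andP [].
  move=> xS; have [->|nx] := eqVneq x S`_i; last first.
    by apply: span_mem; rewrite mem_filter /= nx.
  move: hw; rewrite (bigD1 (Ordinal lt_i)) //= => /eqP; rewrite addr_eq0 => /eqP e.
  have E : S`_i = inc (- (w i)^-1) *
      \sum_(j < size S | j != Ordinal lt_i) inc (w j) * S`_j.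
    by rewrite rmorphN mulNr -mulrN -e fmorphV mulKf // fmorph_eq0.
  rewrite [X in span _ _ X]E; apply: spanZ; apply: big_ind => [|x1 x2|j nj]; [exact: span0|exact: spanD|].
  apply/spanZ/span_mem; rewrite mem_filter mem_nth // andbT /=.
  by rewrite nth_uniq.
rewrite size_filter leqNgt -[X in (_ < X)%N](count_predC (pred1 (S`_i))).
rewrite -[X in (X < _)%N]add0n ltn_add2r.
by rewrite -has_count has_pred1 mem_nth.
Qed.

Variable S : seq L.
Hypotheses (S0 : (0 < size S)%N) (indS : lin_indep S).
Local Notation v := (\row_j S`_j : 'rV[L]_(size S)).

(** Independence makes the matrix of multiplication unique, so identities between multiplications
    transfer to matrices: M^m is scalar when b^m is in F. *)
Lemma lin_indep_mx p (A B : 'M[F]_(size S, p)) :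
  v *m map_mx inc A = v *m map_mx inc B -> A = B.
Proof.
move=> /matrixP e; apply/matrixP => i j.
apply/eqP; rewrite -subr_eq0; apply/eqP.
pose w k := if insub k is Some i then A i j - B i j else 0.
have wE (k : 'I_(size S)) : w k = A k j - B k j by rewrite /w valK.
rewrite -wE; apply: indS => //; apply/eqP.
have := e 0 j; rewrite !mxE => /eqP; rewrite -subr_eq0 -sumrB.
congr (_ == _); apply: eq_bigr => k _.
by rewrite wE !mxE rmorphB; ring.
Qed.

Lemma row_mxX (M : 'M[F]_(size S)) (b : L) : v *m map_mx inc M = b *: v ->
  forall n, v *m map_mx inc (iter n (mulmx M) 1%:M) = b ^+ n *: v.
Proof.
move=> h; elim=> [|n IH] /=; first by rewrite map_mx1 mulmx1 expr0 scale1r.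
by rewrite map_mxM mulmxA h -scalemxAl IH scalerA exprS.
Qed.

End Indep.

Section Radical.
Variables (F : fieldType) (L : closedFieldType) (inc : {rmorphism F -> L}).
Hypothesis L0 : [pchar L] =i pred0.
Variable N : L -> Prop.
Hypothesis N0 : forall x, N x -> x != 0.
Hypothesis Ndiv : forall x y, N x -> N y -> N (x / y).
Hypothesis NF : forall a, a != 0 -> N (inc a).
Hypothesis Ntors : forall x, N x -> exists m c, (0 < m)%N /\ x ^+ m = inc c.
Hypothesis Nroot : forall z n, N z -> (0 < n)%N -> z ^+ n = 1 -> exists a, z = inc a.

Lemma Nexp x n : N x -> N (x ^+ n).
Proof.
move=> hx; have N1 : N 1 by rewrite -(rmorph1 inc); apply/NF/oner_neq0.
elim: n => [|n IH]; rewrite ?expr0 // exprS.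
by rewrite -[_ ^+ n]invrK; apply: Ndiv => //; rewrite -[_^-1]mul1r; exact: Ndiv.
Qed.

(** Take m to be the least positive exponent with b^m in F. If eta b^r is in F with eta^m = 1, then
    eta lies in the group [N], hence in F by [Nroot]; so b^r is in F and m <= r. *)
Lemma radical_irreducible b : N b -> ~ (exists a, b = inc a) ->
  exists m c, [/\ (1 < m)%N, b ^+ m = inc c & irreducible_poly ('X^m - c%:P)].
Proof.
move=> Nb nb.
pose good m := (0 < m)%N /\ exists c, b ^+ m = inc c.
have ex : exists m, `[< good m >].
  by have [m [c [m0 e]]] := Ntors Nb; exists m; apply/asboolP; split => //; exists c.
case: (ex_minnP ex) => m /asboolP [m0 [c e]] min_m.
exists m, c; split => //.
  rewrite ltn_neqAle m0 andbT; apply/eqP => m1; apply: nb; exists c.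
  by rewrite -e -m1 expr1.
apply: (kummer_irreducible m0 (N0 Nb) e) => r eta x r0 eta1 hx.
apply: min_m; apply/asboolP; split => //.
have br0 : b ^+ r != 0 by rewrite expf_neq0 ?N0.
have eta0 : eta != 0.
  by apply: contra_eq_neq eta1 => ->; rewrite expr0n gtn_eqF // eq_sym oner_neq0.
have x0 : x != 0 by rewrite -(fmorph_eq0 inc) -hx mulf_neq0.
have [a ha] : exists a, eta = inc a.
  apply: (Nroot _ m0 eta1); rewrite -[eta](mulfK br0) hx.
  by apply: Ndiv; [exact: NF|exact: Nexp].
exists (x / a); rewrite rmorphM fmorphV -ha -hx; field.
by [].
Qed.

(* Multiplication by an element of [N] outside [F] has trace zero, since its
   minimal polynomial is X^m - b^m with m > 1; so the trace of the relation divided by [bs`_i]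
   isolates [c i]. *)
Theorem radical_lin_indep (bs : seq L) : (forall b, b \in bs -> N b) ->
  (forall i j, (i < size bs)%N -> (j < size bs)%N -> i != j ->
     ~ exists a, bs`_i = inc a * bs`_j) -> lin_indep inc bs.
Proof.
move=> hN hdist c hc i0 lt0.
have b0 : bs`_i0 != 0 by apply/N0/hN/mem_nth.
pose g (j : 'I_(size bs)) := bs`_j / bs`_i0.
have Ng j : N (g j) by apply: Ndiv; apply/hN/mem_nth.
have [|S [S0 indS hS]] := @stable_basis _ _ inc (codom g).
  move=> _ /codomP [j ->]; have [m [d [m0 e]]] := Ntors (Ng j).
  exists ('X^m - d%:P); first by rewrite -size_poly_eq0 size_XnsubC.
  by rewrite rmorphB /= map_polyXn map_polyC /root !hornerE e subrr.
have hM (j : 'I_(size bs)) : exists M : 'M[F]_(size S),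
    \row_k S`_k *m map_mx inc M = g j *: \row_k S`_k.
  by apply/stable_matrix/hS/codom_f.
have [M {}hM] := choice hM.
have tr0 (j : 'I_(size bs)) : j != Ordinal lt0 -> \tr (M j) = 0.
  move=> nj; have [|m [d [m1 e irr]]] := @radical_irreducible (g j) (Ng j).
    move=> [a ha]; apply: (hdist j i0) => //; exists a.
    by rewrite -ha /g divfK.
  apply: (@trace_radical _ _ inc _ _ _ _ m1 S0 irr) => z.
  (* A root of the characteristic polynomial is an eigenvalue z, and M^m = d forces z^m = d. *)
  rewrite map_char_poly -eigenvalue_root_char => /eigenvalueP [u hu u0].
  have E : iter m (mulmx (M j)) 1%:M = d%:M.
    apply: (lin_indep_mx indS); rewrite (row_mxX (hM j)) e map_scalar_mx.
    by rewrite mul_mx_scalar.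
  have : u *m map_mx inc (iter m (mulmx (M j)) 1%:M) = z ^+ m *: u.
    elim: (m) => [|k IH] /=; first by rewrite map_mx1 mulmx1 expr0 scale1r.
    by rewrite map_mxM mulmxA hu -scalemxAl IH scalerA exprS.
  rewrite E map_scalar_mx mul_mx_scalar => /eqP.
  rewrite -subr_eq0 -scalerBl scaler_eq0 (negPf u0) orbF subr_eq0 => /eqP ->.
  by [].
have M1 : M (Ordinal lt0) = 1%:M.
  by apply: (lin_indep_mx indS); rewrite hM /g divff // scale1r map_mx1 mulmx1.
have sM : \sum_(j < size bs) c j *: M j = 0.
  apply: (lin_indep_mx indS); rewrite map_mx0 mulmx0 map_mx_sum mulmx_sumr.
  under eq_bigr => j _ do rewrite map_mxZ -scalemxAr hM scalerA.
  rewrite -scaler_suml.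
  rewrite (_ : \sum_j _ = (\sum_(j < size bs) inc (c j) * bs`_j) / bs`_i0).
    by rewrite hc mul0r scale0r.
  by rewrite mulr_suml; apply: eq_bigr => j _; rewrite mulrA.
(* Only the term [i0] survives; its matrix is the identity, of trace [size S], nonzero in
   characteristic zero. *)
have := congr1 mxtrace sM; rewrite raddf_sum mxtrace0 (bigD1 (Ordinal lt0)) //=.
rewrite big1 ?addr0 => [|j nj]; last by rewrite mxtraceZ tr0 ?mulr0.
rewrite mxtraceZ M1 mxtrace1 => /eqP; rewrite mulf_eq0 => /orP [/eqP //|].
by rewrite -(fmorph_eq0 inc) rmorph_nat pchar0_natr // => /eqP e; rewrite e in S0.
Qed.

End Radical.

(** * The group algebra *)

Section GroupAlgebra.
Local Open Scope fset_scope.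
Local Open Scope ring_scope.
Variables (k : fieldType) (A : zmodType).
Implicit Types (x y : grpalg k A) (a g t : A).

Lemma ga_addE x y a : ga_add x y a = x a + y a.
Proof.
rewrite fsfunE in_fsetU; case: ifP => // /norP [hx hy].
by rewrite !fsfun_dflt ?addr0.
Qed.

Lemma ga_ofE g a : ga_of k g a = (a == g)%:R.
Proof. by rewrite fsfunE in_fset1; case: eqP. Qed.

Lemma ga_0E a : ga0 k A a = 0.
Proof. by rewrite fsfunE. Qed.

Lemma ga_shiftE c g y a : ga_shift c g y a = c * y (a - g).
Proof.
rewrite fsfunE; case: ifP => // /negP h.
rewrite [y _]fsfun_dflt ?mulr0 //; apply/negP => hy; apply: h.
by apply/imfsetP; exists (a - g); rewrite ?subrK.
Qed.

Lemma ga_sumE (I : Type) (r : seq I) (E : I -> grpalg k A) a :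
  (\big[@ga_add k A/ga0 k A]_(i <- r) E i) a = \sum_(i <- r) E i a.
Proof. by apply: (big_morph (fun x : grpalg k A => x a)); [move=> x y; exact: ga_addE|exact: ga_0E]. Qed.

Lemma ga_mul_ofE y t a : ga_mul y (ga_of k t) a = y (a - t).
Proof.
rewrite ga_sumE; under eq_bigr => g _ do rewrite ga_shiftE ga_ofE.
have [hs|hs] := boolP (a - t \in finsupp y).
  rewrite (big_fsetD1 _ hs) /= subKr eqxx mulr1 big_seq big1 ?addr0 // => g.
  rewrite !inE => /andP [ng _].
  by rewrite subr_eq addrC -subr_eq eq_sym (negPf ng) mulr0.
rewrite (fsfun_dflt hs) big_seq big1 // => g hg.
rewrite subr_eq addrC -subr_eq; case: eqP => [e|]; rewrite ?mulr0 //.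
by rewrite e hg in hs.
Qed.

Variables (Om : fieldType) (phi : {rmorphism k -> Om}) (chi : A -> Om).

Lemma ga_eval_wide x (V : {fset A}) : finsupp x `<=` V ->
  ga_eval phi chi x = \sum_(a <- V) phi (x a) * chi a.
Proof.
move=> hV; apply: big_fset_incl => // a _ na.
by rewrite fsfun_dflt // rmorph0 mul0r.
Qed.

Lemma ga_evalD x y : ga_eval phi chi (ga_add x y) = ga_eval phi chi x + ga_eval phi chi y.
Proof.
rewrite !(@ga_eval_wide _ (finsupp x `|` finsupp y)) ?fsubsetUl ?fsubsetUr //.
  by rewrite -big_split; apply: eq_bigr => a _; rewrite ga_addE rmorphD mulrDl.
by apply/fsubsetP => a; rewrite !mem_finsupp ga_addE inE !mem_finsupp;
   case: (eqVneq (x a)) => // ->; rewrite add0r.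
Qed.

Lemma ga_eval0 : ga_eval phi chi (ga0 k A) = 0.
Proof. by rewrite /ga_eval big1 // => a _; rewrite ga_0E rmorph0 mul0r. Qed.

Lemma ga_eval_of g : ga_eval phi chi (ga_of k g) = chi g.
Proof.
rewrite (@ga_eval_wide _ [fset g]).
  by rewrite big_seq_fset1 ga_ofE eqxx rmorph1 mul1r.
apply/fsubsetP => a; rewrite mem_finsupp ga_ofE inE.
by case: (a == g); rewrite ?eqxx.
Qed.

Hypothesis chiD : forall a b, chi (a + b) = chi a * chi b.

Lemma ga_eval_shift c g y :
  ga_eval phi chi (ga_shift c g y) = phi c * chi g * ga_eval phi chi y.
Proof.
rewrite (@ga_eval_wide _ [fset b + g | b in finsupp y]).
  rewrite big_imfset /=; last by move=> a b _ _; exact: addIr.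
  rewrite mulr_sumr; apply: eq_bigr => a _.
  by rewrite ga_shiftE addrK chiD rmorphM; ring.
apply/fsubsetP => a; rewrite mem_finsupp ga_shiftE => h.
apply/imfsetP; exists (a - g); rewrite ?subrK //= mem_finsupp.
by apply: contra h => /eqP ->; rewrite mulr0.
Qed.

Lemma ga_evalM x y : ga_eval phi chi (ga_mul x y) = ga_eval phi chi x * ga_eval phi chi y.
Proof.
rewrite /ga_mul (big_morph (ga_eval phi chi) ga_evalD ga_eval0) mulr_suml.
by apply: eq_bigr => g _; rewrite ga_eval_shift.
Qed.

End GroupAlgebra.

(** * Control from linear independence over a subfield *)

Section Controls.
Local Open Scope fset_scope.
Local Open Scope ring_scope.
Variables (k : fieldType) (A : zmodType) (P : grpalg k A -> Prop).
Variables (Om : closedFieldType) (phi : {rmorphism k -> Om}) (chi : A -> Om).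
Hypothesis Om0 : [pchar Om] =i pred0.
Hypothesis chi0 : chi 0 = 1.
Hypothesis chiD : forall a b, chi (a + b) = chi a * chi b.
Hypothesis kerP : forall x, P x <-> ga_eval phi chi x = 0.

Local Notation chi_neq0 := (exphom_neq0 chi0 chiD).
Local Notation chiN := (exphomN chi0 chiD).

Variable K : subfield Om.
Hypothesis Kphi : forall x, sf_pred K (phi x).
Hypothesis Ktors : forall a, exists2 m, (0 < m)%N & sf_pred K (chi a ^+ m).
Hypothesis Kroot : forall a x n, sf_pred K x -> (0 < n)%N ->
  (chi a * x) ^+ n = 1 -> sf_pred K (chi a * x).
Local Notation H := (fun a => sf_pred K (chi a)).

Lemma controls_kernel : controls H P.
Proof.
have [F [inc hF]] := subfield_type K.
have incK c : sf_pred K (inc c) by apply/hF; exists c.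
pose N z := exists a x, x != 0 /\ z = chi a * inc x.
have incN0 x : x != 0 -> inc x != 0 by rewrite fmorph_eq0.
have KH a b : (exists c, chi a = inc c * chi b) -> H (a - b).
  by move=> [c e] /=; rewrite chiD chiN e mulfK ?chi_neq0.
have indep := @radical_lin_indep F Om inc Om0 N.
move=> x; split; last first.
  move=> [l [hl ->]]; apply/kerP.
  elim: l hl => [|p l IH] hl /=; first exact: ga_eval0.
  rewrite ga_evalD ga_evalM // IH => [|q hq]; last by apply: hl; rewrite in_cons hq orbT.
  by rewrite (kerP _).1 ?mul0r ?addr0 //; apply: (hl p (mem_head _ _)).1.
move=> /kerP Px.
have HB a b : H a -> H b -> H (a - b).
  by move=> ha hb /=; rewrite chiD chiN; apply: sf_M => //; exact: sf_V.
have HN a b : H (a - b) -> H (b - a).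
  by move=> h; rewrite -opprB /= chiN; exact: sf_V.
have HD a b c : H (a - b) -> H (b - c) -> H (a - c).
  by move=> ha hb; rewrite -(subrKA b) /= chiD; exact: sf_M.
have H0 a : H (a - a) by rewrite /= subrr chi0; exact: sf_1.
(* A transversal of the cosets of H that meet the support of x. *)
have [ts [uts hts cov]] : exists ts : seq A, [/\ uniq ts,
   (forall a b, a \in ts -> b \in ts -> H (a - b) -> a = b) &
   forall a, a \in (finsupp x : seq A) -> exists2 t, t \in ts & H (a - t)].
  elim: (finsupp x : seq A) => [|a l [ts [uts hts cov]]].
    by exists [::]; split.
  have [[t tts at_]|na] := pselect (exists2 t, t \in ts & H (a - t)).
    exists ts; split => // b; rewrite in_cons => /predU1P [->|/cov //].
    by exists t.
  exists (a :: ts); split => /=.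
  - by rewrite uts andbT; apply/negP => h; apply: na; exists a => //; exact: H0.
  - move=> b c; rewrite !in_cons => /predU1P [->|hb] /predU1P [->|hc] //.
    + by move=> h; case: na; exists c.
    + by move=> h; case: na; exists b => //; exact: HN.
    + exact: hts.
  move=> b; rewrite in_cons => /predU1P [->|/cov [t tts bt]].
    by exists a; [exact: mem_head|exact: H0].
  by exists t => //; rewrite in_cons tts orbT.
(* The part of x on the coset t + H, translated by - t so that its support lies in H and its value
   in K. *)
pose y t : grpalg k A :=
  [fsfun a in [fset a - t | a in finsupp x] => if `[< H a >] then x (a + t) else 0 | 0].
have yE t a : y t a = if `[< H a >] then x (a + t) else 0.
  rewrite fsfunE; case: ifP => // /negP h; case: asboolP => // _.
  rewrite fsfun_dflt //; apply/negP => hs; apply: h.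
  by apply/imfsetP; exists (a + t); rewrite ?addrK.
have supy t : ga_supported H (y t).
  by move=> a; rewrite mem_finsupp yE; case: asboolP; rewrite ?eqxx.
have xE : x = foldr (@ga_add k A) (ga0 k A) [seq ga_mul (y t) (ga_of k t) | t <- ts].
  apply/fsfunP => a; rewrite foldrE big_map.
  rewrite ga_sumE; under eq_bigr => t _ do rewrite ga_mul_ofE yE subrK.
  have [ha|ha] := boolP (a \in finsupp x); last first.
    by rewrite fsfun_dflt // big1 // => t _; rewrite if_same.
  have [t tts at_] := cov a ha; rewrite (bigD1_seq t) //= asboolT // big_seq_cond.
  rewrite big1 ?addr0 // => u /andP [uts' nu]; case: asboolP => // au.
  by case/eqP: nu; apply: hts => //; apply: HD at_; apply: HN.
have eval_in t : exists c, ga_eval phi chi (y t) = inc c.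
  apply/hF; rewrite /ga_eval big_seq; apply: big_ind => [|u v hu hv|a /supy ha].
  - by rewrite -(subrr 1); apply: sf_B; exact: sf_1.
  - by rewrite -[v]opprK; apply: sf_B => //; rewrite -sub0r -(subrr v); do ?apply: sf_B.
  - by apply: sf_M.
have [c hc] := choice eval_in.
have ind : lin_indep inc [seq chi t | t <- ts].
  apply: indep.
  - by move=> _ [a [z [z0 ->]]]; rewrite mulf_neq0 ?chi_neq0 ?incN0.
  - move=> _ _ [a [z [z0 ->]]] [b [u [u0 ->]]]; exists (a - b), (z / u).
    split; first by rewrite mulf_neq0 ?invr_eq0.
    by rewrite chiD chiN rmorphM fmorphV; field; rewrite chi_neq0 incN0.
  - by move=> a a0; exists 0, a; rewrite chi0 mul1r.
  - move=> _ [a [z [z0 ->]]]; have [m m0 /hF [b hb]] := Ktors a.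
    by exists m, (b * z ^+ m); rewrite exprMn hb rmorphM rmorphXn.
  - move=> _ n [a [z [z0 ->]]] n0 e; apply/hF; exact: Kroot n0 e.
  - by move=> _ /mapP [t _ ->]; exists t, 1; rewrite oner_neq0 rmorph1 mulr1.
  move=> i j; rewrite size_map => lt_i lt_j nij; rewrite !(nth_map 0) // => /KH h.
  by case/eqP: nij; apply/eqP; rewrite -(nth_uniq 0 _ _ uts) //; apply/eqP/hts;
     rewrite ?mem_nth.
(* The value of x is a combination of the chi t with the values of [y t], elements of K, as
   coefficients; it vanishes, so independence kills each of them. *)
have cz t : t \in ts -> ga_eval phi chi (y t) = 0.
  move=> tts; rewrite hc; have lt_t : (index t ts < size ts)%N by rewrite index_mem.
  rewrite -{1}(nth_index 0 tts); have := ind (fun i => c ts`_i) _ (index t ts).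
  rewrite size_map => -> //; first by rewrite rmorph0.
  rewrite -[RHS]Px [in RHS]xE foldrE big_map.
  rewrite (big_morph (ga_eval phi chi) (ga_evalD phi chi) (ga_eval0 phi chi)).
  rewrite (big_nth 0) big_mkord; apply: eq_bigr => i _.
  by rewrite ga_evalM // ga_eval_of hc (nth_map 0).
exists [seq (y t, ga_of k t) | t <- ts]; split.
  by move=> _ /mapP [t tts ->]; split => //=; apply/kerP/cz.
by rewrite {1}xE -map_comp.
Qed.
End Controls.

(** * Places *)

Lemma horner_rev_inv (K : fieldType) (g : {poly K}) x : x != 0 ->
  (\poly_(i < size g) g`_((size g).-1 - i)).[x] = x ^+ (size g).-1 * g.[x^-1].
Proof.
move=> x0; rewrite horner_poly horner_coef mulr_sumr.
rewrite (reindex_inj rev_ord_inj) /=; apply: eq_bigr => i _.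
have lt_i : (i <= (size g).-1)%N by rewrite -ltnS (ltn_predK (ltn_ord i)).
rewrite subnS predn_sub subKn // mulrCA; congr (_ * _).
by rewrite -{2}(subnK lt_i) exprD exprVn mulfK // expf_neq0.
Qed.

Section Place.
Variables (K : fieldType) (L : closedFieldType).

(* The map of a place is total; only its values on the ring [pl] are meaningful. *)
Record place := Place {
  pl :> K -> Prop;
  rho : K -> L;
  pl1 : pl 1;
  plB : forall x y, pl x -> pl y -> pl (x - y);
  plM : forall x y, pl x -> pl y -> pl (x * y);
  rho1 : rho 1 = 1;
  rhoB : forall x y, pl x -> pl y -> rho (x - y) = rho x - rho y;
  rhoM : forall x y, pl x -> pl y -> rho (x * y) = rho x * rho y;
  plV : forall x, pl x -> rho x != 0 -> pl x^-1 }.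

Definition extends (v w : place) := forall x, v x -> w x /\ rho w x = rho v x.

Lemma extends_trans w v u : extends v w -> extends w u -> extends v u.
Proof. by move=> h1 h2 x /h1 [/h2 [ux e2] e1]; rewrite e2. Qed.

Section Basics.
Variable v : place.

Lemma pl0 : v 0. Proof. by rewrite -(subrr 1); apply: plB; exact: pl1. Qed.
Lemma rho0 : rho v 0 = 0.
Proof. by rewrite -(subrr 1) rhoB ?subrr //; exact: pl1. Qed.
Lemma plN x : v x -> v (- x).
Proof. by rewrite -sub0r => hx; apply: plB => //; exact: pl0. Qed.
Lemma rhoN x : v x -> rho v (- x) = - rho v x.
Proof. by move=> hx; rewrite -sub0r rhoB ?rho0 ?sub0r //; exact: pl0. Qed.
Lemma plD x y : v x -> v y -> v (x + y).
Proof. by move=> hx hy; rewrite -[y]opprK; apply: plB => //; exact: plN. Qed.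
Lemma rhoD x y : v x -> v y -> rho v (x + y) = rho v x + rho v y.
Proof. by move=> hx hy; rewrite -[y in LHS]opprK rhoB ?rhoN ?opprK //; exact: plN. Qed.
Lemma plX x n : v x -> v (x ^+ n).
Proof. by move=> hx; elim: n => [|n IH]; rewrite ?exprS; [exact: pl1|exact: plM]. Qed.
Lemma rhoX x n : v x -> rho v (x ^+ n) = rho v x ^+ n.
Proof.
move=> hx; elim: n => [|n IH]; first exact: rho1.
by rewrite !exprS rhoM ?IH //; exact: plX.
Qed.
Lemma pl_nat n : v n%:R.
Proof. by elim: n => [|n IH]; rewrite ?mulrS; [exact: pl0|apply: plD => //; exact: pl1]. Qed.
Lemma rho_nat n : rho v n%:R = n%:R.
Proof.
elim: n => [|n IH]; first exact: rho0.
by rewrite !mulrS rhoD ?rho1 ?IH //; [exact: pl1|exact: pl_nat].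
Qed.
Lemma pl_sum (I : Type) (r : seq I) (P : pred I) (E : I -> K) :
  (forall i, P i -> v (E i)) ->
  v (\sum_(i <- r | P i) E i) /\ rho v (\sum_(i <- r | P i) E i) = \sum_(i <- r | P i) rho v (E i).
Proof.
move=> h; elim: r => [|i r [IH1 IH2]]; first by rewrite !big_nil; split; [exact: pl0|exact: rho0].
rewrite !big_cons; case: ifP => // /h hi; split; first exact: plD.
by rewrite rhoD ?IH2.
Qed.
Lemma rho_neq0 x : rho v x != 0 -> x != 0.
Proof. by apply: contra => /eqP ->; rewrite rho0. Qed.
Lemma rhoV x : v x -> rho v x != 0 -> rho v x^-1 = (rho v x)^-1.
Proof.
move=> hx x0; apply: (mulfI x0); rewrite -rhoM //; last exact: plV.
by rewrite !divff ?rho1 // rho_neq0.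
Qed.

Definition polyR (f : {poly K}) := forall i, v f`_i.
Definition pm (f : {poly K}) : {poly L} := map_poly (rho v) f.

Lemma coef_pm f i : (pm f)`_i = rho v f`_i.
Proof. by rewrite coef_map_id0 // rho0. Qed.

Lemma polyRB f g : polyR f -> polyR g -> polyR (f - g) /\ pm (f - g) = pm f - pm g.
Proof.
move=> hf hg; split=> [i|]; first by rewrite coefB; apply: plB.
by apply/polyP => i; rewrite coefB !coef_pm coefB rhoB.
Qed.

Lemma polyRM f g : polyR f -> polyR g -> polyR (f * g) /\ pm (f * g) = pm f * pm g.
Proof.
move=> hf hg.
have h i : v (f * g)`_i /\ rho v (f * g)`_i = (pm f * pm g)`_i.
  rewrite !coefM; have [|h1 ->] := @pl_sum _ (index_enum 'I_i.+1) xpredT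
     (fun j : 'I_i.+1 => f`_j * g`_(i - j)).
    by move=> j _; apply: plM.
  by split => //; apply: eq_bigr => j _; rewrite rhoM // !coef_pm.
split=> [i|]; first exact: (h i).1.
by apply/polyP => i; rewrite coef_pm (h i).2.
Qed.

Lemma polyRC c : v c -> polyR c%:P /\ pm c%:P = (rho v c)%:P.
Proof.
move=> hc; split=> [i|]; first by rewrite coefC; case: ifP => // _; exact: pl0.
by apply/polyP => i; rewrite coef_pm !coefC; case: ifP => // _; rewrite rho0.
Qed.

Lemma polyRX n : polyR 'X^n /\ pm 'X^n = 'X^n.
Proof.
split=> [i|]; first by rewrite coefXn; exact: pl_nat.
by apply/polyP => i; rewrite coef_pm !coefXn rho_nat.
Qed.

Lemma polyR_horner f x : polyR f -> v x -> v f.[x] /\ rho v f.[x] = (pm f).[rho v x].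
Proof.
move=> hf hx; rewrite horner_coef.
have [|h1 ->] := @pl_sum _ (index_enum 'I_(size f)) xpredT (fun i : 'I_(size f) => f`_i * x ^+ i).
  by move=> i _; apply: plM => //; exact: plX.
split => //; rewrite (horner_coef_wide _ (size_poly _ _)).
by apply: eq_bigr => i _; rewrite coef_pm rhoM ?rhoX //; exact: plX.
Qed.

End Basics.

Lemma polyR_ext v w f : extends v w -> polyR v f -> polyR w f /\ pm w f = pm v f.
Proof.
move=> h hf; split=> [i|]; first exact: (h _ (hf i)).1.
by apply/polyP => i; rewrite !coef_pm (h _ (hf i)).2.
Qed.

(** The new ring consists of the fractions f(x) / g(x) whose denominator reduces to a polynomial not
    vanishing at l. The hypothesis makes the residue f(l) / g(l) well defined, and fractions with
    nonzero residue are invertible by construction. *)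
Lemma place_adjoin (v : place) x l :
  (forall f, polyR v f -> f.[x] = 0 -> (pm v f).[l] = 0) ->
  exists w, [/\ extends v w, w x & rho w x = l].
Proof.
move=> h.
pose Q z y := exists f g, [/\ polyR v f, polyR v g, (pm v g).[l] != 0,
   z = f.[x] / g.[x] & y = (pm v f).[l] / (pm v g).[l]].
have nz g : polyR v g -> (pm v g).[l] != 0 -> g.[x] != 0.
  by move=> hg; apply: contra => /eqP /(h _ hg) ->.
have Qfun z y y' : Q z y -> Q z y' -> y = y'.
  move=> [f [g [hf hg g0 -> ->]]] [f' [g' [hf' hg' g0' e ->]]].
  have gx := nz _ hg g0; have gx' := nz _ hg' g0'.
  have [h1 e1] := polyRM hf hg'; have [h2 e2] := polyRM hf' hg.
  have [h3 e3] := polyRB h1 h2.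
  have := h _ h3; rewrite e3 e1 e2 !hornerE => ee; apply/eqP.
  rewrite eqr_div // -subr_eq0 ee //; apply/eqP.
  by rewrite subr_eq0 -eqr_div // e.
pose r z := if pselect (exists y, Q z y) is left hz then sval (cid hz) else 0.
have rE z y : Q z y -> r z = y.
  rewrite /r => hQ; case: pselect => [hz|[]]; last by exists y.
  by case: cid => y' hy' /=; exact: Qfun hy' hQ.
have QC c : v c -> Q c (rho v c).
  move=> hc; exists c%:P, 1%:P; have [h1 e1] := polyRC hc; have [h2 e2] := polyRC (pl1 v).
  by rewrite e1 e2 !hornerC rho1 !divr1 oner_neq0; split.
have QB z z' y y' : Q z y -> Q z' y' -> Q (z - z') (y - y').
  move=> [f [g [hf hg g0 -> ->]]] [f' [g' [hf' hg' g0' -> ->]]].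
  have gx := nz _ hg g0; have gx' := nz _ hg' g0'.
  exists (f * g' - f' * g), (g * g').
  have [h1 e1] := polyRM hf hg'; have [h2 e2] := polyRM hf' hg.
  have [h3 e3] := polyRB h1 h2; have [h4 e4] := polyRM hg hg'.
  rewrite e3 e4 e1 e2 !hornerE; split => //; first by rewrite mulf_neq0.
    by field; rewrite gx gx'.
  by field; rewrite g0 g0'.
have QM z z' y y' : Q z y -> Q z' y' -> Q (z * z') (y * y').
  move=> [f [g [hf hg g0 -> ->]]] [f' [g' [hf' hg' g0' -> ->]]].
  have gx := nz _ hg g0; have gx' := nz _ hg' g0'.
  exists (f * f'), (g * g').
  have [h1 e1] := polyRM hf hf'; have [h4 e4] := polyRM hg hg'.
  rewrite e4 e1 !hornerM; split => //; first by rewrite mulf_neq0.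
    by field; rewrite gx gx'.
  by field; rewrite g0 g0'.
have QV z y : Q z y -> y != 0 -> Q z^-1 y^-1.
  move=> [f [g [hf hg g0 -> ->]]]; rewrite mulf_eq0 negb_or => /andP [f0 _].
  by exists g, f; split => //; rewrite invf_div.
have Qx : Q x l.
  exists 'X, 1%:P; have [h1 e1] := polyRX v 1; have [h2 e2] := polyRC (pl1 v).
  by rewrite e1 e2 !hornerE rho1 !divr1 oner_neq0; split.
unshelve eexists (@Place (fun z => exists y, Q z y) r _ _ _ _ _ _ _).
- by exists (rho v 1); apply: QC; exact: pl1.
- by move=> z z' [y hy] [y' hy']; exists (y - y'); exact: QB.
- by move=> z z' [y hy] [y' hy']; exists (y * y'); exact: QM.
- by rewrite -(rho1 v); apply/rE/QC/pl1.
- by move=> z z' [y hy] [y' hy']; rewrite (rE _ _ hy) (rE _ _ hy'); apply/rE/QB.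
- by move=> z z' [y hy] [y' hy']; rewrite (rE _ _ hy) (rE _ _ hy'); apply/rE/QM.
- by move=> z [y hy]; rewrite (rE _ _ hy) => y0; exists y^-1; exact: QV.
split=> /=; [|by exists l|exact: rE].
by move=> c /QC hc; split; [exists (rho v c)|exact: rE].
Qed.

(* Chevalley's extension argument: [v] extends to [x] unless 1 is a combination of positive
   powers of [x] with coefficients in the maximal ideal, and not for both [x] and [x^-1]. *)
Definition obstructed (v : place) x := exists f, [/\ polyR v f, f.[x] = 0 & pm v f = 1].

(** Among the nonzero reductions of relations of x take one, g0, of least degree. Its leading
    coefficient lifts to a unit, so division can be carried out on the relations themselves, and g0
    divides every reduction: any root of g0 serves as l. Without a root g0 would be a nonzero
    constant, and scaling its relation would give an obstruction. *)
Lemma unobstructed_adjoin (v : place) x : ~ obstructed v x ->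
  exists l, forall f, polyR v f -> f.[x] = 0 -> (pm v f).[l] = 0.
Proof.
move=> nob.
have [all0|] := pselect (forall f, polyR v f -> f.[x] = 0 -> pm v f = 0).
  by exists 0 => f hf /(all0 _ hf) ->; rewrite horner0.
move=> /existsNP [f1] /not_implyP [hf1 /not_implyP [fx1 /eqP nz1]].
pose good n := exists f, [/\ polyR v f, f.[x] = 0, pm v f != 0 & size (pm v f) = n].
have ex : exists n, `[< good n >] by exists (size (pm v f1)); apply/asboolP; exists f1.
case: (ex_minnP ex) => s /asboolP [f0 [hf0 fx0 nz0 <-]] min_s.
set g0 := pm v f0 in nz0 min_s.
have lu : rho v f0`_(size g0).-1 != 0 by rewrite -coef_pm -/g0 -/(lead_coef g0) lead_coef_eq0.
set u := f0`_(size g0).-1 in lu.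
have hu0 : v u by exact: hf0.
have hu : v u^-1 by exact: plV.
have [l rl] : exists l, root g0 l.
  apply/closed_rootP/negP => /eqP sg0; apply: nob.
  have [h1 e1] := polyRC hu; have [h2 e2] := polyRM h1 hf0.
  exists (u^-1%:P * f0); split => //; first by rewrite hornerE fx0 mulr0.
  move/eqP/size_poly1P: (sg0) => [c c0 gc].
  have uc : rho v u = c by rewrite /u -coef_pm -/g0 sg0 gc coefC.
  by rewrite e2 e1 -/g0 gc rhoV // uc -polyCM mulVf.
exists l => h hh hx; have [n] := ubnP (size (pm v h)).
elim: n h hh hx => // n IH h hh hx lt_h.
have [->|h0] := eqVneq (pm v h) 0; first by rewrite horner0.
have le_s : (size g0 <= size (pm v h))%N by apply: min_s; apply/asboolP; exists h.
(* Chosen to cancel the leading term of the reduction of h; the degree of h itself need not drop. *)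
pose a := h`_(size (pm v h)).-1 * u^-1.
have ha : v a by apply: plM => //; exact: hh.
have [h1 e1] := polyRC ha; have [h2 e2] := polyRX v (size (pm v h) - size g0).
have [h3 e3] := polyRM h1 h2; have [h4 e4] := polyRM h3 hf0.
have [h5 e5] := polyRB hh h4.
have -> : (pm v h).[l] = (pm v (h - a%:P * 'X^(size (pm v h) - size g0) * f0)).[l].
  by rewrite e5 e4 !hornerE -/g0 (eqP rl) mulr0 subr0.
apply: IH => //; first by rewrite !hornerE fx0 hx mulr0 subr0.
rewrite ltnS in lt_h; apply: leq_trans lt_h.
have sh : (0 < size (pm v h))%N by rewrite size_poly_gt0.
have sg : (0 < size g0)%N by rewrite size_poly_gt0.
rewrite -(prednK sh) ltnS prednK //; apply/leq_sizeP => j le_j.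
rewrite e5 e4 e3 e1 e2 -/g0 coefB -mulrA coefCM coefXnM.
have nlt : (j < size (pm v h) - size g0)%N = false.
  apply/negbTE; rewrite -leqNgt; apply: leq_trans le_j.
  by rewrite -subn1 leq_sub2l.
rewrite nlt; move: le_j; rewrite leq_eqVlt => /predU1P [<-|lt_j]; last first.
  rewrite prednK // in lt_j.
  rewrite !nth_default ?mulr0 ?subr0 //.
  by rewrite leq_subRL ?subnK //; apply: leq_trans (leq_subr _ _) lt_j.
have -> : ((size (pm v h)).-1 - (size (pm v h) - size g0) = (size g0).-1)%N.
  by rewrite -!subn1 subnAC subKn.
rewrite /a rhoM // rhoV // !coef_pm -/u; apply/eqP; rewrite subr_eq0 divfK //.
Qed.

(** Say g has the smaller degree. Its reversal G is a relation of x with top coefficient g_0, a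
    unit, so a multiple of G cancels the top of f. As f reduces to 1, the multiplier has residue 0;
    the new f still reduces to 1 and the total size drops. *)
Lemma not_both_obstructed (v : place) x : x != 0 -> obstructed v x -> ~ obstructed v x^-1.
Proof.
move=> x0 [f [hf fx ef]] [g [hg gx eg]].
have [n] := ubnP (size f + size g).
elim: n x f g x0 hf fx ef hg gx eg => // n IH x f g x0 hf fx ef hg gx eg lt_n.
wlog le : x f g x0 hf fx ef hg gx eg lt_n / (size g <= size f)%N.
  move=> W; case: (leqP (size g) (size f)) => [|/ltnW] le; first exact: (W x f g).
  by apply: (W x^-1 g f); rewrite ?invr_eq0 ?invrK // addnC.
have g00 : rho v g`_0 = 1 by rewrite -coef_pm eg coef1.
have g0u : rho v g`_0 != 0 by rewrite g00 oner_neq0.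
have sg : (1 < size g)%N.
  rewrite ltnNge; apply/negP => /size1_polyC e; move: gx; rewrite e hornerC => /eqP.
  by rewrite (negPf (rho_neq0 g0u)).
have sf := leq_trans sg le.
pose a := f`_(size f).-1 * (g`_0)^-1.
have hg0 : v g`_0 by exact: hg.
have hgi : v (g`_0)^-1 by exact: plV.
have ha : v a by apply: plM => //; exact: hf.
have ra : rho v a = 0.
  rewrite rhoM // -coef_pm ef coef1 (_ : _ == _ = false) ?mul0r //.
  by case: (size f) sf => [|[]].
pose G := \poly_(i < size g) g`_((size g).-1 - i).
have hG : polyR v G by move=> i; rewrite coef_poly; case: ifP => // _; exact: pl0.
have Gx : G.[x] = 0 by rewrite horner_rev_inv // gx mulr0.
have [h1 e1] := polyRC ha; have [h2 e2] := polyRX v (size f - size g).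
have [h3 e3] := polyRM h1 h2; have [h4 e4] := polyRM h3 hG.
have [h5 e5] := polyRB hf h4.
apply: (IH x (f - a%:P * 'X^(size f - size g) * G) g) => //.
- by rewrite !hornerE fx Gx mulr0 subr0.
- by rewrite e5 e4 e3 e1 ra !mul0r subr0.
rewrite ltnS in lt_n; apply: leq_trans lt_n; rewrite ltn_add2r.
have sf0 : (0 < size f)%N by rewrite ltnW.
rewrite -[X in (_ < X)%N](prednK sf0) ltnS; apply/leq_sizeP => j le_j.
rewrite coefB -mulrA coefCM coefXnM.
have nlt : (j < size f - size g)%N = false.
  apply/negbTE; rewrite -leqNgt; apply: leq_trans le_j.
  by rewrite -subn1 leq_sub2l // ltnW.
rewrite nlt; move: le_j; rewrite leq_eqVlt => /predU1P [<-|lt_j]; last first.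
  rewrite prednK // in lt_j.
  rewrite [f`_j]nth_default // coef_poly ifN ?mulr0 ?subr0 //.
  by rewrite -leqNgt leq_subRL ?subnK //; apply: leq_trans (leq_subr _ _) lt_j.
have -> : ((size f).-1 - (size f - size g) = (size g).-1)%N.
  by rewrite -!subn1 subnAC subKn.
rewrite coef_poly prednK ?leqnn; last by rewrite ltnW.
by rewrite subnn /a divfK ?subrr // (rho_neq0 g0u).
Qed.

Theorem place_extension (v : place) x : exists w, extends v w /\ (w x \/ w x^-1).
Proof.
have [->|x0] := eqVneq x 0; first by exists v; split => //; left; exact: pl0.
have [ob|nob] := pselect (obstructed v x).
  have /unobstructed_adjoin [l /place_adjoin [w [vw wx _]]] := not_both_obstructed x0 ob.
  by exists w; split => //; right.
have [l /place_adjoin [w [vw wx _]]] := unobstructed_adjoin nob.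
by exists w; split => //; left.
Qed.

End Place.

(** * Lattices and monomials *)

Section Lattice.
Variable V : zmodType.

(** One generator per separating coordinate: the kernel of the first coordinate is treated by
    induction, and an element with least positive first coordinate is added. A group separated by
    fewer coordinates gets fewer generators, which drives the rank reduction for radicals. *)
Lemma lattice_generators (m : nat) (U : V -> Prop) (f : 'I_m -> V -> int) :
  is_subgroup U -> (forall i x y, f i (x - y) = f i x - f i y) ->
  (forall u, U u -> (forall i, f i u = 0) -> u = 0) ->
  exists us : 'I_m -> V, (forall i, U (us i)) /\
    forall u, U u -> exists z : 'I_m -> int, u = \sum_i us i *~ z i.
Proof.
elim: m U f => [|m IH] U f [U0 UB] fB inj.
  exists (fun=> 0); split=> [[]//|u /inj ->]; last by case.
  by exists (fun=> 0); rewrite big_ord0.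
have f0 i : f i 0 = 0 by rewrite -(subrr 0) fB subrr.
have fN i x : f i (- x) = - f i x by rewrite -sub0r fB f0 sub0r.
have fMz i x (z : int) : f i (x *~ z) = f i x * z.
  have fMn n : f i (x *+ n) = f i x * n.
    elim: n => [|n IHn]; first by rewrite mulr0n f0 mulr0.
    by rewrite mulrSr -[X in _ + X]opprK fB fN opprK IHn intS mulrDr mulr1 addrC.
  case: z => n; first by rewrite -pmulrn.
  by rewrite NegzE mulrNz fN -pmulrn fMn mulrN.
have UN x : U x -> U (- x) by rewrite -sub0r; exact: UB.
have UMz x (z : int) : U x -> U (x *~ z).
  move=> hx; have UMn n : U (x *+ n).
    by elim: n => [|n IHn] //; rewrite mulrSr -[X in _ + X]opprK; apply/UB/UN.
  by case: z => n; rewrite ?NegzE ?mulrNz; [exact: UMn|exact/UN/UMn].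
have [us [hus gen]] : exists us : 'I_m -> V, (forall i, U (us i) /\ f ord0 (us i) = 0) /\
    forall u, U u -> f ord0 u = 0 -> exists z : 'I_m -> int, u = \sum_i us i *~ z i.
  have [|||us [h1 h2]] := IH (fun u => U u /\ f ord0 u = 0) (fun i => f (lift ord0 i)).
  - by split=> // x y [hx ex] [hy ey]; split; [exact: UB|rewrite fB ex ey subrr].
  - by move=> i x y; exact: fB.
  - move=> u [hu e] h; apply: inj => // i.
    by case: (unliftP ord0 i) => [j ->|->].
  by exists us; split => // u hu e; exact: h2.
suff [u0 [hu0 h0]] : exists u0, U u0 /\ forall u, U u -> exists z : int, f ord0 u = f ord0 u0 * z.
  exists (fun i => if unlift ord0 i is Some j then us j else u0); split.
    by move=> i; case: unlift => // j; exact: (hus j).1.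
  move=> u hu; have [z0 e0] := h0 u hu.
  have [||z ez] := gen (u - u0 *~ z0); first by apply: UB => //; exact: UMz.
    by rewrite fB fMz e0 subrr.
  exists (fun i => if unlift ord0 i is Some j then z j else z0).
  rewrite big_ord_recl unlift_none; under eq_bigr => i _ do rewrite liftK.
  by rewrite -ez addrC subrK.
have [z0|/existsNP [u1 /not_implyP [hu1 /eqP n1]]] := pselect (forall u, U u -> f ord0 u = 0).
  by exists 0; split => // u /z0 ->; exists 0; rewrite mulr0.
pose good n := exists2 u, U u & f ord0 u = n.+1.
have ex : exists n, `[< good n >].
  case e : (f ord0 u1) n1 => [[|n]|n] // _.
    by exists n; apply/asboolP; exists u1.
  by exists n; apply/asboolP; exists (- u1); [exact: UN|rewrite fN e NegzE opprK].
case: (ex_minnP ex) => n /asboolP [u0 hu0 e0] min_n.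
exists u0; split => // u hu; exists (f ord0 u %/ n.+1)%Z; rewrite e0.
rewrite [LHS](divz_eq _ n.+1) mulrC; set q := (_ %/ _)%Z.
suff -> : (f ord0 u %% n.+1)%Z = 0 by rewrite addr0.
have lt : (f ord0 u %% n.+1 < n.+1)%Z by rewrite ltz_pmod.
have ge : (0 <= f ord0 u %% n.+1)%Z by rewrite modz_ge0.
case E : (f ord0 u %% n.+1)%Z ge lt => [[|r]|] // _ lt.
rewrite ltz_nat ltnS ltnNge in lt; case/negP: lt; apply/min_n/asboolP.
exists (u - u0 *~ q); first by apply: UB => //; exact: UMz.
by rewrite fB fMz e0 -E {1}(divz_eq (f ord0 u) n.+1) mulrC addrC addKr.
Qed.

End Lattice.

Section Monomial.
Variables (K : fieldType) (l : nat) (c : 'I_l -> K).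
Hypothesis c0 : forall i, c i != 0.

Definition mon (e : 'rV[int]_l) : K := \prod_i c i ^ e 0 i.

Lemma mon0 : mon 0 = 1.
Proof. by rewrite /mon big1 // => i _; rewrite mxE expr0z. Qed.

Lemma monD e f : mon (e + f) = mon e * mon f.
Proof. by rewrite /mon -big_split; apply: eq_bigr => i _; rewrite mxE expfzDr. Qed.

Definition mon_neq0 := exphom_neq0 mon0 monD.
Definition monN := exphomN mon0 monD.
Definition monB := exphomB mon0 monD.
Definition monMn := exphomMn mon0 monD.
Definition monMz := exphomMz mon0 monD.
Definition mon_sum := exphom_sum mon0 monD.

Lemma mon_ind (P : K -> Prop) : P 1 -> (forall x y, P x -> P y -> P (x * y)) ->
  (forall i, P (c i)) -> (forall i, P (c i)^-1) -> forall e, P (mon e).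
Proof.
move=> P1 PM Pc PV e; rewrite /mon; apply: big_ind => // i _.
have PX x n : P x -> P (x ^+ n).
  by move=> hx; elim: n => [|n IH]; rewrite ?expr0 ?exprS //; exact: PM.
by case: (e 0 i) => n; rewrite ?NegzE -?exprnN -?exprVn; apply: PX.
Qed.

End Monomial.

Lemma mon_mon (K : fieldType) l m (c : 'I_l -> K) (us : 'I_m -> 'rV[int]_l) (z : 'I_m -> int) :
  (forall i, c i != 0) ->
  mon c (\sum_i us i *~ z i) = mon (fun i => mon c (us i)) (\row_i z i).
Proof.
move=> c0; rewrite mon_sum //; apply: eq_bigr => i _.
by rewrite mxE monMz.
Qed.

(** * Places and radicals over a base field *)

Section PlaceMore.
Variables (K : fieldType) (L : closedFieldType).
Implicit Types (v w : place K L).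

(** The place extends to y or to its inverse. A zero residue of the one present would make the
    constant coefficient of its equation, f or the reversal of f, reduce to 0. So it is a unit, and
    y lies in the ring either way. *)
Lemma place_integral v (f : {poly K}) y : y != 0 -> polyR v f -> f.[y] = 0 ->
  rho v f`_0 != 0 -> rho v (lead_coef f) != 0 ->
  exists w, [/\ extends v w, w y & rho w y != 0].
Proof.
move=> y0 hf fy h0 hl; have [w [vw wy]] := place_extension v y; exists w.
have [hwf ew] := polyR_ext vw hf.
have [w0 r0] := vw _ (hf 0%N); have [wl rl] := vw _ (hf (size f).-1).
have key (g : {poly K}) z : polyR w g -> g.[z] = 0 -> rho w g`_0 != 0 -> w z -> rho w z != 0.
  move=> hg gz g0 wz; apply: contraNneq g0 => e.
  have [_] := polyR_horner hg wz; rewrite gz rho0 e horner_coef0 coef_pm => <-.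
  by [].
have [wy'|nwy] := pselect (w y); first by split => //; apply: (key f) => //; rewrite r0.
have {}wy : w y^-1 by case: wy.
suff : rho w y^-1 != 0 by move=> h; case: nwy; rewrite -[y]invrK; exact: plV.
pose G := \poly_(i < size f) f`_((size f).-1 - i).
have f0 : (0 < size f)%N.
  rewrite lt0n size_poly_eq0; apply: contraNneq h0 => ->.
  by rewrite coef0 rho0.
apply: (key G) => //.
- by move=> i; rewrite coef_poly; case: ifP => // _; exact: pl0.
- by rewrite horner_rev_inv ?invr_eq0 // invrK fy mulr0.
- by rewrite coef_poly f0 subn0 -/(lead_coef f) rl.
Qed.

Lemma place_radical v x n y : (0 < n)%N -> v y -> rho v y != 0 -> x ^+ n = y ->
  exists w, [/\ extends v w, w x & rho w x != 0].
Proof.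
move=> n0 vy y0 e.
have x0 : x != 0.
  apply: contraNneq (rho_neq0 y0) => x0.
  by rewrite -e x0 expr0n gtn_eqF.
have [h1 e1] := polyRX v n; have [h2 e2] := polyRC vy; have [h3 _] := polyRB h1 h2.
apply: (@place_integral v ('X^n - y%:P)) => //.
- by rewrite !hornerE e subrr.
- by rewrite coefB coefXn coefC ltn_eqF //= sub0r rhoN // oppr_eq0.
- by rewrite (monicP (monicXnsubC _ n0)) rho1 oner_neq0.
Qed.

Section Over.
Variables (F : fieldType) (inc : {rmorphism F -> K}).

(** The ring contains F, and the inverse of y is a polynomial in y over F, so it lies in the ring
    too. Hence residues are faithful on algebraic elements. *)
Lemma place_algebraic_neq0 v y : (forall a, v (inc a)) ->
  algebraicOver inc y -> y != 0 -> v y -> rho v y != 0.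
Proof.
move=> hF hy y0 vy; have [q eq] := algebraic_inv_horner hy.
have hq : polyR v (map_poly inc q) by move=> i; rewrite coef_map; exact: hF.
have [h1 e1] := polyR_horner hq vy; rewrite -eq in h1.
apply/eqP => e; have := rho1 v; rewrite -(mulfV y0) rhoM // e mul0r => /esym/eqP.
by rewrite oner_eq0.
Qed.

Lemma place_algebraic v y : (forall a, v (inc a)) -> algebraicOver inc y ->
  exists w, extends v w /\ w y.
Proof.
move=> hF hy; have [->|y0] := eqVneq y 0; first by exists v; split => //; exact: pl0.
have [w [vw [wy|wy]]] := place_extension v y; first by exists w.
exists w; split => //; rewrite -[y]invrK; apply: plV => //.
apply: place_algebraic_neq0 => //; last by rewrite invr_eq0.
  by move=> a; exact: (vw _ (hF a)).1.
exact: algebraic_inv.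
Qed.

Lemma place_algebraic_seq v (ys : seq K) : (forall a, v (inc a)) ->
  (forall y, y \in ys -> algebraicOver inc y) ->
  exists w, extends v w /\ forall y, y \in ys -> w y.
Proof.
move=> hF; elim: ys v hF => [|y ys IH] v hF h; first by exists v.
have [w [vw wy]] := place_algebraic hF (h y (mem_head _ _)).
have [|z hz|u [wu hu]] := IH w; first by move=> a; exact: (vw _ (hF a)).1.
  by apply: h; rewrite in_cons hz orbT.
exists u; split; first exact: extends_trans vw wu.
by move=> z; rewrite in_cons => /predU1P [->|/hu //]; exact: (wu _ wy).1.
Qed.

End Over.

(** The trivial place, whose ring is F itself. Relations over it are polynomials over F, so
    [place_adjoin] can give a transcendental element any residue and an algebraic one any
    conjugate. *)
Lemma base_place (F : fieldType) (inc : {rmorphism F -> K}) (j : {rmorphism F -> L}) :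
  exists v, (forall a, v (inc a) /\ rho v (inc a) = j a) /\ forall x, v x -> exists a, x = inc a.
Proof.
pose r x := if pselect (exists a, x = inc a) is left h then j (sval (cid h)) else 0.
have rE a : r (inc a) = j a.
  rewrite /r; case: pselect => [h|[]]; last by exists a.
  by case: cid => b /= /fmorph_inj ->.
unshelve eexists (@Place K L (fun x => exists a, x = inc a) r _ _ _ _ _ _ _).
- by exists 1; rewrite rmorph1.
- by move=> _ _ [a ->] [b ->]; exists (a - b); rewrite rmorphB.
- by move=> _ _ [a ->] [b ->]; exists (a * b); rewrite rmorphM.
- by rewrite -(rmorph1 inc) rE rmorph1.
- by move=> _ _ [a ->] [b ->]; rewrite -rmorphB !rE rmorphB.
- by move=> _ _ [a ->] [b ->]; rewrite -rmorphM !rE rmorphM.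
- by move=> _ [a ->] _; exists a^-1; rewrite fmorphV.
by split => //= a; split; [exists a|].
Qed.

(** If x differed from 1, the sum 1 + x + ... + x^(n-1) would vanish, while its residue is n. *)
Lemma place_torsion_inj v x n : [pchar L] =i pred0 -> (0 < n)%N -> v x ->
  x ^+ n = 1 -> rho v x = 1 -> x = 1.
Proof.
move=> L0 n0 vx e r1; apply/eqP; rewrite -subr_eq0; apply: contraT => x1.
have := subrX1 x n; rewrite e subrr => /esym/eqP; rewrite mulf_eq0 (negPf x1) /=.
move=> /eqP s0; have [|_] := @pl_sum _ _ v _ (index_enum 'I_n) xpredT (fun i : 'I_n => x ^+ i).
  by move=> i _; exact: plX.
rewrite s0 rho0 (eq_bigr (fun=> 1)) => [|i _]; last by rewrite rhoX // r1 expr1n.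
by rewrite sumr_const card_ord => /esym/eqP; rewrite pchar0_natr // gtn_eqF.
Qed.

Lemma place_mon v l (c : 'I_l -> K) e : (forall i, v (c i)) -> (forall i, rho v (c i) != 0) ->
  v (mon c e) /\ rho v (mon c e) = mon (fun i => rho v (c i)) e.
Proof.
move=> hc c0; have hX x n : v x -> rho v x != 0 -> v (x ^ n) /\ rho v (x ^ n) = rho v x ^ n.
  move=> vx x0; case: n => n; first by split; [exact: plX|exact: rhoX].
  have vX := plX n.+1 vx; have rX := rhoX n.+1 vx.
  have X0 : rho v (x ^+ n.+1) != 0 by rewrite rX expf_neq0.
  by rewrite NegzE -!exprnN -rX; split; [exact: plV|exact: rhoV].
rewrite /mon; elim: (index_enum _) => [|i r [IH1 IH2]].
  by rewrite !big_nil rho1; split => //; exact: pl1.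
have [h1 h2] := hX _ (e 0 i) (hc i) (c0 i).
by rewrite !big_cons rhoM // IH2 h2; split => //; exact: plM.
Qed.

End PlaceMore.

(** * Degree bounds in towers and simple extensions *)

Section Towers.
Variables (F K : fieldType) (inc : {rmorphism F -> K}).

(** The top power of y is rewritten through Q, whose coefficients and inverse leading coefficient
    preserve the span of [S]. *)
Lemma stable_tower S y (Q : {poly K}) : Q != 0 -> Q.[y] = 0 ->
  (forall i, stable inc S Q`_i) -> stable inc S (lead_coef Q)^-1 ->
  stable inc (prodseq S (powseq y (size Q).-1)) y.
Proof.
move=> Q0 Qy hQ hl z /allpairsP [[s u] /= [sS /mapP [i]]].
rewrite mem_iota add0n => /= lt_i -> ->.
rewrite mulrCA -exprS.
have [lt|ge] := ltnP i.+1 (size Q).-1.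
  by apply: span_prod; [exact: span_mem|exact/span_mem/mem_powseq].
have -> : i.+1 = (size Q).-1 by apply/eqP; rewrite eqn_leq ge andbT.
have sQ : size Q = (size Q).-1.+1 by rewrite prednK // lt0n size_poly_eq0.
have l0 : lead_coef Q != 0 by rewrite lead_coef_eq0.
move: Qy; rewrite (@horner_coef_wide _ (size Q)) // sQ big_ord_recr /=.
rewrite -/(lead_coef Q) addrC => /eqP; rewrite addr_eq0 => /eqP e.
have -> : s * y ^+ (size Q).-1 =
    \sum_(j < (size Q).-1) (- (lead_coef Q)^-1 * (Q`_j * s)) * y ^+ j.
  rewrite -[X in s * X](mulKf l0) e mulrN -mulNr mulr_sumr mulr_sumr.
  by apply: eq_bigr => j _; ring.
apply: span_sum => j; apply: span_prod; last exact/span_mem/mem_powseq/ltn_ord.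
rewrite mulNr -mulrN; apply: stable_span => //.
rewrite -mulN1r -(rmorph1 inc) -rmorphN; apply: spanZ; exact: hQ.
Qed.

Lemma mem1_prodseq (S : seq K) (y : K) n : (0 < n)%N -> 1 \in S -> 1 \in prodseq S (powseq y n).
Proof.
move=> n0 S1; apply/allpairsP; exists (1, 1); split; rewrite ?mulr1 //=.
by rewrite -(expr0 y); exact: mem_powseq.
Qed.

Lemma pdeg_tower S y (Q : {poly K}) D : Q != 0 -> Q.[y] = 0 -> 1 \in S -> (size Q <= D.+1)%N ->
  (forall i, stable inc S Q`_i) -> stable inc S (lead_coef Q)^-1 ->
  pdeg inc (size S * D) y.
Proof.
move=> Q0 Qy S1 sQ hQ hl; have hs := stable_tower Q0 Qy hQ hl.
have d0 : (0 < (size Q).-1)%N.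
  rewrite -ltnS prednK ?size_poly_gt0 // ltnNge; apply/negP => /size1_polyC e.
  by move: Qy Q0; rewrite e hornerC => ->; rewrite polyC0 eqxx.
apply: pdeg_leq (stable_pdeg (mem1_prodseq y d0 S1) (oner_neq0 _) hs).
rewrite size_prodseq size_map size_iota leq_mul2l -ltnS prednK ?size_poly_gt0 //.
by rewrite sQ orbT.
Qed.

Lemma lead_inv_stable S (Q : {poly K}) : 1 \in S -> 
  (forall i, stable inc S Q`_i) -> stable inc S (lead_coef Q)^-1.
Proof.
move=> S1 hQ; apply: stableV; last exact: hQ.
exact: pdeg_algebraic (stable_pdeg S1 (oner_neq0 _) (hQ _)).
Qed.

End Towers.

Section SimpleExtension.
Variables (F K : fieldType) (inc : {rmorphism F -> K}).

Definition ev (t : K) : {rmorphism {poly F} -> K} := horner_eval t \o map_poly inc.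

Lemma evE t p : ev t p = (map_poly inc p).[t]. Proof. by []. Qed.

Lemma evC t a : ev t a%:P = inc a.
Proof. by rewrite evE map_polyC hornerC. Qed.

Lemma evX t : ev t 'X = t.
Proof. by rewrite evE map_polyX hornerX. Qed.

Lemma ev_eq0 t p : ~ algebraicOver inc t -> (ev t p == 0) = (p == 0).
Proof.
move=> tr; apply/eqP/eqP => [e|->]; last exact: rmorph0.
by apply: contrapT => /eqP p0; apply: tr; exists p => //; exact/eqP.
Qed.

Definition generated_by (F' : fieldType) (inc' : {rmorphism F' -> K}) (t : K) :=
  [/\ forall a, exists b, inc' b = inc a, exists b, inc' b = t &
   forall y, exists p q, ev t q != 0 /\ inc' y = ev t p / ev t q].

Lemma simple_extension t : exists (F' : fieldType) (inc' : {rmorphism F' -> K}),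
  generated_by inc' t.
Proof.
pose Q z := exists p q, ev t q != 0 /\ z = ev t p / ev t q.
have Q1 : Q 1 by exists 1, 1; rewrite rmorph1 divr1 oner_neq0.
have QB x y : Q x -> Q y -> Q (x - y).
  move=> [p [q [q0 ->]]] [p' [q' [q0' ->]]]; exists (p * q' - p' * q), (q * q').
  by rewrite rmorphB !(rmorphM (ev t)) mulf_neq0 //; split => //; field; rewrite q0 q0'.
have QM x y : Q x -> Q y -> Q (x * y).
  move=> [p [q [q0 ->]]] [p' [q' [q0' ->]]]; exists (p * p'), (q * q').
  by rewrite !(rmorphM (ev t)) mulf_neq0 //; split => //; field; rewrite q0 q0'.
have QV x : Q x -> Q x^-1.
  move=> [p [q [q0 ->]]]; have [p0|p0] := eqVneq (ev t p) 0.
    by exists 0, 1; rewrite rmorph0 rmorph1 oner_neq0 p0 !mul0r invr0.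
  by exists q, p; rewrite invf_div.
have [F' [inc' h]] := subfield_type (Subfield Q1 QB QM QV).
exists F', inc'; split.
- move=> a; have [|b ->] := (h (inc a)).1; last by exists b.
  by exists a%:P, 1; rewrite evC rmorph1 divr1 oner_neq0.
- have [|b ->] := (h t).1; last by exists b.
  by exists 'X, 1; rewrite evX rmorph1 divr1 oner_neq0.
- by move=> y; apply/h; exists y.
Qed.

Variables (F' : fieldType) (inc' : {rmorphism F' -> K}) (t : K).
Hypothesis gen : generated_by inc' t.

Lemma clear_denominators D x : pdeg inc' D x ->
  exists P : {poly {poly F}}, [/\ map_poly (ev t) P != 0, (size P <= D.+1)%N & (map_poly (ev t) P).[x] = 0].
Proof.
have [_ _ h3] := gen.
have [n hn] := choice h3; have [d hd] := choice hn.
move=> [p [p0 sp rp]].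
pose P := \poly_(i < size p) (n p`_i * \prod_(j < size p | j != i :> nat) d p`_j).
pose dd := \prod_(j < size p) ev t (d p`_j).
have dd0 : dd != 0 by apply/prodf_neq0 => j _; exact: (hd _).1.
have PE : map_poly (ev t) P = dd *: map_poly inc' p.
  apply/polyP => i; rewrite coefZ [LHS](coef_map (ev t)) [X in _ * X](coef_map inc').
  rewrite coef_poly; case: ltnP => h.
    have [q0 e] := hd p`_i.
    have -> : dd = ev t (d p`_i) * \prod_(j < size p | j != i :> nat) ev t (d p`_j).
      by rewrite /dd (bigD1 (Ordinal h)).
    rewrite [LHS](rmorphM (ev t)) [X in _ * X](rmorph_prod (ev t)) [X in _ = _ * X]e.
    by set B := \prod_(_ < _ | _) _; field.
  by rewrite [p`_i]nth_default // [LHS](rmorph0 (ev t)) [X in _ * X](rmorph0 inc') mulr0.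
exists P; rewrite PE; split.
- by rewrite scaler_eq0 negb_or dd0 map_poly_eq0.
- exact: leq_trans (size_poly _ _) sp.
- by rewrite hornerZ (eqP rp) mulr0.
Qed.

End SimpleExtension.

Section MinPoly.
Variables (F K : fieldType) (inc : {rmorphism F -> K}).

Lemma min_poly_exists a : algebraicOver inc a ->
  exists mu : {poly F}, [/\ mu != 0, (1 < size mu)%N & forall p, (ev inc a p == 0) = (mu %| p)].
Proof.
move=> [p0 p00 rp0].
pose good n := exists p : {poly F}, [/\ p != 0, ev inc a p = 0 & size p = n].
have ex : exists n, `[< good n >].
  by exists (size p0); apply/asboolP; exists p0; split => //; exact/eqP.
case: (ex_minnP ex) => n /asboolP [mu [mu0 emu <-]] min_n.
exists mu; split => //.
  rewrite ltnNge; apply/negP => /size1_polyC e; move: emu mu0.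
  by rewrite e evC => /eqP; rewrite fmorph_eq0 polyC_eq0 => ->.
move=> p; apply/idP/idP => [/eqP ep|/dvdpP [q ->]]; last by rewrite rmorphM emu mulr0.
rewrite /dvdp; apply: contraT => r0.
have := min_n (size (p %% mu)); rewrite leqNgt ltn_modp mu0 => /(_ _)/negP [] //.
apply/asboolP; exists (p %% mu); split => //; apply/eqP.
by move: ep; rewrite {1}(divp_eq p mu) rmorphD rmorphM emu mulr0 add0r => ->.
Qed.

Lemma lift_poly (Q : {poly K}) : (forall i, exists b, inc b = Q`_i) ->
  exists Q', map_poly inc Q' = Q.
Proof.
move=> h; have [g hg] := choice h; exists (\poly_(i < size Q) g i).
apply/polyP => i; rewrite [LHS](coef_map inc) coef_poly; case: ltnP => lt; first exact: hg.
by rewrite nth_default // [LHS](rmorph0 inc).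
Qed.

End MinPoly.

(** * Degrees of residues and generic specializations *)

Section ResidueDegree.
Variables (F : fieldType) (K : closedFieldType) (inc : {rmorphism F -> K}).

Definition place_over (v : place K K) := forall a, v (inc a) /\ rho v (inc a) = inc a.

Lemma place_over_ext v w : extends v w -> place_over v -> place_over w.
Proof. by move=> h hv a; have [h1 h2] := hv a; have [h3 h4] := h _ h1; rewrite h4. Qed.

Lemma place_ev v t p : place_over v -> v t ->
  v (ev inc t p) /\ rho v (ev inc t p) = ev inc (rho v t) p.
Proof.
move=> hv vt; have hp : polyR v (map_poly inc p).
  by move=> i; rewrite coef_map; exact: (hv _).1.
have [h1 h2] := polyR_horner hp vt; split => //.
rewrite !evE h2; congr (_.[_]); apply/polyP => i.
by rewrite coef_pm !coef_map; exact: (hv _).2.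
Qed.

Lemma place_ev_poly v t (P : {poly {poly F}}) : place_over v -> v t ->
  polyR v (map_poly (ev inc t) P) /\
  pm v (map_poly (ev inc t) P) = map_poly (ev inc (rho v t)) P.
Proof.
move=> hv vt; split=> [i|].
  by rewrite (coef_map (ev inc t)); exact: (place_ev _ hv vt).1.
apply/polyP => i; rewrite coef_pm (coef_map (ev inc t)) (coef_map (ev inc _)).
exact: (place_ev _ hv vt).2.
Qed.

(** Reducing P gives an equation for the residue of x over F(rho t), unless every coefficient
    vanishes at [rho v t]. In that case the minimal polynomial of [rho v t] divides P and can be
    cancelled, because t is transcendental; the leading coefficient loses degree, so this stops. *)
Lemma residue_degree v t S x D (P : {poly {poly F}}) :
  place_over v -> v t -> ~ algebraicOver inc t -> 1 \in S -> stable inc S (rho v t) ->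
  P != 0 -> (size P <= D.+1)%N -> (map_poly (ev inc t) P).[x] = 0 -> v x ->
  pdeg inc (size S * D) (rho v x).
Proof.
move=> hv vt tr S1 hS P0 sP Px vx.
have alg : algebraicOver inc (rho v t) by exact: pdeg_algebraic (stable_pdeg S1 (oner_neq0 _) hS).
have [mu [mu0 smu hmu]] := min_poly_exists alg.
have [n] := ubnP (size (lead_coef P)); elim: n P P0 sP Px => // n IH P P0 sP Px lt_n.
have [h1 e1] := place_ev_poly P hv vt.
have hQ i : stable inc S (map_poly (ev inc (rho v t)) P)`_i.
  by rewrite (coef_map (ev inc _)); apply: stable_horner.
have [Q0|Q0] := eqVneq (map_poly (ev inc (rho v t)) P) 0; last first.
  apply: (pdeg_tower Q0) => //; last exact: lead_inv_stable.
    by have [_] := polyR_horner h1 vx; rewrite Px rho0 e1 => <-.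
  by apply: leq_trans (size_poly _ _) sP.
have dv i : mu %| P`_i.
  by rewrite -hmu; have := coef_map (ev inc (rho v t)) P i; rewrite Q0 coef0 => <-.
pose P' := \poly_(i < size P) (P`_i %/ mu).
have PE : P = mu *: P'.
  apply/polyP => i; rewrite coefZ coef_poly; case: ltnP => h.
    by rewrite mulrC divpK.
  by rewrite nth_default // mulr0.
have P0' : P' != 0 by apply: contra P0 => /eqP e; rewrite PE e scaler0.
apply: (IH P') => //.
- exact: leq_trans (size_poly _ _) sP.
- move: Px; rewrite {1}PE (_ : map_poly _ (mu *: P') = ev inc t mu *: map_poly (ev inc t) P').
    by rewrite hornerZ => /eqP; rewrite mulf_eq0 ev_eq0 // (negPf mu0) => /eqP.
  by apply/polyP => i; rewrite coefZ !(coef_map (ev inc t)) coefZ; exact: rmorphM.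
rewrite ltnS in lt_n; apply: leq_trans lt_n.
rewrite [in X in (_ < X)%N]PE lead_coefZ size_mul ?lead_coef_eq0 //.
rewrite -subn1 -addnBAC ?(ltnW smu) // subn1 -[X in (X < _)%N]add0n ltn_add2r.
by case: (size mu) smu => [|[]].
Qed.

End ResidueDegree.

Section GenericPlace.
Variables (F : fieldType) (K : closedFieldType) (inc : {rmorphism F -> K}).

Lemma nonzero_constant_term (P : {poly {poly F}}) u (y : K) : ~ algebraicOver inc u -> y != 0 ->
  P != 0 -> (map_poly (ev inc u) P).[y] = 0 ->
  exists Q : {poly {poly F}}, Q`_0 != 0 /\ (map_poly (ev inc u) Q).[y] = 0.
Proof.
move=> tr y0 P0 Py; have [m [Q]] := multiplicity_XsubC P 0.
rewrite P0 /= subr0 => nr PE; exists Q; split.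
  by rewrite -horner_coef0.
move: Py; rewrite PE rmorphM rmorphXn /= map_polyX hornerM hornerXn => /eqP.
by rewrite mulf_eq0 expf_eq0 (negPf y0) andbF orbF => /eqP.
Qed.

(** A transcendental u has no relations over F and can be sent to any a in F. The polynomial h
    collects the constant and leading coefficients of equations of the y; where these survive at u =
    a, [place_integral] adjoins each y with nonzero residue. *)
Lemma generic_place u (ys : seq K) : ~ algebraicOver inc u ->
  (forall y, y \in ys -> y != 0 /\
     exists P, map_poly (ev inc u) P != 0 /\ (map_poly (ev inc u) P).[y] = 0) ->
  exists h : {poly F}, h != 0 /\ forall a, ~~ root h a -> exists w : place K K,
    [/\ place_over inc w, w u, rho w u = inc a &
     forall y, y \in ys -> [/\ w y, rho w y != 0 & algebraicOver inc (rho w y)]].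
Proof.
move=> tr; elim: ys => [_|y ys IH hys].
  exists 1; split=> [|a _]; first exact: oner_neq0.
  have [v [hv vF]] := base_place inc inc.
  have [f hf fu|w [vw wu ru]] := @place_adjoin _ _ v u (inc a).
    have [i|p pE] := @lift_poly _ _ inc f; first by have [b ->] := vF _ (hf i); exists b.
    have p0 : p = 0 by apply/eqP; rewrite -(ev_eq0 p tr) evE pE fu.
    by rewrite -pE p0 rmorph0 /pm map_poly0 horner0.
  by exists w; split => //; exact: place_over_ext vw hv.
have [|h [h0 hw]] := IH; first by move=> z hz; apply: hys; rewrite in_cons hz orbT.
have [y0 [P' [P'0 Py']]] := hys y (mem_head _ _).
have [|P [P0 Py]] := nonzero_constant_term tr y0 _ Py'.
  by apply: contra P'0 => /eqP ->; rewrite rmorph0.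
have lP0 : lead_coef P != 0.
  by rewrite lead_coef_eq0; apply: contra P0 => /eqP ->; rewrite coef0.
exists (h * (P`_0 * lead_coef P)); split; first by rewrite !mulf_neq0.
move=> a; rewrite !rootM !negb_or => /and3P [ha ra la].
have [w [wF wu ru wys]] := hw a ha.
have [h1 e1] := place_ev_poly P wF wu.
have evr p : ~~ root p a -> ev inc (inc a) p != 0.
  by rewrite evE horner_map fmorph_eq0.
have lE : lead_coef (map_poly (ev inc u) P) = ev inc u (lead_coef P).
  by apply: lead_coef_map_eq; rewrite ev_eq0.
have [||w' [ww' wy ry]] := @place_integral _ _ w (map_poly (ev inc u) P) y y0 h1 Py.
- by rewrite (coef_map (ev inc u)) (place_ev _ wF wu).2 ru evr.
- by rewrite lE (place_ev _ wF wu).2 ru evr.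
exists w'; have wF' := place_over_ext ww' wF.
have [wu' ru'] := ww' _ wu.
split => //; first by rewrite ru'.
move=> z; rewrite in_cons => /predU1P [->|hz]; last first.
  by have [wz rz az] := wys z hz; have [wz' rz'] := ww' _ wz; rewrite rz'.
split => //; exists (map_poly (horner_eval a) P).
  apply: contra ra => /eqP e; have := congr1 (fun q : {poly F} => q`_0) e.
  by rewrite (coef_map (horner_eval a)) coef0 => /eqP.
have [h2 e2] := place_ev_poly P wF' wu'.
have [_] := polyR_horner h2 wy; rewrite Py rho0 e2 ru' ru => /esym/eqP e.
rewrite /root -[X in X.[_] == 0](_ : map_poly (ev inc (inc a)) P = _) //.
apply/polyP => i; rewrite (coef_map (ev inc _)) (coef_map inc) (coef_map (horner_eval a)).
exact: horner_map.
Qed.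

End GenericPlace.

Lemma natr_exp_neq1 (K : fieldType) m n : [pchar K] =i pred0 -> (1 < m)%N -> (0 < n)%N ->
  m%:R ^+ n != 1 :> K.
Proof.
move=> K0 m1 n0; rewrite -natrX -subr_eq0 -[X in _ - X](mulr1n 1) -natrB ?expn_gt0 ?(ltnW m1) //.
by rewrite pchar0_natr // subn_eq0 -ltnNge -(exp1n n) ltn_exp2r.
Qed.

Lemma nonroot_nat (F : fieldType) (h : {poly F}) : [pchar F] =i pred0 -> h != 0 ->
  exists2 n, (1 < n)%N & ~~ root h n%:R.
Proof.
(* Starting at 2 yields a value that is not a root of unity. *)
move=> F0 h0; pose rs : seq F := [seq n%:R | n <- iota 2 (size h)].
have [/allPn [_ /mapP [n hn ->] nr]|all_r] := boolP (~~ all (root h) rs).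
  by exists n => //; move: hn; rewrite mem_iota => /andP [].
have urs : uniq rs.
  rewrite map_inj_uniq ?iota_uniq // => m n /eqP.
  wlog le : m n / (m <= n)%N.
    by move=> W; case/orP: (leq_total m n) => /W // h1 e; apply/esym/h1; rewrite eq_sym.
  rewrite eq_sym -subr_eq0 -natrB // pchar0_natr // subn_eq0 => le'.
  by apply/eqP; rewrite eqn_leq le.
have := max_poly_roots h0 (negbNE all_r) urs.
by rewrite size_map size_iota ltnn.
Qed.

Section Transitivity.
Variables (F K : fieldType) (inc : {rmorphism F -> K}).
Variables (F1 : fieldType) (inc1 : {rmorphism F1 -> K}) (t : K).
Variables (F2 : fieldType) (inc2 : {rmorphism F2 -> K}) (u : K).
Hypotheses (gen1 : generated_by inc inc1 t) (gen2 : generated_by inc inc2 u).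

Lemma ev_lift p : exists p', ev inc t p = ev inc2 t p'.
Proof.
have [h1 _ _] := gen2.
have [|p' e] := @lift_poly _ _ inc2 (map_poly inc p); last by exists p'; rewrite !evE e.
by move=> i; rewrite (coef_map inc); exact: h1.
Qed.

Lemma stable_pdeg_tower S x D : 1 \in S -> stable inc2 S t -> pdeg inc1 D x ->
  exists D', pdeg inc2 D' x.
Proof.
move=> S1 hS /(clear_denominators gen1) [P [P0 sP Px]].
have hQ i : stable inc2 S (map_poly (ev inc t) P)`_i.
  have [p' e] := ev_lift P`_i.
  have -> : (map_poly (ev inc t) P)`_i = ev inc2 t p' by rewrite coef_map; exact: e.
  exact: stable_horner.
exists (size S * D)%N; apply: (pdeg_tower P0 Px) => //; last exact: lead_inv_stable.
exact: leq_trans (size_poly _ _) sP.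
Qed.

Lemma algebraic_tower y : algebraicOver inc2 t -> algebraicOver inc1 y -> algebraicOver inc2 y.
Proof.
move=> /algebraic_pdeg [N /pdeg_stable [S [_ S1 hS]]] /algebraic_pdeg [D hy].
by have [D' /pdeg_algebraic] := stable_pdeg_tower S1 hS hy.
Qed.

(** Steinitz exchange: an equation of u over F(t) is a relation P(t, u) = 0 over F. Read in the
    other variable it is an equation for t, nonzero because u is transcendental. *)
Lemma algebraic_swap : ~ algebraicOver inc u -> algebraicOver inc1 u -> algebraicOver inc2 t.
Proof.
move=> tr /algebraic_pdeg [D /(clear_denominators gen1) [P [P0 _ Pu]]].
have sw : (map_poly (ev inc u) (swapXY P)).[t] = 0.
  pose U := map_poly (map_poly inc) P.
  have E (x : K) (Q : {poly {poly F}}) :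
      map_poly (ev inc x) Q = map_poly (horner_eval x) (map_poly (map_poly inc) Q).
    apply/polyP => i; rewrite (coef_map (ev inc x)) (coef_map (horner_eval x)).
    by rewrite (coef_map (map_poly inc)).
  rewrite E -swapXY_map -horner_swapXY swapXYK -horner2_swapXY horner_swapXY.
  by rewrite -[RHS]Pu E.
have [i|Q QE] := @lift_poly _ _ inc2 (map_poly (ev inc u) (swapXY P)).
  rewrite (coef_map (ev inc u)); have [h1 [b hb] _] := gen2.
  have [j|p' e] := @lift_poly _ _ inc2 (map_poly inc (swapXY P)`_i).
    by rewrite (coef_map inc); exact: h1.
  by exists p'.[b]; rewrite -horner_map e hb.
exists Q; rewrite ?QE; last exact/eqP.
rewrite -(map_poly_eq0 inc2) QE; apply: contra P0 => /eqP e.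
suff -> : P = 0 by rewrite rmorph0.
apply/eqP; rewrite -swapXY_eq0; apply/eqP/polyP => i; apply/eqP.
rewrite coef0 -(ev_eq0 _ tr); have := congr1 (fun q : {poly K} => q`_i) e.
by rewrite (coef_map (ev inc u)) coef0 => /eqP.
Qed.
End Transitivity.

(** * Bounded radicals *)

(** The [c i] are algebraic over F rather than in F, because the statement is applied to residues of
    generators, which are only algebraic. M depends on c and D but not on x, n or e. With l = 0 it
    bounds the exponent of the roots of unity of degree at most D. *)
Definition bounded_radicals (F K : fieldType) (inc : {rmorphism F -> K}) : Prop :=
  forall l (c : 'I_l -> K) D, (forall i, c i != 0 /\ algebraicOver inc (c i)) ->
  exists2 M, (0 < M)%N & forall x n e, (0 < n)%N -> pdeg inc D x ->
    x ^+ n = mon c e -> exists e', x ^+ M = mon c e'.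

Lemma monomials_stable (F K : fieldType) (inc : {rmorphism F -> K}) l (c : 'I_l -> K) :
  (forall i, algebraicOver inc (c i)) ->
  exists2 S, 1 \in S & forall e, stable inc S (mon c e).
Proof.
move=> hc; have [|S S1 hS] := @stable_algebraic _ K inc (codom c).
  by move=> _ /codomP [j ->].
exists S => // e; apply: (@mon_ind _ _ _ (fun z => stable inc S z)).
- exact: stable1.
- by move=> x y; exact: stableM.
- by move=> j; apply/hS/codom_f.
- by move=> j; apply: stableV; [exact: hc|apply/hS/codom_f].
Qed.

(** The bound is independent of n, as all powers of x preserve one list. A radical can thus be
    replaced by one of its powers divided by a monomial. *)
Lemma pdeg_expr_mul (F K : fieldType) (inc : {rmorphism F -> K}) S D x n y :
  1 \in S -> stable inc S y -> pdeg inc D x -> pdeg inc (size S * D) (x ^+ n * y).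
Proof.
move=> S1 hS hx; have [S2 [sS2 S21 hS2]] := pdeg_stable hx.
have h1 : 1 \in prodseq S S2 by apply/allpairsP; exists (1, 1); rewrite mulr1.
apply: (@pdeg_leq _ _ _ (size S * size S2)); first by rewrite leq_mul2l sS2 orbT.
rewrite -size_prodseq; apply: stable_pdeg h1 (oner_neq0 _) _; apply: stableM.
  by apply/stableX/stable_prodr.
exact: stable_prodl.
Qed.

Section AlgebraicStep.
Variables (F K : fieldType) (inc : {rmorphism F -> K}).
Variables (F' : fieldType) (inc' : {rmorphism F' -> K}) (t : K).
Hypothesis gen : generated_by inc inc' t.

Lemma generated_stable S : 1 \in S -> stable inc S t -> forall y, stable inc S (inc' y).
Proof.
move=> S1 hS y; have [_ _ h] := gen; have [p [q [q0 ->]]] := h y.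
have hq : stable inc S (ev inc t q) by exact: stable_horner.
apply: stableM; first exact: stable_horner.
exact: stableV (pdeg_algebraic (stable_pdeg S1 (oner_neq0 _) hq)) hq.
Qed.

Lemma pdeg_tower_simple S D x : 1 \in S -> stable inc S t -> pdeg inc' D x ->
  pdeg inc (size S * D) x.
Proof.
move=> S1 hS [p [p0 sp rp]].
have hp i : stable inc S (map_poly inc' p)`_i.
  by rewrite (coef_map inc'); exact: generated_stable.
apply: (@pdeg_tower _ _ _ _ _ (map_poly inc' p)) => //; last exact: lead_inv_stable.
- by rewrite map_poly_eq0.
- exact/eqP.
- by rewrite size_map_poly.
Qed.

Lemma bounded_radicals_algebraic : algebraicOver inc t ->
  bounded_radicals inc -> bounded_radicals inc'.
Proof.
move=> /algebraic_pdeg [N /pdeg_stable [S [_ S1 hS]]] R l c D hc.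
have [i|M M0 hM] := R l c (size S * D)%N.
  have [ci0 /algebraic_pdeg [D' hD']] := hc i; split => //.
  exact: pdeg_algebraic (pdeg_tower_simple S1 hS hD').
exists M => // x n e n0 hx; apply: (hM x n e n0); exact: pdeg_tower_simple.
Qed.

End AlgebraicStep.

Section TranscendentalStep.
Variables (F : fieldType) (K : closedFieldType) (inc : {rmorphism F -> K}).
Variables (F' : fieldType) (inc' : {rmorphism F' -> K}) (t : K).
Hypotheses (gen : generated_by inc inc' t) (tr : ~ algebraicOver inc t).
Hypothesis K0 : [pchar K] =i pred0.

Lemma pchar0_sub : [pchar F] =i pred0.
Proof. by move=> p; rewrite -(fmorph_pchar inc) K0. Qed.

Definition good_place l (c : 'I_l -> K) (v : place K K) :=
  [/\ place_over inc v, v t, algebraicOver inc (rho v t) &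
   forall i, [/\ v (c i), rho v (c i) != 0 & algebraicOver inc (rho v (c i))]].

(** Here u takes over from t as transcendental generator: by exchange t, and then every [c i], is
    algebraic over F(u), and the residue of u can be prescribed. *)
Lemma good_place_exists l (c : 'I_l -> K) u : ~ algebraicOver inc u ->
  algebraicOver inc' u -> (forall i, c i != 0 /\ algebraicOver inc' (c i)) ->
  exists v, good_place c v /\ exists n, [/\ (1 < n)%N, v u & rho v u = n%:R].
Proof.
move=> tru algu hc.
have [F2 [inc2 gen2]] := simple_extension inc u.
have algt : algebraicOver inc2 t := algebraic_swap gen gen2 tru algu.
have t0 : t != 0.
  by apply/eqP => t0; apply: tr; rewrite t0; exact: algebraic0.
have [|h [h0 hv]] := @generic_place _ _ inc u (t :: codom c) tru.
  move=> y hy; suff [y0 /algebraic_pdeg [D hD]] : y != 0 /\ algebraicOver inc2 y.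
    by split => //; have [P [P0 _ Py]] := clear_denominators gen2 hD; exists P.
  move: hy; rewrite in_cons => /predU1P [-> //|/codomP [i ->]].
  by have [ci0 ai] := hc i; split => //; exact: algebraic_tower gen gen2 _ algt ai.
have [n n1 hn] := nonroot_nat pchar0_sub h0.
have [v [vF vu ru vys]] := hv _ hn.
exists v; split; last by exists n; rewrite ru rmorph_nat.
have [vt _ at_] := vys t (mem_head _ _).
by split => // i; apply: vys; rewrite in_cons codom_f orbT.
Qed.

(** If [c i] is algebraic over F, residues are faithful on its powers. Otherwise it is itself taken
    as the generator u and sent to an integer greater than 1. *)
Lemma nontorsion_place l (c : 'I_l -> K) i :
  (forall i, c i != 0 /\ algebraicOver inc' (c i)) ->
  (forall n, (0 < n)%N -> c i ^+ n != 1) ->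
  exists v, good_place c v /\ forall n, (0 < n)%N -> rho v (c i) ^+ n != 1.
Proof.
move=> hc nt; have [ai|ti] := pselect (algebraicOver inc (c i)).
  have [_ [b hb] _] := gen.
  have at_ : algebraicOver inc' t by rewrite -hb; exact: algebraic_id.
  have [v [gv _]] := good_place_exists tr at_ hc.
  exists v; split => // n n0; have [vF _ _ vc] := gv; have [vi _ _] := vc i.
  have vd : v (c i ^+ n - 1) by apply: plB; [exact: plX|exact: pl1].
  rewrite -subr_eq0 -rhoX // -(rho1 v) -rhoB //; [|exact: plX|exact: pl1].
  apply: (place_algebraic_neq0 (inc := inc)) => //; first by move=> a; exact: (vF a).1.
    apply: algebraic_sub; last exact: algebraic1.
    elim: n {n0 vd} => [|n IH]; first by rewrite expr0; exact: algebraic1.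
    by rewrite exprS; exact: algebraic_mul.
  by rewrite subr_eq0 nt.
have [v [gv [m [m1 _ rm]]]] := good_place_exists ti (hc i).2 hc.
by exists v; split => // n n0; rewrite rm natr_exp_neq1.
Qed.

Lemma good_place_degree l (c : 'I_l -> K) v D : good_place c v ->
  exists D', forall w x, extends v w -> w x -> pdeg inc' D x -> pdeg inc D' (rho w x).
Proof.
move=> [vF vt /algebraic_pdeg [N /pdeg_stable [S [_ S1 hS]]] _].
exists (size S * D)%N => w x vw wx /(clear_denominators gen) [P [P0 sP Px]].
have [wt et] := vw _ vt.
apply: (residue_degree (place_over_ext vw vF) wt tr S1 _ _ sP Px wx).
  by rewrite et.
by apply: contra P0 => /eqP ->; rewrite rmorph0.
Qed.

(** Here x is a root of unity. Its residue has bounded degree over F, so the case of no generators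
    bounds the exponent of the residue, and the residue map is injective on torsion. *)
Lemma bounded_radicals_torsion l (c : 'I_l -> K) D : bounded_radicals inc ->
  (forall i, c i != 0 /\ algebraicOver inc' (c i)) ->
  (forall i, exists2 n, (0 < n)%N & c i ^+ n = 1) ->
  exists2 M, (0 < M)%N & forall x n e, (0 < n)%N -> pdeg inc' D x ->
    x ^+ n = mon c e -> x ^+ M = 1.
Proof.
move=> R hc ct; have c0 i : c i != 0 by case: (hc i).
have [q q0 hq] : exists2 q, (0 < q)%N & forall i, c i ^+ q = 1.
  have [d hd1 hd2] : exists2 d : 'I_l -> nat, forall i, (0 < d i)%N & forall i, c i ^+ d i = 1.
    have h i : exists n, (0 < n)%N /\ c i ^+ n = 1 by have [n n0 e] := ct i; exists n.
    by have [d hd] := choice h; exists d => i; have [] := hd i.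
  exists (\prod_i d i)%N; first by rewrite prodn_gt0.
  by move=> i; rewrite (bigD1 i) //= exprM hd2 expr1n.
have [_ [b hb] _] := gen.
have at_ : algebraicOver inc' t by rewrite -hb; exact: algebraic_id.
have [v [gv _]] := good_place_exists tr at_ hc.
have [D' hD'] := good_place_degree D gv.
have [[] //|M M0 hM] := R 0 (fun=> 1) D'.
exists M => // x n e n0 hx ex.
have xq : x ^+ (n * q) = 1.
  rewrite exprM ex; apply: (@mon_ind _ _ _ (fun z => z ^+ q = 1)).
  - by rewrite expr1n.
  - by move=> y z hy hz; rewrite exprMn hy hz mulr1.
  - exact: hq.
  - by move=> i; rewrite exprVn hq invr1.
have nq0 : (0 < n * q)%N by rewrite muln_gt0 n0.
have [|w [vw wx rx]] := place_radical nq0 (pl1 v) _ xq; first by rewrite rho1 oner_neq0.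
have := hM (rho w x) (n * q)%N 0 nq0 (hD' _ _ vw wx hx).
rewrite -rhoX // xq rho1 mon0 => // -[] // e'.
rewrite /mon big_ord0 -rhoX // => r1.
apply: (place_torsion_inj K0 nq0 _ _ r1); first exact: plX.
by rewrite exprAC xq expr1n.
Qed.

(* A place over F keeping some [c i] nontorsion sends the problem to F; the elements of the
   group generated by c whose value is torsion then need only l - 1 generators. *)
Lemma bounded_radicals_transcendental : bounded_radicals inc -> bounded_radicals inc'.
Proof.
move=> R l; elim: l => [|l IH] c D hc.
  have [|M M0 hM] := bounded_radicals_torsion D R hc; first by case.
  by exists M => // x n e n0 hx /(hM _ _ _ n0 hx) ->; exists 0; rewrite mon0.
have c0 i : c i != 0 by case: (hc i).
have [ct|/existsNP [i ni]] := pselect (forall i, exists2 n, (0 < n)%N & c i ^+ n = 1).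
  have [M M0 hM] := bounded_radicals_torsion D R hc ct.
  by exists M => // x n e n0 hx /(hM _ _ _ n0 hx) ->; exists 0; rewrite mon0.
have [|v [gv nt]] := @nontorsion_place _ c i hc.
  by move=> n n0; apply/eqP => e; apply: ni; exists n.
have [vF vt _ vc] := gv.
pose rc j := rho v (c j).
have rc0 j : rc j != 0 by case: (vc j).
have vmon e : v (mon c e) /\ rho v (mon c e) = mon rc e.
  by apply: place_mon => j; case: (vc j).
pose U (e : 'rV[int]_l.+1) := exists2 n, (0 < n)%N & mon rc e ^+ n = 1.
(* The residue of [c i] has infinite order, so the coordinates other than i separate [U]: l
   generators instead of l + 1. *)
have [||| us [hus gen_us]] := @lattice_generators _ l U (fun j e => e 0 (lift i j)).
- split; first by exists 1; rewrite // mon0 expr1n.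
  move=> x y [n n0 hn] [m m0 hm]; exists (n * m)%N; first by rewrite muln_gt0 n0.
  by rewrite monB // expr_div_n exprM hn [(n * m)%N]mulnC exprM hm !expr1n divr1.
- by move=> j x y; rewrite !mxE.
- move=> u [n n0 hn] h; apply/rowP => j; rewrite mxE.
  case: (unliftP i j) => [k -> //|->]; apply/eqP; apply: contraT => ui0.
  have uE : mon rc u = rc i ^ u 0 i.
    by rewrite /mon (bigD1 i) //= big1 ?mulr1 // => k nk;
       case: (unliftP i k) nk => [k' -> _|->]; rewrite ?eqxx // h expr0z.
  case E : (u 0 i) ui0 uE => [[|m]|m] // _ uE.
    by have := nt (m.+1 * n)%N; rewrite exprM muln_gt0 n0 -/(rc i) (exprnP (rc i)) -uE hn eqxx => /(_ isT).
  have := nt (m.+1 * n)%N; rewrite exprM muln_gt0 n0 -/(rc i) => /(_ isT).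
  rewrite NegzE -exprnN in uE.
  rewrite -[rc i ^+ m.+1]invrK -uE exprVn hn invr1 eqxx.
  by [].
pose c' j := mon c (us j).
have [|S0 S01 hS0c] := monomials_stable (inc := inc') (c := c).
  by move=> j; case: (hc j).
have [D' hD'] := good_place_degree D gv.
have [|M M0 hM] := R _ rc D'; first by move=> j; split => //; case: (vc j).
have [|M2 M20 hM2] := IH c' (size S0 * D)%N.
  move=> j; split; first exact: mon_neq0.
  exact: pdeg_algebraic (stable_pdeg S01 (oner_neq0 _) (hS0c _)).
exists (M * M2)%N; first by rewrite muln_gt0 M0.
move=> x n e n0 hx ex; have [ve re] := vmon e.
have [|w [vw wx rx]] := place_radical n0 ve _ ex; first by rewrite re mon_neq0.
have [we rwe] := vw _ ve.
have rex : rho w x ^+ n = mon rc e by rewrite -rhoX // ex rwe re.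
have [e' he'] := hM (rho w x) n e n0 (hD' _ _ vw wx hx) rex.
(* The residues of x^M and [mon c e'] agree, so the exponent vector of z^n lies in [U] and the
   induction hypothesis for [c'] applies to z. *)
pose z := x ^+ M / mon c e'.
have zn : z ^+ n = mon c (e *+ M - e' *+ n).
  by rewrite expr_div_n exprAC ex monB // !monMn.
have [|zs hzs] := gen_us (e *+ M - e' *+ n).
  exists 1; rewrite // expr1 monB // !monMn // -he' -exprM.
  by rewrite -rex -exprM mulnC divff // expf_neq0.
have zc : z ^+ n = mon c' (\row_j zs j) by rewrite zn hzs mon_mon.
have hz : pdeg inc' (size S0 * D) z by rewrite /z -monN //; exact: pdeg_expr_mul.
have [e2 he2] := hM2 z n _ n0 hz zc.
exists (e' *+ M2 + \sum_j us j *~ e2 0 j).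
rewrite monD // monMn // mon_mon // (_ : \row_j _ = e2); last by apply/rowP => j; rewrite mxE.
by rewrite -he2 /z expr_div_n -exprM mulrC divfK // expf_neq0 // mon_neq0.
Qed.

End TranscendentalStep.

(** * Rational numbers and Northcott's theorem *)

Section RatEmbedding.
Variables (K : fieldType).
Hypothesis K0 : [pchar K] =i pred0.

Lemma pchar0_intr (z : int) : (z%:~R == 0 :> K) = (z == 0).
Proof.
case: z => n; first by rewrite -pmulrn pchar0_natr.
by rewrite NegzE mulrNz oppr_eq0 -pmulrn pchar0_natr // oppr_eq0.
Qed.

Lemma pchar0_ratr_frac (a b : int) : b != 0 ->
  @ratr K (a%:~R / b%:~R) = a%:~R / b%:~R.
Proof.
move=> b0; set x := (_ / _ : rat); rewrite /ratr.
have e : numq x * b = a * denq x.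
  apply: (@intr_inj rat); rewrite !intrM numqE /x.
  have b0' : b%:~R != 0 :> rat by rewrite intr_eq0.
  by rewrite mulrAC divfK.
apply/eqP; rewrite eqr_div ?pchar0_intr ?denq_neq0 //.
by rewrite -!intrM e.
Qed.

Lemma rat_frac (x : rat) : x = (numq x)%:~R / (denq x)%:~R.
Proof. by rewrite divq_num_den. Qed.

Lemma rat_embedding : exists inc : {rmorphism rat -> K}, True.
Proof.
have dn x : denq x != 0 by rewrite denq_neq0.
have dnK x : (denq x)%:~R != 0 :> K by rewrite pchar0_intr.
have dnQ x : (denq x)%:~R != 0 :> rat by rewrite intr_eq0.
have zm : zmod_morphism (@ratr K).
  move=> x y; rewrite {1}(rat_frac x) {1}(rat_frac y).
  have -> : (numq x)%:~R / (denq x)%:~R - (numq y)%:~R / (denq y)%:~R =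
     (numq x * denq y - numq y * denq x)%:~R / (denq x * denq y)%:~R :> rat.
    by rewrite intrB !intrM; field; rewrite !dnQ.
  rewrite pchar0_ratr_frac ?mulf_neq0 // intrB !intrM /ratr; field.
  by rewrite !dnK.
have mm : monoid_morphism (@ratr K).
  split; first by rewrite /ratr divr1.
  move=> x y; rewrite {1}(rat_frac x) {1}(rat_frac y).
  have -> : (numq x)%:~R / (denq x)%:~R * ((numq y)%:~R / (denq y)%:~R) =
     (numq x * numq y)%:~R / (denq x * denq y)%:~R :> rat.
    by rewrite !intrM; field; rewrite !dnQ.
  rewrite pchar0_ratr_frac ?mulf_neq0 // !intrM /ratr; field.
  by rewrite !dnK.
pose A := GRing.isZmodMorphism.Build rat K (@ratr K) zm.
pose M := GRing.isMonoidMorphism.Build rat K (@ratr K) mm.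
pose f : {rmorphism rat -> K} := HB.pack (@ratr K) A M.
by exists f.
Qed.

End RatEmbedding.

Section FiniteLists.

Lemma bounded_int_poly_list n (N : nat) : exists Ps : seq {poly int},
  forall P : {poly int}, (size P <= n)%N -> (forall i, `|P`_i| <= N%:Z) -> P \in Ps.
Proof.
elim: n => [|n [Ps IH]].
  by exists [:: 0] => P; rewrite leqn0 size_poly_eq0 => /eqP -> _; rewrite mem_seq1.
pose zs : seq int := [seq i%:Z | i <- iota 0 N.+1] ++ [seq - i%:Z | i <- iota 0 N.+1].
exists [seq cons_poly z Q | z <- zs, Q <- Ps] => P sP hP.
pose Q := \poly_(i < n) P`_i.+1.
have PE : P = cons_poly P`_0 Q.
  apply/polyP => -[|i]; rewrite coef_cons //= coef_poly; case: ltnP => // le.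
  by rewrite nth_default // (leq_trans sP).
apply/allpairsP; exists (P`_0, Q); split => //=.
  have := hP 0%N; rewrite mem_cat; case: (P`_0) => m h; apply/orP.
    by left; apply/mapP; exists m; rewrite // mem_iota.
  by right; apply/mapP; exists m.+1; rewrite ?NegzE // mem_iota.
apply: IH; first exact: size_poly.
by move=> i; rewrite coef_poly; case: ifP => // _; rewrite normr0.
Qed.

Lemma roots_list (K : closedFieldType) (Ps : seq {poly K}) : exists ys : seq K,
  forall P z, P \in Ps -> P != 0 -> root P z -> z \in ys.
Proof.
elim: Ps => [|P Ps [ys IH]]; first by exists [::].
have [rs Drs] := closed_field_poly_normal P.
exists (rs ++ ys) => Q z; rewrite in_cons mem_cat => /predU1P [->|hQ] Q0 rz.
  by move: rz; rewrite Drs rootZ ?lead_coef_eq0 // root_prod_XsubC => ->.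
by rewrite (IH _ _ hQ Q0 rz) orbT.
Qed.

Lemma prod_XsubC_coef_bound (rs : seq algC) (B : nat) :
  (forall z, z \in rs -> `|z| <= B%:R) ->
  forall i, `|(\prod_(z <- rs) ('X - z%:P))`_i| <= (B.+1 ^ size rs)%:R.
Proof.
elim: rs => [|z rs IH] h i.
  by rewrite big_nil coef1 expn0; case: eqP => _; rewrite ?normr1 ?normr0.
have {}IH := IH (fun z hz => h z (mem_behead (s := _ :: _) hz)).
rewrite big_cons mulrBl coefB coefXM coefCM.
apply: le_trans (ler_normB _ _) _; rewrite /= expnS mulSn natrD lerD //.
  by case: eqP => _; rewrite ?normr0.
rewrite normrM natrM ler_pM //; exact: h (mem_head _ _).
Qed.

Lemma algC_seq_bound (rs : seq algC) : exists2 B : nat, (0 < B)%N &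
  forall z, z \in rs -> `|z| <= B%:R.
Proof.
elim: rs => [|z rs [B B0 hB]]; first by exists 1%N.
have [n hn] : exists n : nat, `|z| <= n%:R.
  by exists (Num.bound `|z|); apply/ltW/archi_boundP.
exists (n + B)%N; first by rewrite addn_gt0 B0 orbT.
move=> y; rewrite in_cons => /predU1P [->|/hB h].
  by apply: le_trans hn _; rewrite ler_nat leq_addr.
by apply: le_trans h _; rewrite ler_nat leq_addl.
Qed.

Lemma Aint_integral (z : algC) : z \in Aint <-> integralOver (intr : int -> algC) z.
Proof.
split=> [/floorpP [P PE]|[P mP rP]].
  exists P; last by rewrite -PE root_minCpoly.
  have := minCpoly_monic z; rewrite PE !monicE lead_coef_map_eq /= ?intr_eq1 ?intr_eq0 ?lead_coef_eq0 //.
    by move=> /eqP h; apply/eqP/(@intr_inj algC).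
  by apply: contraFneq (minCpoly_eq0 z) => P0; rewrite PE P0 rmorph0 eqxx.
apply: root_monic_Aint rP _ _; first exact: monic_map.
by apply/polyOverP => i; rewrite coef_map; by rewrite rpred_int.
Qed.

Lemma Aint_radical (z : algC) n : (0 < n)%N -> z ^+ n \in Aint -> z \in Aint.
Proof.
move=> n0 /Aint_integral h; apply/Aint_integral.
apply: (@integral_root_monic _ _ _ z ('X^n - (z ^+ n)%:P)).
- exact: monicXnsubC.
- by rewrite /root !hornerE subrr.
apply/integral_poly => i; rewrite coefB coefXn coefC.
apply: integral_sub; first exact: integral_nat.
by case: ifP => // _; exact: integral0.
Qed.

Lemma Aint_multiple (z : algC) : exists2 q : nat, (0 < q)%N & q%:R * z \in Aint.
Proof.
have [p [Dp mp] _] := minCpolyP z.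
have [P [a a0 pE]] := rat_poly_scale p.
have P0 : P != 0.
  by apply: contraTneq mp => P0; rewrite pE P0 rmorph0 scaler0 monicE lead_coef0 eq_sym oner_eq0.
have /eqP Pz : root (map_poly (intr : int -> algC) P) z.
  have := root_minCpoly z; rewrite Dp pE map_polyZ /= rootZ.
    by rewrite -map_poly_comp (eq_map_poly (g := intr)) // => x /=; exact: ratr_int.
  by rewrite fmorph_eq0 invr_eq0 intr_eq0.
pose d := (size P).-1; pose lc := lead_coef P.
have sP : size P = d.+1 by rewrite /d prednK // size_poly_gt0.
have d0 : (0 < d)%N.
  rewrite lt0n; apply: contra_eq_neq Pz => d0.
  have /size1_polyC -> : (size P <= 1)%N by rewrite sP d0.
  rewrite map_polyC hornerC /= intr_eq0 -[0%N]d0 -/(lead_coef P).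
  by rewrite lead_coef_eq0.
have lc0 : lc != 0 by rewrite lead_coef_eq0.
(* The monic polynomial with Q(lc X) = lc^(d-1) P(X). *)
pose Q : {poly int} := \poly_(i < d.+1) (if i == d then 1 else P`_i * lc ^+ (d.-1 - i)).
have sQ : size Q = d.+1 by rewrite size_poly_eq // eqxx oner_neq0.
have hz : lc%:~R * z \in Aint.
  apply/Aint_integral; exists Q.
    by rewrite monicE /lead_coef sQ coef_poly /= ltnSn eqxx.
  apply/eqP; rewrite -[RHS](mulr0 (lc%:~R ^+ d.-1)) -Pz.
  rewrite !(@horner_coef_wide _ d.+1) ?(leq_trans (size_poly _ _)) ?sP ?sQ //.
  rewrite mulr_sumr; apply: eq_bigr => i _; rewrite !coef_map /= coef_poly ltn_ord.
  have := ltn_ord i; rewrite ltnS leq_eqVlt => /predU1P [->|lt_i].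
    rewrite eqxx mul1r exprMn mulrA -/lc; congr (_ * _).
    by rewrite /d -/(lead_coef P) -/lc -exprSr prednK.
  rewrite ltn_eqF // intrM rmorphXn /= exprMn.
  have -> : lc%:~R ^+ d.-1 = lc%:~R ^+ (d.-1 - i) * lc%:~R ^+ i :> algC.
    by rewrite -exprD subnK // -ltnS prednK.
  ring.
exists `|lc|%N; first by rewrite absz_gt0.
case: (lc) hz => m hz; first by rewrite -pmulrn in hz.
by move: hz; rewrite NegzE mulrNz mulNr rpredN -pmulrn.
Qed.

Lemma Aint_multiple_seq (rs : seq algC) : exists2 q : nat, (0 < q)%N &
  forall z, z \in rs -> q%:R * z \in Aint.
Proof.
elim: rs => [|z rs [q q0 hq]]; first by exists 1%N.
have [n n0 hn] := Aint_multiple z.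
exists (n * q)%N; first by rewrite muln_gt0 n0.
move=> y; rewrite in_cons natrM => /predU1P [->|/hq h].
  by rewrite mulrAC rpredM // Aint_Cnat ?natr_nat.
by rewrite -mulrA rpredM // Aint_Cnat ?natr_nat.
Qed.

End FiniteLists.

(** * Finiteness of reduced radicals of bounded degree *)

Section Northcott.
Variables (K : closedFieldType) (inc : {rmorphism rat -> K}).
Hypothesis K0 : [pchar K] =i pred0.
Variables (l : nat) (c : 'I_l -> K).
Hypothesis hc : forall i, c i != 0 /\ algebraicOver inc (c i).

(** These places stand for embeddings of number fields into [algC]: on algebraic elements of their
    ring they are faithful and preserve equations over the rationals. *)
Definition rational_place (w : place K algC) :=
  forall a, w (inc a) /\ rho w (inc a) = ratr a.

Lemma rational_place_ext v w : extends v w -> rational_place v -> rational_place w.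
Proof. by move=> h hv a; have [h1 h2] := hv a; have [h3 h4] := h _ h1; rewrite h4. Qed.

Lemma rational_place_horner w x (p : {poly rat}) : rational_place w -> w x ->
  rho w (map_poly inc p).[x] = (map_poly ratr p).[rho w x].
Proof.
move=> hw wx; have hp : polyR w (map_poly inc p).
  by move=> i; rewrite coef_map; exact: (hw _).1.
have [_ ->] := polyR_horner hp wx; congr (_.[_]); apply/polyP => i.
by rewrite coef_pm !coef_map; exact: (hw _).2.
Qed.

(* All conjugates of [Q * y] are bounded by [N], and it is integral: a radical with exponents
   in [0, n) is no larger than the product of the c i. *)
Lemma northcott_place : exists Q N : nat, (0 < Q)%N /\
  forall w y n (e : 'rV[int]_l), rational_place w -> (forall i, w (c i)) -> w y -> (0 < n)%N ->
   (forall i, 0 <= e 0 i < n%:Z) -> y ^+ n = mon c e ->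
   `|Q%:R * rho w y| <= N%:R /\ Q%:R * rho w y \in Aint.
Proof.
have h i : exists p : {poly rat}, p != 0 /\ root (map_poly inc p) (c i).
  by have [_ [p p0 rp]] := hc i; exists p.
have [p hp] := choice h.
have [rs hrs] := roots_list (codom (fun i => map_poly (ratr : rat -> algC) (p i))).
have [B B0 hB] := algC_seq_bound rs; have [q q0 hq] := Aint_multiple_seq rs.
exists (q ^ l)%N, ((q * B) ^ l)%N; split; first by rewrite expn_gt0 q0.
move=> w y n e hw wc wy n0 he ye.
have rc i : rho w (c i) \in rs.
  have [p0 /eqP rp] := hp i; apply: (hrs (map_poly ratr (p i))).
  - exact: codom_f.
  - by rewrite map_poly_eq0.
  by apply/eqP; rewrite -rational_place_horner // rp rho0.
have rc0 i : rho w (c i) != 0.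
  have [c0 ac] := hc i; apply: (place_algebraic_neq0 (inc := inc)) => // a.
  exact: (hw a).1.
(* As e_i <= n, the factor q^n c_i^(e_i), taken on residues, equals q^(n - e_i) (q c_i)^(e_i). It is
   therefore integral, and its absolute value is at most (q B)^n because B >= 1. *)
pose f i := q%:R ^+ n * rho w (c i) ^+ absz (e 0 i).
have lt_e i : (absz (e 0%R i) <= n)%N.
  by have := he i; case: (e 0 i) => // m; rewrite ltz_nat => /ltnW.
have eta_n : ((q ^ l)%:R * rho w y) ^+ n = \prod_i f i.
  rewrite exprMn -rhoX // ye (place_mon _ wc rc0).2 /mon big_split /=.
  rewrite prodr_const card_ord natrX -!exprM mulnC; congr (_ * _).
  by apply: eq_bigr => i _; have := he i; case: (e 0 i).
split.
  rewrite -(@ler_pXn2r _ n) ?nnegrE //= -normrX eta_n normr_prod.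
  have -> : ((q * B) ^ l)%:R ^+ n = \prod_(i < l) ((q * B) ^ n)%:R :> algC.
    by rewrite prodr_const card_ord !natrX -!exprM [(l * n)%N]mulnC.
  apply: ler_prod => i _; rewrite normr_ge0 /= normrM expnMn natrM natrX normrX.
  rewrite ger0_norm ?ler0n // ler_wpM2l ?exprn_ge0 ?ler0n // normrX natrX.
  apply: le_trans (lerXn2r _ _ _ (hB _ (rc i))) _; rewrite ?nnegrE ?ler0n //.
  by rewrite ler_weXn2l ?ler1n.
apply: (Aint_radical n0); rewrite eta_n; apply: rpred_prod => i _.
rewrite /f -{1}(subnK (lt_e i)) exprD -mulrA -exprMn.
by rewrite rpredM // rpredX ?hq // Aint_Cnat ?natr_nat.
Qed.

(** The multiple [y'] = Q y is integral with conjugates bounded by N, so its minimal polynomial has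
    degree at most D and integer coefficients of absolute value at most (N+1)^D. There are finitely
    many such polynomials. *)
Lemma northcott D : exists ys : seq K, forall y n (e : 'rV[int]_l), (0 < n)%N -> pdeg inc D y ->
  (forall i, 0 <= e 0 i < n%:Z) -> y ^+ n = mon c e -> y \in ys.
Proof.
have [Q [N [Q0 hQ]]] := northcott_place.
have [Ps hPs] := bounded_int_poly_list D.+1 (N.+1 ^ D).
have [zs hzs] := roots_list [seq map_poly inc (map_poly intr P) | P : {poly int} <- Ps].
have QK : Q%:R != 0 :> K by rewrite pchar0_natr // -lt0n.
exists [seq z / Q%:R | z <- zs] => y n e n0 hy he ye.
pose y' := Q%:R * y.
suff y'zs : y' \in zs by apply/mapP; exists y'; rewrite // mulrAC divff ?mul1r.
have hy' : pdeg inc D y'.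
  have [S [sS S1 hS]] := pdeg_stable hy.
  apply: pdeg_leq sS _; apply: stable_pdeg S1 (oner_neq0 _) _.
  by apply: stableM => //; rewrite -(rmorph_nat inc); exact: stable_const.
have [v [hv vF]] := base_place inc (ratr : {rmorphism rat -> algC}).
have ext u : rational_place u -> exists w, [/\ extends u w, rational_place w, (forall i, w (c i)) & w y].
  move=> hu; have [||w [uw hw]] := @place_algebraic_seq _ _ _ inc u (y :: codom c).
  - by move=> a; exact: (hu a).1.
  - move=> x; rewrite in_cons => /predU1P [->|/codomP [i ->]]; last by case: (hc i).
    exact: pdeg_algebraic hy.
  exists w; split => //; first exact: rational_place_ext uw hu.
    by move=> i; apply: hw; rewrite in_cons codom_f orbT.
  by apply: hw; rewrite mem_head.
have ry (w : place K algC) : w y -> w y' /\ rho w y' = Q%:R * rho w y.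
  by move=> wy; rewrite rhoM ?rho_nat //; [split => //; apply: plM => //|]; exact: pl_nat.
have [w [vw hw wc wy]] := ext v hv.
have [wy' ry'] := ry w wy.
have [_ etaA] := hQ w y n e hw wc wy n0 he ye.
rewrite -ry' in etaA; set eta := rho w y' in etaA.
have [p [Dp mp] dvp] := minCpolyP eta.
have root_eta (f : {poly rat}) : (map_poly inc f).[y'] = 0 -> p %| f.
  by move=> fy; rewrite -dvp /root -rational_place_horner // fy rho0.
have [rs Drs] := closed_field_poly_normal (minCpoly eta).
rewrite (monicP (minCpoly_monic eta)) scale1r in Drs.
have hrs z : z \in rs -> `|z| <= N%:R.
  rewrite -root_prod_XsubC -Drs Dp => rz.
  (* The conjugate z is the residue of [y'] at another rational place, since p divides every
     rational relation of [y']; the uniform bound [hQ] applies there. *)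
  have [f hf fy|w1 [vw1 w1y rw1]] := @place_adjoin _ _ v y' z.
    have [i|g gE] := @lift_poly _ _ inc f; first by have [b ->] := vF _ (hf i); exists b.
    have -> : pm v f = map_poly ratr g.
      by apply/polyP => i; rewrite coef_pm -gE !coef_map; exact: (hv _).2.
    rewrite -gE in fy; have /dvdpP [r ->] := root_eta g fy.
    by rewrite rmorphM hornerM (eqP rz) mulr0.
  have [w2 [w12 hw2 wc2 wy2]] := ext w1 (rational_place_ext vw1 hv).
  have [+ _] := hQ w2 y n e hw2 wc2 wy2 n0 he ye.
  by rewrite -(ry w2 wy2).2 (w12 _ w1y).2 rw1.
have sD : (size rs <= D)%N.
  have [f [f0 sf /eqP rf]] := hy'.
  rewrite -ltnS -(size_prod_XsubC rs id) -Drs Dp size_map_poly.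
  by apply: leq_trans sf; apply: dvdp_leq => //; exact: root_eta.
have [P PE] := floorpP etaA.
have hP : P \in Ps.
  apply: hPs => [|i].
    rewrite -(size_map_inj_poly (f := intr : int -> algC)) //; last exact: intr_inj.
    by rewrite -PE Drs size_prod_XsubC.
  have := prod_XsubC_coef_bound hrs i; rewrite -Drs PE coef_map /= -intr_norm => h1.
  have : (`|P`_i|%:~R <= (N.+1 ^ D)%:R :> algC).
    by apply: le_trans h1 _; rewrite ler_nat leq_pexp2l.
  by rewrite pmulrn ler_int.
have P0 : P != 0 by apply: contraFneq (minCpoly_eq0 eta) => P0; rewrite PE P0 rmorph0.
apply: (hzs (map_poly inc (map_poly intr P))).
- by apply/mapP; exists P.
- rewrite map_poly_eq0 -size_poly_eq0 size_map_inj_poly ?size_poly_eq0 //.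
  exact: intr_inj.
(* P kills the residue eta, hence [y'] itself, as rational places are faithful on algebraic
   elements. *)
apply/eqP/eqP; apply: contraT => nz.
have [S [_ S1 hS]] := pdeg_stable hy'.
have alg : algebraicOver inc (map_poly inc (map_poly intr P)).[y'].
  exact: pdeg_algebraic (stable_pdeg S1 (oner_neq0 _) (stable_horner _ hS)).
have hp : polyR w (map_poly inc (map_poly intr P)).
  by move=> i; rewrite coef_map; exact: (hw _).1.
have := place_algebraic_neq0 (fun a => (hw a).1) alg nz (polyR_horner hp wy').1.
rewrite rational_place_horner // -map_poly_comp (eq_map_poly (g := intr)); last first.
  by move=> x /=; exact: ratr_int.
by rewrite -PE -/eta (eqP (root_minCpoly eta)) eqxx.
Qed.

End Northcott.

Lemma bounded_radicals_rat (K : closedFieldType) (inc : {rmorphism rat -> K}) :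
  [pchar K] =i pred0 -> bounded_radicals inc.
Proof.
move=> K0 l c D hc; have c0 i : c i != 0 by case: (hc i).
have [|S0 S01 hS0c] := monomials_stable (inc := inc) (c := c).
  by move=> j; case: (hc j).
(* Pigeonhole on the powers of [x], reduced modulo monomials to exponents in [0, n). *)
have [ys hys] := northcott K0 hc (size S0 * D)%N.
(* Divisible by every difference of two distinct indices up to [size ys]. *)
exists (size ys)`!; first exact: fact_gt0.
move=> x n e n0 hx ex.
have n0' : n%:Z != 0 by rewrite eqz_nat -lt0n.
pose g j : 'rV[int]_l := \row_i ((e *+ j)%R 0%R i %/ n)%Z.
pose r j : 'rV[int]_l := \row_i ((e *+ j)%R 0%R i %% n)%Z.
pose xx j := x ^+ j / mon c (g j).
have xn j : xx j ^+ n = mon c (r j).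
  rewrite expr_div_n exprAC ex -!monMn // -monB //; congr mon.
  apply/rowP => i; rewrite !mxE [(g j *+ n) _ _]mulmxnE mxE; set a := (e *+ j) 0 i.
  have -> : (a %/ n)%Z *+ n = (a %/ n)%Z * n by rewrite -mulr_natr natz.
  by rewrite {1}(divz_eq a n) addrC addKr.
have xin j : xx j \in ys.
  apply: (hys _ n (r j)) => //; last first.
    by move=> i; rewrite mxE modz_ge0 //= ltz_pmod // ltz_nat.
  by rewrite /xx -monN //; exact: pdeg_expr_mul.
have /(uniqPn 0) [i [j [lt_ij]]] : ~~ uniq [seq xx j | j <- iota 0 (size ys).+1].
  apply/negP => u; have /(uniq_leq_size u) : {subset [seq xx j | j <- iota 0 (size ys).+1] <= ys}.
    by move=> _ /mapP [j _ ->].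
  by rewrite size_map size_iota ltnn.
rewrite size_map size_iota => lt_j; have lt_i := ltn_trans lt_ij lt_j.
rewrite !(nth_map 0%N) ?size_iota // !nth_iota // !add0n => eij.
have x0 : x != 0.
  by apply: contraTneq (mon_neq0 c0 e) => x0; rewrite -ex x0 expr0n gtn_eqF // eqxx.
have xd : x ^+ (j - i) = mon c (g j - g i).
  have h : x ^+ j = x ^+ i / mon c (g i) * mon c (g j).
    by rewrite -/(xx i) eij divfK ?mon_neq0.
  apply: (mulIf (expf_neq0 i x0)); rewrite -exprD subnK ?(ltnW lt_ij) // h monB //.
  by rewrite [LHS]mulrAC [RHS]mulrC mulrA.
have /dvdnP [m ->] : (j - i %| (size ys)`!)%N.
  by apply: dvdn_fact; rewrite subn_gt0 lt_ij /= (leq_trans (leq_subr _ _)).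
by exists ((g j - g i) *+ m); rewrite mulnC exprM xd monMn.
Qed.

(** * Finitely generated fields *)

Section FieldGen.
Variable K : fieldType.
Implicit Types (S T : K -> Prop).

Lemma field_gen_sub S x y : field_gen S x -> field_gen S y -> field_gen S (x - y).
Proof. by move=> hx hy; apply: fg_add => //; exact: fg_opp. Qed.

Lemma sf_0 (T : subfield K) : sf_pred T 0.
Proof. by rewrite -(subrr 1); apply: sf_B; exact: sf_1. Qed.

Lemma sf_N (T : subfield K) x : sf_pred T x -> sf_pred T (- x).
Proof. by move=> hx; rewrite -sub0r; apply: sf_B => //; exact: sf_0. Qed.

Lemma sf_D (T : subfield K) x y : sf_pred T x -> sf_pred T y -> sf_pred T (x + y).
Proof. by move=> hx hy; rewrite -[y]opprK; apply: sf_B => //; exact: sf_N. Qed.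

Definition field_gen_subfield S : subfield K :=
  Subfield (fg_one S) (@field_gen_sub S) (@fg_mul K S) (@fg_inv K S).

Lemma field_gen_min S (T : subfield K) : (forall x, S x -> sf_pred T x) ->
  forall x, field_gen S x -> sf_pred T x.
Proof.
move=> h x; elim=> {x} [x /h //||x y _ hx _ hy|x _ hx|x y _ hx _ hy|x _ hx].
- exact: sf_1.
- exact: sf_D.
- exact: sf_N.
- exact: sf_M.
- exact: sf_V.
Qed.

Lemma field_gen_mono S T : (forall x, S x -> field_gen T x) ->
  forall x, field_gen S x -> field_gen T x.
Proof. by move=> h; exact: (@field_gen_min S (field_gen_subfield T)). Qed.

Lemma field_gen0 S : field_gen S 0.
Proof. by rewrite -(subrr 1); apply: field_gen_sub; exact: fg_one. Qed.

Lemma field_genX S x n : field_gen S x -> field_gen S (x ^+ n).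
Proof.
by move=> hx; elim: n => [|n IH]; rewrite ?expr0 ?exprS; [exact: fg_one|exact: fg_mul].
Qed.

Lemma field_gen_int S (z : int) : field_gen S z%:~R.
Proof.
have hn n : field_gen S n%:R.
  by elim: n => [|n IH]; rewrite ?mulrS; [exact: field_gen0|apply: fg_add => //; exact: fg_one].
by case: z => n; rewrite ?NegzE ?mulrNz -pmulrn; [|apply: fg_opp]; exact: hn.
Qed.

Lemma field_gen_horner S (F : fieldType) (inc : {rmorphism F -> K}) t (p : {poly F}) :
  (forall a, field_gen S (inc a)) -> field_gen S t -> field_gen S (map_poly inc p).[t].
Proof.
move=> hF ht; rewrite horner_map_coef; apply: big_ind => [||i _].
- exact: field_gen0.
- by move=> x y; exact: fg_add.
- by apply: fg_mul => //; exact: field_genX.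
Qed.

Lemma image_subfield (F : fieldType) (inc : {rmorphism F -> K}) :
  exists T : subfield K, forall x, sf_pred T x <-> exists y, x = inc y.
Proof.
unshelve eexists (@Subfield K (fun x => exists y, x = inc y) _ _ _ _) => //.
- by exists 1; rewrite rmorph1.
- by move=> _ _ [a ->] [b ->]; exists (a - b); rewrite rmorphB.
- by move=> _ _ [a ->] [b ->]; exists (a * b); rewrite rmorphM.
- by move=> _ [a ->]; exists a^-1; rewrite fmorphV.
Qed.

Lemma field_gen_map (k : fieldType) (phi : {rmorphism k -> K}) (S : k -> Prop) T :
  (forall x, S x -> T (phi x)) -> forall x, field_gen S x -> field_gen T (phi x).
Proof.
move=> h x; elim=> {x} [x /h hx||x y _ hx _ hy|x _ hx|x y _ hx _ hy|x _ hx].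
- exact: fg_in.
- by rewrite rmorph1; exact: fg_one.
- by rewrite rmorphD; exact: fg_add.
- by rewrite rmorphN; exact: fg_opp.
- by rewrite rmorphM; exact: fg_mul.
- by rewrite fmorphV; exact: fg_inv.
Qed.

End FieldGen.

Theorem bounded_radicals_fin_gen (K : closedFieldType) (gs : seq K) : [pchar K] =i pred0 ->
  exists (F : fieldType) (inc : {rmorphism F -> K}),
    (forall x, field_gen (fun y => y \in gs) x <-> exists y, x = inc y) /\ bounded_radicals inc.
Proof.
move=> K0; elim: gs => [|g gs [F [inc [hF R]]]].
  have [inc _] := rat_embedding K0; exists rat, inc; split; last exact: bounded_radicals_rat.
  have [T hT] := image_subfield inc.
  move=> x; split=> [hx|[r ->]].
    by apply/hT; apply: field_gen_min hx => y; rewrite in_nil.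
  rewrite (rat_frac r) rmorphM fmorphV !rmorph_int.
  by apply: fg_mul; [|apply: fg_inv]; exact: field_gen_int.
have [F' [inc' gen]] := simple_extension inc g.
exists F', inc'; split; last first.
  have [alg|tr] := pselect (algebraicOver inc g).
    exact: bounded_radicals_algebraic gen alg R.
  exact: bounded_radicals_transcendental gen tr K0 R.
have [h1 h2 h3] := gen; have [T hT] := image_subfield inc'.
have incg a : field_gen (fun y => y \in g :: gs) (inc a).
  apply: (@field_gen_mono _ (fun y => y \in gs)); last by apply/hF; exists a.
  by move=> x hx; apply: fg_in; rewrite in_cons hx orbT.
have gg : field_gen (fun y => y \in g :: gs) g by apply: fg_in; exact: mem_head.
move=> x; split=> [hx|[y ->]].
  apply/hT; apply: field_gen_min hx => y; rewrite in_cons => /predU1P [->|hy]; apply/hT.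
    by have [b <-] := h2; exists b.
  have /hF [a ->] : field_gen (fun y => y \in gs) y by exact: fg_in.
  by have [b <-] := h1 a; exists b.
have [p [q [_ ->]]] := h3 y.
by apply: fg_mul; [|apply: fg_inv]; exact: field_gen_horner.
Qed.

(** * Cyclotomic extensions *)

Section Cyclotomic.
Variables (F : fieldType) (K : closedFieldType) (inc : {rmorphism F -> K}).
Hypothesis K0 : [pchar K] =i pred0.

Lemma prim_root_exists n : (0 < n)%N -> exists z : K, n.-primitive_root z.
Proof.
move=> n0; pose p : {poly K} := 'X^n - 1; have [r Dp] := closed_field_poly_normal p.
rewrite (monicP _) ?monicXnsubC // scale1r in Dp.
have rn1: all n.-unity_root r by apply/allP=> z; rewrite -root_prod_XsubC -Dp.
have sz_r: (n < (size r).+1)%N.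
  by rewrite -(size_prod_XsubC r id) -Dp size_XnsubC.
have [|z] := hasP (has_prim_root n0 rn1 _ sz_r); last by exists z.
by rewrite -separable_prod_XsubC -Dp separable_Xn_sub_1 // pchar0_natr // -lt0n.
Qed.

Variables (N : nat) (Z : K) (mu : {poly F}).
Hypotheses (N0 : (0 < N)%N) (pZ : N.-primitive_root Z) (mu1 : (1 < size mu)%N).
Hypothesis hmu : forall p, (ev inc Z p == 0) = (mu %| p).

Lemma conj_root z p : root (map_poly inc mu) z -> ev inc Z p = 0 -> ev inc z p = 0.
Proof.
move=> /eqP rz /eqP; rewrite hmu => /dvdpP [q ->].
by rewrite evE rmorphM hornerM rz mulr0.
Qed.

Lemma conj_exp z : root (map_poly inc mu) z -> exists2 u, (0 < u)%N & z = Z ^+ u.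
Proof.
move=> rz; have /eqP : ev inc z ('X^N - 1) = 0.
  apply: (conj_root rz); rewrite rmorphB rmorphXn evX rmorph1.
  by rewrite (prim_expr_order pZ) subrr.
rewrite rmorphB rmorphXn evX rmorph1 subr_eq0 => /eqP /(prim_rootP pZ) [u ->].
exists (u + N)%N; first by rewrite addn_gt0 N0 orbT.
by rewrite exprD (prim_expr_order pZ) mulr1.
Qed.

(** Fixed field without Galois groups: the remainder of Y modulo mu, minus the constant Y(Z),
    vanishes at all roots of mu. These are distinct because X^N - 1 is separable, too many for a
    nonzero polynomial of degree below that of mu. *)
Lemma conj_fixed (Y : {poly F}) :
  (forall z, root (map_poly inc mu) z -> ev inc z Y = ev inc Z Y) ->
  exists a, ev inc Z Y = inc a.
Proof.
move=> hY; set y := ev inc Z Y in hY *.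
have mu0 : mu != 0 by rewrite -size_poly_gt0 ltnW.
have [rs Drs] := closed_field_poly_normal (map_poly inc mu).
have l0 : lead_coef (map_poly inc mu) != 0 by rewrite lead_coef_eq0 map_poly_eq0.
have srs : size rs = (size mu).-1.
  by rewrite -(size_map_poly inc) Drs size_scale // size_prod_XsubC.
have urs : uniq rs.
  rewrite -separable_prod_XsubC.
  apply: (@dvdp_separable _ ('X^N - 1)); last first.
    by apply: separable_Xn_sub_1; rewrite pchar0_natr // -lt0n.
  rewrite -(dvdpZl _ _ l0) -Drs.
  have -> : 'X^N - 1 = map_poly inc ('X^N - 1) by rewrite rmorphB /= map_polyXn rmorph1.
  rewrite dvdp_map -hmu rmorphB rmorphXn evX rmorph1.
  by rewrite (prim_expr_order pZ) subrr.
pose R := Y %% mu.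
have sR : (size R < size mu)%N by rewrite ltn_modp.
have hR : map_poly inc R = y%:P.
  apply/eqP; rewrite -subr_eq0; apply: contraT => nz.
  have all_r : all (root (map_poly inc R - y%:P)) rs.
    apply/allP => z zrs; have rz : root (map_poly inc mu) z.
      by rewrite Drs rootZ // root_prod_XsubC.
    rewrite /root !hornerE subr_eq0 -(hY z rz) {1}(divp_eq Y mu) rmorphD rmorphM.
    by rewrite [ev inc z mu](eqP rz) mulr0 add0r.
  have := max_poly_roots nz all_r urs; rewrite srs ltnNge; case/negP.
  apply: leq_trans (size_polyD _ _) _; rewrite size_polyN geq_max size_map_poly.
  rewrite -ltnS (ltn_predK mu1) sR /=; apply: leq_trans (size_polyC_leq1 _) _.
  by rewrite -ltnS (ltn_predK mu1).
exists R`_0; have := congr1 (fun p : {poly K} => p`_0) hR.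
by rewrite (coef_map inc) coefC eqxx => ->.
Qed.

Variables (g : {poly F}) (n : nat) (c : F).
Hypotheses (n0 : (0 < n)%N) (nN : (n %| N)%N) (b0 : ev inc Z g != 0).
Hypothesis bn : ev inc Z g ^+ n = inc c.
Local Notation b := (ev inc Z g).

(* [b ^+ u] divided by the conjugate [g(Z^u)] of [b] is invariant under conjugation,
   because the Galois group of a cyclotomic extension is abelian. *)
Lemma conj_ratio u : root (map_poly inc mu) (Z ^+ u) -> (0 < u)%N ->
  exists eta a, eta ^+ N = 1 /\ b ^+ u.-1 = eta * inc a.
Proof.
move=> ru u0; have c0 : c != 0 by rewrite -(fmorph_eq0 inc) -bn expf_neq0.
have c0' : inc c != 0 by rewrite fmorph_eq0.
have comp v p : ev inc Z (p \Po 'X^v) = ev inc (Z ^+ v) p.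
  by rewrite !evE map_comp_poly horner_comp map_polyXn hornerXn.
have conj v : root (map_poly inc mu) (Z ^+ v) ->
    exists f : nat, ev inc (Z ^+ v) g = Z ^+ f * b /\ (Z ^+ f) ^+ n = 1.
  move=> rv; have e : ev inc (Z ^+ v) (g ^+ n - c%:P) = 0.
    by apply: (conj_root rv); rewrite rmorphB rmorphXn evC bn subrr.
  have en : (ev inc (Z ^+ v) g / b) ^+ n = 1.
    rewrite expr_div_n bn; apply: (mulIf c0'); rewrite divfK // mul1r.
    by apply/eqP; rewrite -subr_eq0 -(rmorphXn (ev inc _)) -(evC inc (Z ^+ v)) -rmorphB e.
  have eN : (ev inc (Z ^+ v) g / b) ^+ N = 1.
    by have /dvdnP [k ->] := nN; rewrite mulnC exprM en expr1n.
  have [f hf] := prim_rootP pZ eN; exists f.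
  by rewrite -hf; split => //; rewrite divfK.
have [f [hf fn]] := conj u ru.
(* A polynomial form of b^u / g(Z^u): since g(Z^u)^n = c, the inverse of g(Z^u) is g(Z^u)^(n-1) /
   c. *)
pose Y := g ^+ u * (g \Po 'X^u) ^+ n.-1 * (c^-1)%:P.
have YE v : ev inc (Z ^+ v) Y =
    ev inc (Z ^+ v) g ^+ u * ev inc (Z ^+ (u * v)) g ^+ n.-1 / inc c.
  rewrite !rmorphM !rmorphXn evC fmorphV; congr (_ * _ ^+ _ / _).
  by rewrite !evE map_comp_poly horner_comp map_polyXn hornerXn -exprM mulnC.
have [|a ha] := @conj_fixed Y.
  move=> z rz; have [v v0 zE] := conj_exp rz; rewrite zE in rz *.
  have [k [hk kn]] := conj v rz.
  (* The conjugation sending Z to Z^u is applied to g(Z^v) = Z^k g(Z). *)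
  have huv : ev inc (Z ^+ (u * v)) g = Z ^+ (u * k) * ev inc (Z ^+ u) g.
    have e : ev inc Z ((g \Po 'X^v) - 'X^k * g) = 0.
      by rewrite rmorphB rmorphM rmorphXn evX comp hk subrr.
    have := conj_root ru e; rewrite rmorphB rmorphM rmorphXn evX.
    rewrite [X in X - _](_ : _ = ev inc (Z ^+ (u * v)) g); last first.
      by rewrite !evE map_comp_poly horner_comp map_polyXn hornerXn -exprM.
    by rewrite -exprM => /eqP; rewrite subr_eq0 => /eqP.
  rewrite -{2}[Z]expr1 !YE huv hk muln1 expr1; congr (_ / _).
  rewrite !exprMn mulrACA -[RHS]mul1r; congr (_ * _).
  have -> : (u * k = k * u)%N by rewrite mulnC.
  rewrite exprM -exprS prednK // -exprM mulnC exprM kn expr1n.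
  by [].
have ye : ev inc Z Y = b ^+ u.-1 * (Z ^+ f) ^+ n.-1.
  rewrite -{1}[Z]expr1 YE muln1 expr1 hf -bn exprMn -[in b ^+ u](prednK u0) exprS.
  rewrite -[in X in _ / X](prednK n0) exprS; field.
  by rewrite b0 expf_neq0.
exists (Z ^+ f), a; split; first by rewrite exprAC (prim_expr_order pZ) expr1n.
by rewrite -ha ye mulrCA -exprS prednK // fn mulr1.
Qed.

(** The exponents z with b^z in F up to an N-th root of unity form a group [J], generated by some d;
    put e = |d|. By [conj_ratio], e divides u - 1 for every conjugate Z^u, so Z^(N/e) is fixed: F
    contains a root of unity of order e, and e divides w. *)
Lemma cyclotomic_radical_prim w : (forall a r, (0 < r)%N -> a ^+ r = 1 :> F -> a ^+ w = 1) ->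
  exists eta a, eta ^+ N = 1 /\ b ^+ w = eta * inc a.
Proof.
move=> hw.
pose J (z : int) := exists eta a, eta ^+ N = 1 /\ b ^ z = eta * inc a.
have JB x y : J x -> J y -> J (x - y).
  move=> [e [a [eN ea]]] [e' [a' [eN' ea']]]; exists (e / e'), (a / a').
  rewrite expr_div_n eN eN' divr1; split => //.
  by rewrite expfzDr // -invr_expz ea ea' rmorphM fmorphV invfM mulrACA.
have J0 : J 0 by exists 1, 1; rewrite expr1n rmorph1 mulr1 expr0z.
have [||us [hus gen]] := @lattice_generators int 1 J (fun _ x => x) (conj J0 JB).
- by [].
- by move=> u _ /(_ ord0).
set d := us ord0 in hus gen; have Jd : J d := hus ord0.
have {}gen z : J z -> exists t, z = d * t.
  move=> /gen [t ->]; exists (t ord0).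
  by rewrite big_ord1 -/d -mulrzr intz.
have [t nt] : exists t, n%:Z = d * t.
  by apply: gen; exists 1, c; rewrite expr1n mul1r; split => //; exact: bn.
pose e := absz d.
have e0 : (0 < e)%N.
  rewrite absz_gt0; apply: contraTneq n0 => d0.
  by rewrite -ltz_nat nt d0 mul0r.
have dve z : J z -> (e %| absz z)%N.
  by move=> /gen [s ->]; rewrite abszM dvdn_mulr.
have /dvdnP [n' nE] : (e %| n)%N by apply: (dve n%:Z); exists 1, c; rewrite expr1n mul1r.
have /dvdnP [m NE] := nN.
pose k := (m * n')%N.
have NkE : N = (k * e)%N by rewrite NE nE mulnA.
have [|a ha] := @conj_fixed 'X^k.
  move=> z rz; have [u u0 zE] := conj_exp rz; rewrite zE in rz *.
  have /dve : J (u.-1)%:Z by exact: conj_ratio.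
  rewrite absz_nat => /dvdnP [s us'].
  rewrite !rmorphXn !evX -(prednK u0) us' -exprM mulSn exprD.
  by rewrite -mulnA [(e * k)%N]mulnC -NkE mulnC exprM (prim_expr_order pZ) expr1n mulr1.
rewrite rmorphXn evX in ha.
have aw : a ^+ w = 1.
  apply: (hw _ e e0); apply: (fmorph_inj inc).
  by rewrite rmorphXn rmorph1 -ha -exprM -NkE (prim_expr_order pZ).
have : Z ^+ (k * w) = 1 by rewrite exprM ha -rmorphXn aw rmorph1.
move/eqP; rewrite -(prim_order_dvd pZ) NkE dvdn_pmul2l => [/dvdnP [s ->]|]; last first.
  by rewrite lt0n; apply: contraTneq N0 => k0; rewrite NkE k0.
have [eta [a' [etaN be]]] : J e%:Z.
  have [->|->] : e%:Z = d \/ e%:Z = 0 - d.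
    by rewrite sub0r /e; case: (d) => r; [left|right; rewrite NegzE opprK].
    by [].
  exact: JB.
exists (eta ^+ s), (a' ^+ s); rewrite (exprAC eta) -NkE etaN expr1n; split => //.
by rewrite mulnC exprM [b ^+ e]be exprMn rmorphXn.
Qed.

End Cyclotomic.

Lemma cyclotomic_radical (F : fieldType) (K : closedFieldType) (inc : {rmorphism F -> K})
    w m n zeta (g : {poly F}) c :
  [pchar K] =i pred0 -> (forall a r, (0 < r)%N -> a ^+ r = 1 :> F -> a ^+ w = 1) ->
  (0 < m)%N -> zeta ^+ m = 1 -> (0 < n)%N -> ev inc zeta g != 0 -> ev inc zeta g ^+ n = inc c ->
  exists N eta a, [/\ (0 < N)%N, eta ^+ N = 1 & ev inc zeta g ^+ w = eta * inc a].
Proof.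
move=> K0 hw m0 zm n0 b0 bn.
(* The order m n, rather than m, makes the n-th roots of unity powers of Z. *)
have N0 : (0 < m * n)%N by rewrite muln_gt0 m0.
have [Z pZ] := prim_root_exists K0 N0.
have zN : zeta ^+ (m * n) = 1 by rewrite exprM zm expr1n.
have [k zE] := prim_rootP pZ zN.
have gE : ev inc zeta g = ev inc Z (g \Po 'X^k).
  by rewrite !evE map_comp_poly horner_comp map_polyXn hornerXn zE.
have algZ : algebraicOver inc Z.
  exists ('X^(m * n) - 1); first by rewrite -size_poly_eq0 size_XnsubC.
  by rewrite rmorphB /= map_polyXn rmorph1 /root !hornerE (prim_expr_order pZ) subrr.
have [mu [_ mu1 hmu]] := min_poly_exists algZ.
rewrite gE in b0 bn *.
have [|eta [a [etaN e]]] := cyclotomic_radical_prim K0 N0 pZ mu1 hmu n0 _ b0 bn hw.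
  exact: dvdn_mull.
by exists (m * n)%N, eta, a.
Qed.

(** * Finitely generated groups and roots of unity *)

Section FinGenSubgroups.
Variable A : zmodType.

Definition combination (gs : seq A) (e : 'rV[int]_(size gs)) : A :=
  \sum_(i < size gs) gs`_i *~ e 0 i.
Arguments combination gs e : clear implicits.

Fact combination_is_zmod_morphism gs : zmod_morphism (combination gs).
Proof.
move=> x y; rewrite -sumrB; apply: eq_bigr => i _.
by rewrite !mxE mulrzBr.
Qed.
HB.instance Definition _ gs :=
  GRing.isZmodMorphism.Build _ A (combination gs) (@combination_is_zmod_morphism gs).

Lemma fg_subgroupP (U : A -> Prop) : fg_subgroup U ->
  exists gs, forall x, U x <-> exists e, x = combination gs e.
Proof.
move=> [gs h]; exists gs => x; rewrite h; split=> [[c ->]|[e ->]].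
  by exists (\row_i c i); apply: eq_bigr => i _; rewrite mxE.
exists (fun i => if insub i is Some j then e 0 j else 0).
by apply: eq_bigr => i _; rewrite valK.
Qed.

Lemma fg_subgroup_is_subgroup (U : A -> Prop) : fg_subgroup U -> is_subgroup U.
Proof.
move=> [gs h]; split; first by apply/h; exists (fun=> 0); rewrite big1.
move=> x y /h [c ->] /h [d ->]; apply/h; exists (fun i => c i - d i).
by rewrite -sumrB; apply: eq_bigr => i _; rewrite mulrzBr.
Qed.

Lemma subgroupMn (U : A -> Prop) x n : is_subgroup U -> U x -> U (x *+ n).
Proof.
move=> [U0 UB] hx; have UN : U (- x) by rewrite -sub0r; exact: UB.
by elim: n => [|n IH]; rewrite ?mulr0n // mulrSr -[X in _ + X]opprK; exact: UB.
Qed.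

(** Multiplication by N embeds U into C. As the generators of C may satisfy relations, the argument
    runs on exponent vectors: those representing elements of N U form a lattice, whose generators
    divided by N generate U. *)
Lemma fg_of_bounded_exponent (C U : A -> Prop) N : torsion_free A -> is_subgroup U ->
  fg_subgroup C -> (0 < N)%N -> (forall a, U a -> C (a *+ N)) -> fg_subgroup U.
Proof.
move=> tf [U0 UB] /fg_subgroupP [gs hC] N0 hN.
pose V e := exists2 a, U a & a *+ N = combination gs e.
have [|||us [hus gen]] := @lattice_generators _ (size gs) V (fun i e => e 0 i).
- split; first by exists 0; rewrite ?mul0rn ?raddf0.
  move=> x y [a Ua ha] [b Ub hb]; exists (a - b); first exact: UB.
  by rewrite mulrnBl ha hb raddfB.
- by move=> i x y; rewrite !mxE.
- by move=> u _ h; apply/rowP => i; rewrite h mxE.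
have h i : exists a, U a /\ a *+ N = combination gs (us i) by have [a] := hus i; exists a.
have [a ha] := choice h.
have UMz x (z : int) : U x -> U (x *~ z).
  move=> hx; have UMn n : U (x *+ n) := subgroupMn n (conj U0 UB) hx.
  by case: z => n; rewrite ?NegzE ?mulrNz -pmulrn // -sub0r; exact: UB.
exists (codom a) => x; split=> [Ux|[c ->]]; last first.
  apply: big_ind => [//|y z hy hz|i _].
    by rewrite -[z]opprK -[- z]sub0r; apply/UB/UB.
  apply: UMz; have /codomP [j ->] : (codom a)`_i \in codom a by exact: mem_nth.
  by case: (ha j).
have /hC [e he] := hN x Ux.
have [|z hz] := gen e; first by exists x.
exists (fun i => if insub i is Some j then z j else 0).
rewrite -(big_mkord xpredT (fun i => (codom a)`_i *~ (if insub i is Some j then z j else 0))).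
rewrite size_codom card_ord big_mkord.
rewrite (eq_bigr (fun i => a i *~ z i)) => [|i _]; last first.
  by rewrite valK (nth_map i) ?size_enum_ord // nth_ord_enum.
apply/eqP; rewrite -subr_eq0; apply/eqP; apply: (tf _ N N0).
rewrite mulrnBl he hz raddf_sum -sumrMnl; apply/eqP; rewrite subr_eq0; apply/eqP.
apply: eq_bigr => i _; rewrite raddfMz [X in X *~ _](_ : _ = a i *+ N); last by rewrite (ha i).2.
by rewrite !pmulrn mulrzAC.
Qed.

End FinGenSubgroups.
Arguments combination {A} gs e.

(** Write l = l' p^j with l' prime to p. By Bezout z is a product of powers of z^(p^(j+1)), itself a
    power of z^p, and of z^l', which has p-power order. The exponent j + 1 stays positive when p
    does not divide l. *)
Lemma prime_power_root_mem (K : fieldType) (T : subfield K) p l (z : K) : prime p ->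
  (forall y j, (0 < j)%N -> y ^+ (p ^ j) = 1 -> sf_pred T y) ->
  (0 < l)%N -> z ^+ l = 1 -> sf_pred T (z ^+ p) -> sf_pred T z.
Proof.
move=> pp hT l0 zl zp.
have TX x n : sf_pred T x -> sf_pred T (x ^+ n).
  by move=> hx; elim: n => [|n IH]; rewrite ?exprS; [exact: sf_1|exact: sf_M].
have [l' cop lE] := pfactor_coprime pp l0; set j := logn p l in lE.
have z1 : (z ^+ l') ^+ (p ^ j.+1) = 1.
  by rewrite -exprM expnSr mulnA -lE exprM zl expr1n.
have z2 : sf_pred T (z ^+ (p ^ j.+1)) by rewrite expnS exprM; exact: TX.
have z0 : z != 0.
  by apply: contra_eq_neq zl => ->; rewrite expr0n gtn_eqF // eq_sym oner_neq0.
have p0 : (0 < p ^ j.+1)%N by rewrite expn_gt0 prime_gt0.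
have [u v e _] := egcdnP l' p0.
have /eqP g1 : coprime (p ^ j.+1) l' by rewrite coprimeXl.
rewrite g1 in e.
have -> : z = (z ^+ (p ^ j.+1)) ^+ u / (z ^+ l') ^+ v.
  rewrite -!exprM [(_ * u)%N]mulnC e exprD [(l' * v)%N]mulnC expr1 mulrC mulKf //.
  by rewrite expf_neq0.
apply: sf_M; first exact: TX.
by apply/sf_V/TX; exact: hT z1.
Qed.

Lemma root_of_unity_mem (K : fieldType) (T : subfield K) q l (z : K) :
  (forall p y j, prime p -> (p %| q)%N -> (0 < j)%N -> y ^+ (p ^ j) = 1 -> sf_pred T y) ->
  (0 < q)%N -> (0 < l)%N -> z ^+ l = 1 -> sf_pred T (z ^+ q) -> sf_pred T z.
Proof.
move=> hT; have [n] := ubnP q; elim: n q z hT => // n IH q z hT lt_q q0 l0 zl zq.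
have [q1|q1] := eqVneq q 1%N; first by rewrite q1 expr1 in zq.
have qgt1 : (1 < q)%N by rewrite ltn_neqAle eq_sym q1.
have pp := pdiv_prime qgt1; have dvp := pdiv_dvd q.
have [r qE] := dvdnP dvp; set p := pdiv q in pp dvp qE.
have r0 : (0 < r)%N by move: q0; rewrite qE muln_gt0 => /andP [].
apply: (IH r) => //.
- move=> p' y j pp' d; apply: hT => //; rewrite qE; exact: dvdn_mulr.
- rewrite ltnS in lt_q; apply: leq_trans lt_q; rewrite qE.
  by rewrite -[X in (X < _)%N]muln1 ltn_pmul2l // prime_gt1.
apply: (@prime_power_root_mem _ _ p l) => //.
- by move=> y j; exact: hT.
- by rewrite exprAC zl expr1n.
by rewrite -exprM -qE.
Qed.

Section CyclotomicSubfield.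
Variables (F : fieldType) (K : closedFieldType) (inc : {rmorphism F -> K}).
Hypothesis K0 : [pchar K] =i pred0.

Lemma cyclotomic_subfield : exists T : subfield K, forall z, sf_pred T z <->
  exists m zeta (g : {poly F}), [/\ (0 < m)%N, zeta ^+ m = 1 & z = ev inc zeta g].
Proof.
pose Q z := exists m zeta (g : {poly F}), [/\ (0 < m)%N, zeta ^+ m = 1 & z = ev inc zeta g].
have common x y : Q x -> Q y -> exists m zeta (g h : {poly F}),
    [/\ (0 < m)%N, zeta ^+ m = 1, x = ev inc zeta g & y = ev inc zeta h].
  move=> [m [z [g [m0 zm ->]]]] [m' [z' [g' [m0' zm' ->]]]].
  have N0 : (0 < m * m')%N by rewrite muln_gt0 m0.
  have [Z pZ] := prim_root_exists K0 N0.
  have [i ->] : {i : 'I_(m * m') | z = Z ^+ i}.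
    by apply: (prim_rootP pZ); rewrite exprM zm expr1n.
  have [j ->] : {j : 'I_(m * m') | z' = Z ^+ j}.
    by apply: (prim_rootP pZ); rewrite mulnC exprM zm' expr1n.
  exists (m * m')%N, Z, (g \Po 'X^i), (g' \Po 'X^j).
  by rewrite (prim_expr_order pZ) !evE !map_comp_poly !horner_comp !map_polyXn !hornerXn.
have Q1 : Q 1 by exists 1%N, 1, 1; rewrite expr1n rmorph1.
have QB x y : Q x -> Q y -> Q (x - y).
  move=> hx hy; have [m [z [g [h [m0 zm -> ->]]]]] := common _ _ hx hy.
  by exists m, z, (g - h); rewrite rmorphB.
have QM x y : Q x -> Q y -> Q (x * y).
  move=> hx hy; have [m [z [g [h [m0 zm -> ->]]]]] := common _ _ hx hy.
  by exists m, z, (g * h); rewrite rmorphM.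
have QV x : Q x -> Q x^-1.
  move=> [m [z [g [m0 zm ->]]]].
  have [N hz] : exists N, pdeg inc N z.
    exists m, ('X^m - 1); rewrite size_XnsubC // -size_poly_eq0 size_XnsubC //.
    by rewrite rmorphB /= map_polyXn rmorph1 /root !hornerE zm subrr.
  have [S [_ S1 hS]] := pdeg_stable hz.
  have hg : stable inc S (ev inc z g) by exact: stable_horner.
  have [q ->] := algebraic_inv_horner (pdeg_algebraic (stable_pdeg S1 (oner_neq0 _) hg)).
  by exists m, z, (q \Po g); rewrite !evE map_comp_poly horner_comp.
by exists (Subfield Q1 QB QM QV).
Qed.

End CyclotomicSubfield.

Section MultiplicativeGroups.
Variables (A : zmodType) (K : closedFieldType) (chi : A -> K).
Hypotheses (K0 : [pchar K] =i pred0) (tfA : torsion_free A).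
Hypotheses (chi0 : chi 0 = 1) (chiD : forall a b, chi (a + b) = chi a * chi b).
Hypothesis chi_inj : forall a, chi a = 1 -> a = 0.
Variables (F : fieldType) (inc : {rmorphism F -> K}) (C : A -> Prop).
Hypotheses (radF : bounded_radicals inc) (fgC : fg_subgroup C) (dC : dense C).
Hypothesis CF : forall a, C a -> exists x, chi a = inc x.

Lemma roots_of_unity_exponent : exists2 w, (0 < w)%N &
  forall a r, (0 < r)%N -> a ^+ r = 1 :> F -> a ^+ w = 1.
Proof.
have [[] //|M M0 hM] := radF (c := fun _ : 'I_0 => 1) 1.
exists M => // a r r0 ar.
have [||e] := hM (inc a) r 0 r0.
- exists ('X - a%:P); rewrite polyXsubC_eq0 size_XsubC; split => //.
  by rewrite rmorphB /= map_polyX map_polyC root_XsubC.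
- by rewrite mon0 -rmorphXn ar rmorph1.
by rewrite /mon big_ord0 -rmorphXn => e1; apply: (fmorph_inj inc); rewrite rmorph1.
Qed.

(* Schinzel's argument descends a power of [chi a] to F at a bounded cost; there
   the radicals of the finitely generated group chi C have bounded exponent. *)
Lemma cyclotomic_bounded_exponent (T : subfield K) :
  (forall z, sf_pred T z -> exists m zeta (g : {poly F}),
     [/\ (0 < m)%N, zeta ^+ m = 1 & z = ev inc zeta g]) ->
  exists2 N, (0 < N)%N & forall a, sf_pred T (chi a) -> C (a *+ N).
Proof.
move=> hT; have [w w0 hw] := roots_of_unity_exponent.
have [gs hC] := fg_subgroupP fgC.
have Cgs i : (i < size gs)%N -> C gs`_i.
  move=> lt; apply/hC; exists (delta_mx 0 (Ordinal lt)).
  rewrite /combination (bigD1 (Ordinal lt)) //= mxE !eqxx big1 ?addr0 // => j nj.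
  by rewrite mxE (negPf nj) mulr0z.
pose c (i : 'I_(size gs)) := chi gs`_i.
have c0 i : c i != 0 by exact: exphom_neq0.
have chi_mon e : chi (combination gs e) = mon c e.
  by rewrite /combination exphom_sum //; apply: eq_bigr => i _; rewrite exphomMz.
have [|M M0 hM] := radF (c := c) 1.
  move=> i; split => //; have [x hx] := CF (Cgs i (ltn_ord i)).
  by rewrite /c hx; exact: algebraic_id.
exists (w * M)%N; first by rewrite muln_gt0 w0.
move=> a /hT [m [z [g [m0 zm ea]]]].
have [n [n0 Cn]] := dC (I : (fun _ : A => True) a).
have [x hx] := CF Cn; rewrite exphomMn // ea in hx.
have [|N [eta [y [N0 etaN hy]]]] := @cyclotomic_radical _ _ inc w m n z g x K0 hw m0 zm n0 _ hx.
  by rewrite -ea; exact: exphom_neq0.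
have eta0 : eta != 0.
  by apply: contra_eq_neq etaN => ->; rewrite expr0n gtn_eqF // eq_sym oner_neq0.
have sgC := fg_subgroup_is_subgroup fgC.
(* The power N removes eta: y^(n N) is the value of n w N a, a monomial in the generators of C, so y
   is a radical lying in F. *)
have /hC [e he] : C (a *+ n *+ (w * N)) by exact: subgroupMn.
have [|||e' he'] := hM (inc y) (n * N)%N e.
- by rewrite muln_gt0 n0.
- exists ('X - y%:P); rewrite polyXsubC_eq0 size_XsubC; split => //.
  by rewrite rmorphB /= map_polyX map_polyC root_XsubC.
- rewrite -chi_mon -he -mulrnA mulnCA exphomMn // [RHS]exprM ea hy exprMn.
  by rewrite [(n * N)%N]mulnC (exprM eta) etaN expr1n mul1r.
(* The images of w M a and of the combination [e'] differ by eta^M, an N-th root of unity.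
   Multiplying by N, injectivity of [chi] and torsion-freeness make the two elements equal. *)
apply/hC; exists e'; apply/eqP; rewrite -subr_eq0; apply/eqP.
apply: (tfA N0); apply: chi_inj.
rewrite exphomMn // exphomB // chi_mon -he' exphomMn // exprM ea hy [(eta * _) ^+ M]exprMn mulfK.
  by rewrite exprAC etaN expr1n.
by rewrite he' mon_neq0.
Qed.

End MultiplicativeGroups.

Theorem theorem3p3
  (k : fieldType) (A : zmodType) (P : grpalg k A -> Prop)
  (Om : closedFieldType) (phi : {rmorphism k -> Om}) (chi : A -> Om)
  (C D : A -> Prop) :
  fin_gen_field k -> [pchar k] =i pred0 ->
  torsion_free A -> minimax A ->
  ga_prime_ideal P -> ga_faithful P ->
  (* chi : A -> Om^* is a group homomorphism, and the induced k-algebra map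
     kA -> Om has kernel exactly P, i.e. it is the natural map
     kA -> kA/P = R -> h (field of fractions) -> algebraic closure of h *)
  chi 0 = 1 -> (forall a b, chi (a + b) = chi a * chi b) ->
  (forall x, P x <-> ga_eval phi chi x = 0) ->
  fg_subgroup C -> dense C ->
  is_subgroup D -> (forall c, D c -> C c) -> dense_in C D ->
  let tau := fun z : Om =>
    (exists p n : nat, [/\ pi_quot C p, (0 < n)%N & z ^+ (p ^ n) = 1])
    \/ 4.-primitive_root z in
  let s := field_gen (fun z : Om =>
    [\/ exists x, z = phi x, tau z | exists2 c, C c & z = chi c]) in
  let B := fun a : A => s (chi a) in
  let ts := fun z : Om => s z /\ exists n : nat, (0 < n)%N /\ z ^+ n = 1 in
  let d := field_gen (fun z : Om =>
    [\/ exists x, z = phi x, exists2 c, D c & z = chi c | ts z]) in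
  let H := fun a : A => d (chi a) in
  ((fg_subgroup B /\ dense B) /\ (fg_subgroup H /\ dense H)
     /\ (forall a, H a -> B a))
  /\ (controls B P /\ controls H P).
Proof.
move=> [ks hks] k0 tf _ _ faith chi0 chiD kerP fgC dC sgD DC dD tau s B ts d H.
have Om0 : [pchar Om] =i pred0 by move=> p; rewrite (fmorph_pchar phi) k0.
have sgC := fg_subgroup_is_subgroup fgC.
(* If chi a = 1, then a - 1 lies in P and faithfulness applies. *)
have chi_inj a : chi a = 1 -> a = 0.
  move=> ca; apply: faith; exists (ga_add (ga_of k a) (ga_shift (-1) 0 (ga1 k A))).
    apply/kerP; rewrite ga_evalD ga_eval_shift // !ga_eval_of chi0 ca rmorphN1.
    by rewrite !mulr1 subrr.
  by apply/fsfunP => b; rewrite !ga_addE ga_shiftE subr0; ring.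
have s_phi x : s (phi x) by apply: fg_in; apply: Or31; exists x.
have s_C c : C c -> s (chi c) by move=> hc; apply: fg_in; apply: Or33; exists c.
have s_tau z : tau z -> s z by move=> hz; apply: fg_in; exact: Or32.
have d_phi x : d (phi x) by apply: fg_in; apply: Or31; exists x.
have d_D c : D c -> d (chi c) by move=> hc; apply: fg_in; apply: Or32; exists c.
have d_s x : d x -> s x.
  by apply: field_gen_mono => z [[y ->]|[c /DC hc ->]|[sz _]];
    [exact: s_phi|exact: s_C|exact: sz].
pose sS := field_gen_subfield (fun z : Om =>
  [\/ exists x, z = phi x, tau z | exists2 c, C c & z = chi c]).
pose dS := field_gen_subfield (fun z : Om =>
  [\/ exists x, z = phi x, exists2 c, D c & z = chi c | ts z]).
have [cs hC] := fg_subgroupP fgC.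
pose gs := [seq phi x | x <- ks] ++ [seq chi c | c <- cs].
have [F [inc [hF radF]]] := bounded_radicals_fin_gen gs Om0.
have phiF x : exists y, phi x = inc y.
  apply/hF; apply: field_gen_map (hks x) => z hz.
  by rewrite mem_cat map_f.
have CF a : C a -> exists y, chi a = inc y.
  move=> /hC [e ->]; apply/hF; rewrite /combination exphom_sum //.
  apply: big_ind => [|x y|i _]; [exact: fg_one|exact: fg_mul|].
  have hi : field_gen (fun y => y \in gs) (chi cs`_i).
    by apply: fg_in; rewrite mem_cat map_f ?orbT // mem_nth.
  rewrite exphomMz //; case: (e 0 i) => n; first exact: field_genX.
  by rewrite NegzE -exprnN; apply/fg_inv/field_genX.
(* [T] is the union of the cyclotomic extensions of F = k(C); it contains s because tau consists of
   roots of unity. *)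
have [T hT] := cyclotomic_subfield inc Om0.
have s_T z : s z -> sf_pred T z.
  have incT y : sf_pred T (inc y).
    by apply/hT; exists 1%N, 1, y%:P; rewrite expr1n evC.
  apply: field_gen_min => u [[x ->]|hu|[c hc ->]].
  - by have [y ->] := phiF x.
  - have [m m0 um] : exists2 m, (0 < m)%N & u ^+ m = 1.
      case: hu => [[p [n [[pp _] _ e]]]|pr]; last by exists 4%N; rewrite ?(prim_expr_order pr).
      by exists (p ^ n)%N; rewrite // expn_gt0 prime_gt0.
    by apply/hT; exists m, u, 'X; rewrite evX.
  - by have [y ->] := CF c hc.
have [N N0 hN] : exists2 N, (0 < N)%N & forall a, B a -> C (a *+ N).
  have [|N N0 hN] := cyclotomic_bounded_exponent Om0 tf chi0 chiD chi_inj radF fgC dC CF (T := T).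
    by move=> z /hT.
  by exists N => // a /s_T; exact: hN.
have sub_sg (S : subfield Om) : is_subgroup (fun a => sf_pred S (chi a)).
  split; first by rewrite chi0; exact: sf_1.
  by move=> x y hx hy; rewrite exphomB //; apply: sf_M => //; exact: sf_V.
have dH : dense H.
  move=> a aT; have [n [n0 Cn]] := dC a aT; have [m [m0 Dm]] := dD _ Cn.
  by exists (n * m)%N; rewrite muln_gt0 n0 mulrnA; split => //; exact: d_D.
have s_root a x n : s x -> (0 < n)%N -> (chi a * x) ^+ n = 1 -> s (chi a * x).
  (* Let q be the order of a modulo C. Then (chi a x)^q lies in s, and every prime dividing q is in
     pi(A/C), so its p-power roots of unity lie in tau. *)
  move=> sx n0 e; pose good q := (0 < q)%N && `[< C (a *+ q) >].
  have ex : exists q, good q.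
    by have [q [q0 Cq]] := dC a I; exists q; rewrite /good q0; apply/asboolP.
  case: (ex_minnP ex) => q /andP [q0 /asboolP Cq] min_q.
  apply: (@root_of_unity_mem _ sS q n) => //; last first.
    rewrite exprMn -exphomMn //; apply: fg_mul; first exact: s_C.
    exact: field_genX.
  move=> p y j pp dv j0 ye; apply: s_tau; left; exists p, j; split => //; split => //.
  exists a, q; split => // m m0 lt_m Cm.
  by have := min_q m; rewrite leqNgt lt_m /good m0 => /(_ (asboolT Cm)).
split; [split; [|split; [|]]|split].
- split; first exact: fg_of_bounded_exponent tf (sub_sg sS) fgC N0 hN.
  by move=> a aT; have [n [n0 Cn]] := dC a aT; exists n; split => //; exact: s_C.
- split => //; apply: fg_of_bounded_exponent tf (sub_sg dS) fgC N0 _ => a /d_s.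
  exact: hN.
- by move=> a /d_s.
- apply: (controls_kernel Om0 chi0 chiD kerP (K := sS)) => // a.
  by have [m [m0 Cm]] := dC a I; exists m => //; rewrite -exphomMn //; exact: s_C.
- apply: (controls_kernel Om0 chi0 chiD kerP (K := dS)) => // a.
    by have [m [m0 Hm]] := dH a I; exists m => //; rewrite -exphomMn.
  (* By [s_root] this root of unity lies in s, hence among those adjoined to form d. *)
  move=> x n dx n0 e; apply: fg_in; apply: Or33; split; first exact: s_root (d_s _ dx) n0 e.
  by exists n.
Qed.
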